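(* Let $X$ be a log-concave random vector in $\mathbb{R}^d$ and let $W$ be a radially-symmetric log-concave random vector in $\mathbb{R}^d$ independent of $X$. Then for any affine contraction $T:\mathbb{R}^d\to\mathbb{R}^d$, $$f_{X+W}\preceq f_{T(X)+W},$$ and consequently $h_\alpha(T(X)+W)\le h_\alpha(X+W)$ for all $\alpha\in(0,\infty)$.
   Context: An affine contraction is a map $T(x)=Ax+b$ with $A$ linear and $b\in\mathbb{R}^d$ fixed, that is $1$-Lipschitz for the Euclidean norm. $f_Y$ denotes the density of a random vector $Y$ with respect to Lebesgue measure on $\mathbb{R}^d$. A random vector is log-concave if it has a density of the form $e^{-\phi}$ with $\phi:\mathbb{R}^d\to(-\infty,\infty]$ convex. Rényi entropy: for $Y$ with density $f$, $h_\alpha(Y)=\frac{1}{1-\alpha}\log\int_{\mathbb{R}^d} f^\alpha$ for $\alpha\in(0,1)\cup(1,\infty)$, and $h_1(Y)=-\int f\log f$ (natural logarithm). Rearrangement and majorization: for a Borel set $A$ of positive finite volume, $A^*$ is the open Euclidean ball centered at $0$ with the same volume as $A$. For a nonnegative measurable $f$ vanishing at infinity, its symmetrically decreasing rearrangement $f^*$ is the (a.e. unique) function with $\{f^*>t\}=\{f>t\}^*$ for all $t>0$. For probability densities $f,g$ on $\mathbb{R}^d$, $f\preceq g$ (''$f$ is majorized by $g$'') means $\int_{B(0,r)}f^*\,dx\le\int_{B(0,r)}g^*\,dx$ for all $r>0$, where $B(0,r)$ is the open Euclidean ball of radius $r$ centered at $0$. *)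

(* Defs.v *)
From HB Require Import structures.
From mathcomp Require Import all_boot all_order all_algebra.
From mathcomp Require Import all_classical all_reals all_analysis.

Set Implicit Arguments.
Unset Strict Implicit.
Unset Printing Implicit Defensive.

Import Order.TTheory GRing.Theory Num.Theory.
Import numFieldNormedType.Exports.

Local Open Scope classical_set_scope.
Local Open Scope ring_scope.

(* R^n is 'cV[R]_n, equipped with the Borel sigma-algebra of its topology. *)

Definition cV_display : measure_display.
Proof. exact: default_measure_display. Qed.

Section cV_borel.
Variables (R : realType) (n : nat).

Let borel0 : <<s @open 'cV[R]_n >> set0.
Proof. exact: sigma_algebra0. Qed.

Let borelC A : <<s @open 'cV[R]_n >> A -> <<s @open 'cV[R]_n >> (~` A).
Proof. exact: sigma_algebraC. Qed.

Let borel_bigcup (F : (set 'cV[R]_n)^nat) :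
  (forall i, <<s @open 'cV[R]_n >> (F i)) ->
  <<s @open 'cV[R]_n >> (\bigcup_i F i).
Proof. exact: sigma_algebra_bigcup. Qed.

HB.instance Definition _ := @isMeasurable.Build cV_display 'cV[R]_n
  <<s @open 'cV[R]_n >> borel0 borelC borel_bigcup.

End cV_borel.

Section cV_measurable.
Variables (R : realType).

Lemma open_cV_measurable n (U : set 'cV[R]_n) : open U -> measurable U.
Proof. exact: sub_sigma_algebra. Qed.

Lemma measurable_coord n (i : 'I_n) :
  measurable_fun [set: 'cV[R]_n] (fun x : 'cV[R]_n => x i 0 : R).
Proof.
apply: (measurability _ (measurable_realfun.RGenOpens.measurableE R)).
move=> _ [_ [a [b ->]] <-]; rewrite setTI; apply: open_cV_measurable.
apply: open_comp; last exact: interval_open.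
by move=> x _; exact: coord_continuous.
Qed.

Let box n (q : 'cV[rat]_n * 'cV[rat]_n) : set 'cV[R]_n :=
  [set y | forall i, ratr (q.1 i 0) < y i 0 < ratr (q.2 i 0)].

Lemma open_bigcup_box n (U : set 'cV[R]_n) : open U ->
  U = \bigcup_(q in [set q | @box n q `<=` U]) box q.
Proof.
move=> oU; apply/seteqP; split=> [x Ux|x [q qU qx]]; last exact: qU.
have : nbhs x U by exact: open_nbhs_nbhs.
case=> P xP PU.
have /choice[q qP] (i : 'I_n) : exists q : rat * rat,
    ratr q.1 < x i 0 < ratr q.2 /\
    forall y : R, ratr q.1 < y < ratr q.2 -> P i 0 y.
  have /nbhs_ballP[e /= e0 eP] := xP i 0.
  have [q1 q1P] : exists q : rat, ratr q \in `](x i 0 - e), (x i 0)[.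
    by apply: rat_in_itvoo; rewrite ltrBlDr ltrDl.
  have [q2 q2P] : exists q : rat, ratr q \in `](x i 0), (x i 0 + e)[.
    by apply: rat_in_itvoo; rewrite ltrDl.
  move: q1P q2P; rewrite !in_itv/= => /andP[a1 a2] /andP[b1 b2].
  exists (q1, q2); split => /=; first by rewrite a2 b1.
  move=> y /andP[y1 y2]; apply: eP; rewrite /ball/= ltr_distlC.
  by rewrite (lt_trans a1 y1) (lt_trans y2 b2).
exists (\col_i (q i).1, \col_i (q i).2).
  move=> y /= yq; apply: PU => i j; rewrite ord1.
  by apply: (qP i).2; have := yq i; rewrite !mxE.
by move=> i /=; rewrite !mxE; exact: (qP i).1.
Qed.

Lemma measurable_fun_cVP d (T : measurableType d) n (f : T -> 'cV[R]_n) :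
  (forall i, measurable_fun [set: T] (fun t => f t i 0 : R)) ->
  measurable_fun [set: T] f.
Proof.
move=> mf; apply: (measurability (@open 'cV[R]_n)) => // _ [U oU <-].
rewrite setTI (open_bigcup_box oU) preimage_bigcup bigcup_mkcond.
apply: countable_bigcupT_measurable; first exact: countableP.
move=> q; case: ifPn => // _.
rewrite (_ : _ @^-1` _ = \bigcap_(i in [set: 'I_n])
    (fun t => f t i 0) @^-1` `]ratr (q.1 i 0), ratr (q.2 i 0)[%classic).
  apply: fin_bigcap_measurable => // i _; rewrite -[X in measurable X]setTI.
  by apply: mf => //; exact: measurable_itv.
apply/seteqP; split=> t /= h i; have := h i; first by move=> ? _; rewrite /= in_itv.
by rewrite /= in_itv; apply.
Qed.

Definition cV_cons n (p : R * 'cV[R]_n) : 'cV[R]_n.+1 :=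
  \col_i (if unlift ord0 i is Some j then p.2 j 0 else p.1).

Definition cV_uncons n (x : 'cV[R]_n.+1) : R * 'cV[R]_n :=
  (x ord0 0, \col_j x (lift ord0 j) 0).

Lemma cV_unconsK n : cancel (@cV_uncons n) (@cV_cons n).
Proof.
move=> x; apply/colP => i; rewrite mxE.
by case: unliftP => [j ->|->]; rewrite /= ?mxE.
Qed.

Lemma cV_consK n : cancel (@cV_cons n) (@cV_uncons n).
Proof.
move=> [a x]; congr pair; first by rewrite mxE unlift_none.
by apply/colP => j; rewrite !mxE liftK.
Qed.

Lemma measurable_cV_cons n : measurable_fun setT (@cV_cons n).
Proof.
apply: measurable_fun_cVP => i.
under eq_fun do rewrite mxE.
case: unliftP => [j _|_]; last exact: measurable_fst.
by apply: (measurableT_comp (@measurable_coord n j)); exact: measurable_snd.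
Qed.

Lemma measurable_cV_uncons n : measurable_fun setT (@cV_uncons n).
Proof.
apply: measurable_fun_pair => /=; first exact: measurable_coord.
apply: measurable_fun_cVP => i; under eq_fun do rewrite mxE.
exact: measurable_coord.
Qed.

Definition cbox n (a b : 'I_n -> R) : set 'cV[R]_n :=
  [set x | forall i, a i <= x i 0 <= b i].

Lemma measurable_cbox n (a b : 'I_n -> R) : measurable (cbox a b).
Proof.
rewrite (_ : cbox a b = \bigcap_(i in [set: 'I_n])
    (fun x : 'cV[R]_n => x i 0) @^-1` `[a i, b i]%classic).
  apply: fin_bigcap_measurable => // i _; rewrite -[X in measurable X]setTI.
  by apply: measurable_coord => //; exact: measurable_itv.
apply/seteqP; split=> t /= h i; have := h i; first by move=> ? _; rewrite /= in_itv.
by rewrite /= in_itv; apply.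
Qed.

End cV_measurable.

Section lebesgue_cV.
Variable R : realType.
Local Open Scope ereal_scope.

Section step.
Variables (n : nat) (mu : {sigma_finite_measure set 'cV[R]_n -> \bar R}).

Definition lebesgue_cV_step : set 'cV[R]_n.+1 -> \bar R :=
  pushforward (@lebesgue_measure R \x mu) (@cV_cons R n).

Let step0 : lebesgue_cV_step set0 = 0.
Proof. by rewrite /lebesgue_cV_step /pushforward preimage_set0 measure0. Qed.

Let step_ge0 A : 0 <= lebesgue_cV_step A.
Proof. by rewrite /lebesgue_cV_step /pushforward; exact: measure_ge0. Qed.

Let step_sigma_additive : semi_sigma_additive lebesgue_cV_step.
Proof.
exact: (@measure_semi_sigma_additive _ _ _
  (measure_function_pushforward__canonical__measure_function_Measure
     (@lebesgue_measure R \x mu) (@measurable_cV_cons R n))).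
Qed.

HB.instance Definition _ := isMeasure.Build _ _ _ lebesgue_cV_step
  step0 step_ge0 step_sigma_additive.

Let step_sigma_finite : sigma_finite setT lebesgue_cV_step.
Proof.
have /sigma_finiteP[F [TF ndF Foo]] := sigma_finiteT (@lebesgue_measure R).
have /sigma_finiteP[G [TG ndG Goo]] := sigma_finiteT mu.
exists (fun i => @cV_uncons R n @^-1` (F i `*` G i)).
  rewrite -preimage_bigcup -[LHS](preimage_setT (@cV_uncons R n)).
  congr (_ @^-1` _); apply/seteqP; split=> // -[x y] _.
  have [i _ Fix] : (\bigcup_i F i) x by rewrite -TF.
  have [j _ Gjy] : (\bigcup_i G i) y by rewrite -TG.
  exists (maxn i j) => //; split.
  - by move: x Fix; exact/subsetPset/ndF/leq_maxl.
  - by move: y Gjy; exact/subsetPset/ndG/leq_maxr.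
move=> i; have [mFi Fioo] := Foo i; have [mGi Gioo] := Goo i.
have mFGi : measurable (F i `*` G i) by exact: measurableX.
split.
  by rewrite -[X in measurable X]setTI; exact: measurable_cV_uncons.
rewrite /lebesgue_cV_step /pushforward -comp_preimage.
rewrite (_ : _ \o _ = id) ?preimage_id.
  by rewrite product_measure1E// lte_mul_pinfty// ge0_fin_numE.
by apply/funext => p; exact: cV_consK.
Qed.

HB.instance Definition _ := Measure_isSigmaFinite.Build _ _ _ lebesgue_cV_step
  step_sigma_finite.

End step.

(* Lebesgue measure on R^n, the n-fold product of the one on R. *)
Fixpoint lebesgue_cV n : {sigma_finite_measure set 'cV[R]_n -> \bar R} :=
  match n with
  | 0 => \d_(0%R : 'cV[R]_0)
  | n'.+1 => lebesgue_cV_step (lebesgue_cV n')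
  end.

Lemma lebesgue_cV_box n (a b : 'I_n -> R) : (forall i, a i <= b i)%R ->
  lebesgue_cV n (cbox a b) = (\prod_(i < n) (b i - a i))%:E.
Proof.
elim: n a b => [|n IH] a b ab.
  rewrite big_ord0; transitivity (lebesgue_cV 0 setT); last exact: diracT.
  by congr (lebesgue_cV 0 _); apply/seteqP; split=> // x _ [].
rewrite big_ord_recl EFinM -(IH (a \o lift ord0) (b \o lift ord0)); last first.
  by move=> i; exact: ab.
have len0 : lebesgue_measure (`[a ord0, b ord0]%classic : set R) =
    (b ord0 - a ord0)%:E.
  rewrite lebesgue_measure_itv/= lte_fin.
  have := ab ord0; rewrite le_eqVlt => /predU1P[->|->]; last by rewrite EFinB.
  by rewrite ltxx subrr.
rewrite /= /lebesgue_cV_step /pushforward.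
rewrite (_ : _ @^-1` _ =
    `[a ord0, b ord0]%classic `*` cbox (a \o lift ord0) (b \o lift ord0)).
  rewrite product_measure1E//; last exact: measurable_cbox.
  by congr (_ * _); exact: len0.
apply/seteqP; split=> -[t x] /=.
  move=> h; split => [|i]; first by have := h ord0; rewrite mxE unlift_none in_itv.
  by have := h (lift ord0 i); rewrite mxE liftK.
move=> [h1 h2] i; rewrite mxE.
case: unliftP => [j ->|->] /=; first exact: h2.
by rewrite in_itv in h1.
Qed.

End lebesgue_cV.

Section definitions.
Variables (R : realType) (d : nat).
Local Notation V := 'cV[R]_d.
Local Notation leb := (lebesgue_cV R d).

(* The library norm on matrices is the sup norm. *)
Definition enorm (x : V) : R := Num.sqrt (\sum_i x i 0 ^+ 2).

Definition eball (r : R) : set V := [set x | enorm x < r].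

Definition affine_contraction (T : V -> V) : Prop :=
  (exists (A : 'M[R]_d) (b : V), forall x, T x = A *m x + b) /\
  (forall x y, enorm (T x - T y) <= enorm (x - y)).

Definition convex_efun (phi : V -> \bar R) : Prop :=
  forall (x y : V) (t : R), 0 <= t <= 1 ->
    (phi (t *: x + (1 - t) *: y)%R
      <= t%:E * phi x + (1 - t)%:E * phi y)%E.

(* A plays the role of a Borel set of finite volume and B of A^*; radii r <= 0
   give the empty ball, so that A^* is empty when A is null. *)
Definition is_set_rearrangement (A B : set V) : Prop :=
  exists r : R, B = eball r /\ leb B = leb A.

(* g is the rearrangement f^*; it takes the value +oo at 0 when f is
   essentially unbounded. *)
Definition is_rearrangement (f : V -> R) (g : V -> \bar R) : Prop :=
  (forall x, 0 <= g x)%E /\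
  forall t : R, 0 < t ->
    is_set_rearrangement [set x | t < f x] [set x | t%:E < g x]%E.

Definition majorized (f g : V -> R) : Prop :=
  exists fs gs : V -> \bar R,
    [/\ is_rearrangement f fs, is_rearrangement g gs &
      forall r : R, 0 < r ->
        (\int[leb]_(x in eball r) fs x <= \int[leb]_(x in eball r) gs x)%E].

Definition renyi_entropy (alpha : R) (f : V -> R) : \bar R :=
  if alpha == 1 then (- \int[leb]_x (f x * ln (f x))%:E)%E
  else (((1 - alpha)^-1)%:E * lne (\int[leb]_x (f x `^ alpha)%:E))%E.

Section random_vectors.
Context {disp : measure_display} {Omega : measurableType disp}.
Variable P : probability Omega R.

Definition is_density (Y : Omega -> V) (f : V -> R) : Prop :=
  [/\ measurable_fun setT f, (forall x, 0 <= f x) &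
    forall A, measurable A ->
      pushforward P Y A = (\int[leb]_(x in A) (f x)%:E)%E].

Definition log_concave (Y : Omega -> V) : Prop :=
  exists phi : V -> \bar R,
    [/\ (forall x, phi x != -oo%E), convex_efun phi &
      exists2 f, is_density Y f & forall x, (f x)%:E = expeR (- phi x)%E].

Definition radially_symmetric (Y : Omega -> V) : Prop :=
  exists2 f, is_density Y f & forall x y, enorm x = enorm y -> f x = f y.

Definition independent_vectors (X Y : Omega -> V) : Prop :=
  forall A B : set V, measurable A -> measurable B ->
    (P (X @^-1` A `&` Y @^-1` B) = P (X @^-1` A) * P (Y @^-1` B))%E.

End random_vectors.
End definitions.

(* Main.v *)
(* Write excess f t for the integral of (f - t)_+. The claim
   excess f_{X+W} t <= excess f_{T(X)+W} t for all t contains both conclusions: the excess is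
   the tail integral of s |-> vol {f > s}, from which majorization and the comparison of
   integrals of functions with monotone derivative follow.
   The contractions A for which the excess inequality holds are closed under
   products and contain the orthogonal matrices. Every contraction is a product
   of orthogonal matrices and of matrices 1 - s u u^T with 0 <= s <= 1; these are
   conjugate to 1 - s u u^T with u = e_0, which multiplies the first coordinate by
   a = 1 - s, and there the inequality is obtained by moving fibres. By
   Prekopa-Leindler the superlevel set {f_{X+W} > t} meets lines parallel to e_0
   in intervals; move each of these so that its midpoint c becomes a c. The new
   set has the same volume, and since the distance |x_0 - c| of x to the midpoint
   becomes a |x_0 - c|, the mass that the even unimodal weight f_W(. - x) puts on
   the set does not decrease. *)

From HB Require Import structures.
Require Import Defs.
From mathcomp Require Import all_boot all_order all_algebra.
From mathcomp Require Import all_classical all_reals all_analysis.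
From mathcomp Require Import measurable_realfun.
From mathcomp Require Import ring lra.

Set Implicit Arguments.
Unset Strict Implicit.
Unset Printing Implicit Defensive.

Import Order.TTheory GRing.Theory Num.Theory.
Import numFieldNormedType.Exports.

Local Open Scope classical_set_scope.
Local Open Scope ring_scope.

(** * One-dimensional integrals and layer cake *)

(** Closure under products forces the excess inequality to be stated for [C X + W] with an arbitrary
    matrix [C]: after a factor with [s = 1] the law of [C X] sits on a hyperplane and has no density
    for the next step to start from. Log-concavity of [X] therefore enters only through the joint
    log-concavity of [p x * w (z - C x)] in [z] and [x]; its integral over [x] is quasi-concave in
    [z], which is all that interval fibres require. The moved set depends only on the level set and
    on [a], so one set serves every [x] and the comparison can be integrated against the law of [X].
    The factorization of a contraction descends on the rank of [1 - A^T A], with Cauchy-Schwarz for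
    semidefinite forms in place of a spectral theorem. Densities are fixed only almost everywhere:
    the log-concave and the radial density of [W] may differ on a null set, so exact evenness in a
    coordinate has to be restored. The entropy at [alpha = 1] is delicate because [1 + ln y] changes
    sign and the integral of [f ln f] may be [-oo]. *)

Section real_line.
Context {R : realType}.
Local Notation mu := (@lebesgue_measure R).
Local Open Scope ereal_scope.

(** Uniqueness of Lebesgue measure: the right-hand side is a measure in [A], and it has the correct
    value on the intervals []u, v]]. *)
Lemma lebesgue_measure_affine (c b : R) (A : set R) : (0 < c)%R ->
  measurable A ->
  mu A = c%:E * mu ((fun x => c * x + b)%R @^-1` A).
Proof.
move=> c0 mA.
have mf : measurable_fun setT (fun x : R => (c * x + b)%R : measurableTypeR R).
  by apply: measurable_funD => //; exact: measurable_funM.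
pose nu : {measure set (measurableTypeR R) -> \bar R} :=
  mscale (NngNum (ltW c0))
    (measure_function_pushforward__canonical__measure_function_Measure mu mf).
transitivity (nu A); last by [].
apply: lebesgue_measure_unique => //= _ [[u v]] _ <-.
rewrite /nu /mscale /= /pushforward.
have -> : (fun x => c * x + b)%R @^-1` [set` `]u, v]] =
    [set` `](u - b) / c, (v - b) / c]%R].
  apply/seteqP; split => x /=; rewrite !in_itv/= ltr_pdivrMr// ler_pdivlMr//
    [(x * c)%R]mulrC ltrBlDr lerBrDr//.
rewrite !lebesgue_measure_itv/= !lte_fin ltr_pM2r ?invr_gt0// ltrD2r.
case: ifP => _; last by rewrite mule0.
rewrite -!EFinD -EFinM; congr EFin.
by field; rewrite gt_eqF.
Qed.

Lemma ge0_integral_affine (c b : R) (f : R -> \bar R) : (0 < c)%R ->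
  measurable_fun setT f -> (forall x, 0 <= f x) ->
  \int[mu]_x f x = c%:E * \int[mu]_x f (c * x + b)%R.
Proof.
move=> c0 mf f0.
have mg : measurable_fun setT (fun x : R => (c * x + b)%R : measurableTypeR R).
  by apply: measurable_funD => //; exact: measurable_funM.
transitivity (\int[mscale (NngNum (ltW c0))
    (measure_function_pushforward__canonical__measure_function_Measure mu mg)]_x
    f x).
  apply: eq_measure_integral => A mA _.
  by rewrite [LHS](lebesgue_measure_affine b c0 mA).
rewrite ge0_integral_mscale//; congr (_ * _).
by rewrite ge0_integral_pushforward//.
Qed.

Lemma ge0_integral_shift (b : R) (f : R -> \bar R) :
  measurable_fun setT f -> (forall x, 0 <= f x) ->
  \int[mu]_x f (x + b)%R = \int[mu]_x f x.
Proof.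
move=> mf f0; rewrite (ge0_integral_affine b ltr01 mf f0) mul1e.
by apply: eq_integral => x _; rewrite mul1r.
Qed.

Lemma ge0_integral_opp (f : R -> \bar R) :
  measurable_fun setT f -> (forall x, 0 <= f x) ->
  \int[mu]_x f (- x)%R = \int[mu]_x f x.
Proof.
move=> mf f0.
transitivity (\int[pushforward mu (-%R : _ -> measurableTypeR R)]_x f x).
  by rewrite ge0_integral_pushforward.
by apply: eq_measure_integral => A mA _; exact: lebesgue_measureN.
Qed.

End real_line.

Section layer_cake.
Context d (T : measurableType d) (R : realType).
Variable m : {sigma_finite_measure set T -> \bar R}.
Local Notation mu := (@lebesgue_measure R).
Local Open Scope ereal_scope.

Lemma measurable_subgraph (f : T -> \bar R) : measurable_fun setT f ->
  measurable [set p : T * R | p.2%:E < f p.1].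
Proof.
move=> mf; rewrite -[X in measurable X]setTI.
apply: (measurable_lte measurableT (f := fun p : T * R => p.2%:E)
  (g := f \o fst)).
  by apply/measurable_EFinP; exact: measurable_snd.
by apply: measurableT_comp => //; exact: measurable_fst.
Qed.

Lemma lebesgue_measure_below (x : \bar R) : 0 <= x ->
  mu ([set` `]0%R, +oo[] `&` [set s : R | s%:E < x]) = x.
Proof.
move=> x0; case: x x0 => [r| |]//.
- rewrite lee_fin => r0.
  rewrite (_ : _ `&` _ = [set` `]0%R, r[]).
    rewrite lebesgue_measure_itv/= lte_fin; case: ltgtP r0 => // [_ _|<- _ //].
    by rewrite oppr0 adde0.
  by apply/seteqP; split => s /=; rewrite !in_itv/= lte_fin ?andbT;
    [move=> [-> ->]|move=> /andP[]].
- move=> _; rewrite (_ : _ `&` _ = [set` `]0%R, +oo[]).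
    by rewrite lebesgue_measure_itv/= ltry.
  by apply/seteqP; split => s /=; [move=> []|rewrite ltry].
Qed.

(** Tonelli for the indicator of the region between 0 and the graph of [f]. *)
Lemma layer_cake (f : T -> \bar R) : measurable_fun setT f ->
  (forall x, 0 <= f x) ->
  \int[m]_x f x = \int[mu]_(s in `]0%R, +oo[) m [set x | s%:E < f x].
Proof.
move=> mf f0.
pose S := [set p : T * R | p.2%:E < f p.1].
pose g (p : T * R) : \bar R := (\1_(S `&` (setT `*` `]0%R, +oo[)) p)%:E.
have mS : measurable (S `&` (setT `*` `]0%R, +oo[)).
  by apply: measurableI; [exact: measurable_subgraph|exact: measurableX].
have mg : measurable_fun setT g.
  by apply/measurable_EFinP; exact: measurable_indic.
transitivity (\int[m]_x \int[mu]_s g (x, s)).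
  apply: eq_integral => x _; rewrite -{1}(lebesgue_measure_below (f0 x)).
  rewrite -[X in mu X]setIT -integral_indic//.
    apply: eq_integral => s _; rewrite /g !indicE; congr (_%:E)%R.
    congr (nat_of_bool _)%:R; apply/idP/idP; rewrite !inE/= => -[].
      by move=> ? ?; split.
    by move=> ? [].
  apply: measurableI => //; rewrite -[X in measurable X]setTI.
  by apply: (measurable_lte measurableT) => //; exact/measurable_EFinP.
transitivity (\int[mu]_s \int[m]_x g (x, s)).
  apply: (@fubini_tonelli _ _ _ (measurableTypeR R) _ m
    (@lebesgue_measure R) g mg).
  by move=> p; rewrite lee_fin.
rewrite [RHS]integral_mkcond; apply: eq_integral => s _.
rewrite patchE; have [s0|s0] := ltP 0%R (s : R).
  rewrite mem_set/= ?in_itv/= ?s0// -[X in m X]setIT -integral_indic//.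
    apply: eq_integral => x _; rewrite /g !indicE; congr (_%:E)%R.
    congr (nat_of_bool _)%:R; apply/idP/idP; rewrite !inE/=; first by move=> [].
    by move=> ?; do !split => //=; rewrite in_itv/= s0.
  by rewrite -[X in measurable X]setTI; exact: (measurable_lte measurableT).
rewrite memNset/= ?in_itv/= ?andbT ?ltNge ?s0//.
apply: integral0_eq => x _; rewrite /g indicE memNset//= => -[_ [_]] /=.
by rewrite in_itv/= andbT ltNge s0.
Qed.

End layer_cake.

(** * Lebesgue measure on R^d *)

Section measurable_cV.
Context {R : realType}.
Context d (T : measurableType d).

Lemma measurable_cV_coord n (f : T -> 'cV[R]_n) (i : 'I_n) :
  measurable_fun setT f -> measurable_fun setT (fun t => f t i 0).
Proof. exact: (measurableT_comp (@measurable_coord R n i)). Qed.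

Lemma measurable_cVD n (f g : T -> 'cV[R]_n) :
  measurable_fun setT f -> measurable_fun setT g ->
  measurable_fun setT (fun t => f t + g t).
Proof.
move=> mf mg; apply: measurable_fun_cVP => i.
under eq_fun do rewrite mxE.
by apply: measurable_funD; exact: measurable_cV_coord.
Qed.

Lemma measurable_cVZ n (k : R) (f : T -> 'cV[R]_n) :
  measurable_fun setT f -> measurable_fun setT (fun t => k *: f t).
Proof.
move=> mf; apply: measurable_fun_cVP => i; under eq_fun do rewrite mxE.
by apply: measurable_funM => //; exact: measurable_cV_coord.
Qed.

Lemma measurable_cVN n (f : T -> 'cV[R]_n) :
  measurable_fun setT f -> measurable_fun setT (fun t => - f t).
Proof.
by move=> mf; under eq_fun do rewrite -scaleN1r; exact: measurable_cVZ.
Qed.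

Lemma measurable_cVB n (f g : T -> 'cV[R]_n) :
  measurable_fun setT f -> measurable_fun setT g ->
  measurable_fun setT (fun t => f t - g t).
Proof. by move=> mf mg; apply: measurable_cVD => //; exact: measurable_cVN. Qed.

Lemma measurable_mulmx_cV m n (A : 'M[R]_(m, n)) (f : T -> 'cV[R]_n) :
  measurable_fun setT f -> measurable_fun setT (fun t => A *m f t).
Proof.
move=> mf; apply: measurable_fun_cVP => i; under eq_fun do rewrite mxE.
by apply: measurable_sum => j; apply: measurable_funM => //;
  exact: measurable_cV_coord.
Qed.

Lemma measurable_enorm n (f : T -> 'cV[R]_n) :
  measurable_fun setT f -> measurable_fun setT (fun t => enorm (f t)).
Proof.
move=> mf; rewrite /enorm.
apply: (measurableT_comp (continuous_measurable_fun (@sqrt_continuous R))).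
by apply: measurable_sum => i; apply: measurable_funX; exact: measurable_cV_coord.
Qed.

End measurable_cV.

Lemma measurable_eball (R : realType) d (r : R) : measurable (@eball R d r).
Proof.
rewrite -[X in measurable X]setTI.
have : measurable_fun setT (fun x : 'cV[R]_d => enorm x < r).
  by apply: measurable_fun_ltr => //; exact: measurable_enorm.
by move=> /(_ measurableT [set true]); apply.
Qed.

Lemma measurable_indic_comp d d' (T : measurableType d) (U : measurableType d')
    (R : realType) (g : T -> U) (C : set U) :
  measurable C -> measurable_fun setT g ->
  measurable_fun setT (fun t => \1_C (g t) : R).
Proof.
move=> mC mg; have mi : measurable_fun setT (\1_C : U -> R).
  exact: measurable_indic.
exact: (measurableT_comp mi mg).
Qed.

Section lebesgue_cV_theory.
Context {R : realType}.
Local Notation mu := (@lebesgue_measure R).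
Local Notation leb := (@lebesgue_cV R).
Local Open Scope ereal_scope.

Lemma ge0_integral_cV_cons n (f : 'cV[R]_n.+1 -> \bar R) :
  measurable_fun setT f -> (forall x, 0 <= f x) ->
  \int[leb n.+1]_x f x = \int[leb n]_y \int[mu]_s f (cV_cons (s, y)).
Proof.
move=> mf f0.
have mg : measurable_fun setT (f \o @cV_cons R n).
  by apply: measurableT_comp => //; exact: measurable_cV_cons.
transitivity (\int[pushforward (lebesgue_measure \x leb n) (@cV_cons R n)]_x f x).
  by [].
rewrite ge0_integral_pushforward//; last exact: measurable_cV_cons.
rewrite preimage_setT.
by apply: (@fubini_tonelli2 _ _ _ _ R mu (leb n) (f \o @cV_cons R n) mg) => p /=.
Qed.

Lemma ge0_integral_cV_cons_swap n (f : 'cV[R]_n.+1 -> \bar R) :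
  measurable_fun setT f -> (forall x, 0 <= f x) ->
  \int[leb n.+1]_x f x = \int[mu]_s \int[leb n]_y f (cV_cons (s, y)).
Proof.
move=> mf f0; rewrite ge0_integral_cV_cons//.
have mg : measurable_fun setT (f \o @cV_cons R n).
  by apply: measurableT_comp => //; exact: measurable_cV_cons.
apply/esym.
by apply: (@fubini_tonelli _ _ _ _ R mu (leb n) (f \o @cV_cons R n) mg) => p /=.
Qed.

Lemma cV_consD n (s t : R) (x y : 'cV[R]_n) :
  cV_cons (s + t, x + y)%R = (cV_cons (s, x) + cV_cons (t, y))%R.
Proof.
apply/colP => i; rewrite !mxE; case: unliftP => [j _|_] //=.
by rewrite mxE.
Qed.

Lemma cV_consZ n (k s : R) (x : 'cV[R]_n) :
  cV_cons (k * s, k *: x)%R = (k *: cV_cons (s, x))%R.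
Proof.
by apply/colP => i; rewrite !mxE; case: unliftP => [j _|_] //=; rewrite mxE.
Qed.

Lemma measurable_cV_section n (f : 'cV[R]_n.+1 -> \bar R) (y : 'cV[R]_n) :
  measurable_fun setT f -> measurable_fun setT (fun s => f (cV_cons (s, y))).
Proof.
move=> mf; apply: (measurableT_comp mf).
by apply: (measurableT_comp (@measurable_cV_cons R n)).
Qed.

Lemma measurable_cV_section2 n (f : 'cV[R]_n.+1 -> \bar R) (s : R) :
  measurable_fun setT f -> measurable_fun setT (fun y => f (cV_cons (s, y))).
Proof.
move=> mf; apply: (measurableT_comp mf).
by apply: (measurableT_comp (@measurable_cV_cons R n)).
Qed.

Lemma ge0_integral_cV_shift n (v : 'cV[R]_n) (f : 'cV[R]_n -> \bar R) :
  measurable_fun setT f -> (forall x, 0 <= f x) ->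
  \int[leb n]_x f (x + v)%R = \int[leb n]_x f x.
Proof.
elim: n v f => [|n IH] v f mf f0.
  by apply: eq_integral => x _; congr f; apply/colP => -[].
have mg : measurable_fun setT (fun x : 'cV[R]_n.+1 => f (x + v)%R).
  by apply: measurableT_comp => //; exact: measurable_cVD.
rewrite (ge0_integral_cV_cons_swap mg); last by move=> x; exact: f0.
rewrite (ge0_integral_cV_cons_swap mf f0).
rewrite -[RHS](ge0_integral_shift (cV_uncons v).1); first last.
- by move=> s; exact: integral_ge0.
- apply: (measurable_fun_fubini_tonelli_F (m2 := leb n) (f \o @cV_cons R n)).
    exact: (measurableT_comp mf (@measurable_cV_cons R n)).
  by move=> p /=.
apply: eq_integral => s _; rewrite -[RHS](IH (cV_uncons v).2)//; last first.
  exact: measurable_cV_section2.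
by apply: eq_integral => x _; rewrite cV_consD -surjective_pairing cV_unconsK.
Qed.

Lemma lebesgue_cV_shift n (v : 'cV[R]_n) (A : set 'cV[R]_n) : measurable A ->
  leb n [set x | A (x + v)%R] = leb n A.
Proof.
move=> mA.
have mA' : measurable [set x | A (x + v)%R].
  rewrite -[X in measurable X]setTI.
  by apply: (measurable_cVD (f := id) (g := cst v)).
rewrite -[in LHS](setIT [set x | _]) -[in RHS](setIT A) -!integral_indic//.
rewrite -[RHS](ge0_integral_cV_shift v); first last.
- by move=> x; rewrite lee_fin.
- exact/measurable_EFinP/measurable_indic.
by apply: eq_integral.
Qed.

(* Weil's argument: integrate 1_A(x + y) 1_B(y) in both orders. *)
Lemma translation_invariant_proportional n
    (nu : {sigma_finite_measure set 'cV[R]_n -> \bar R}) (A B : set 'cV[R]_n) :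
  (forall v (C : set 'cV[R]_n), measurable C -> nu [set x | C (x + v)%R] = nu C) ->
  measurable A -> measurable B ->
  nu A * leb n B = nu [set x | B (- x)%R] * leb n A.
Proof.
move=> nuD mA mB.
pose f (p : 'cV[R]_n * 'cV[R]_n) : \bar R :=
  (\1_A (p.1 + p.2)%R * \1_B p.2)%:E.
have m1 (C : set 'cV[R]_n) : measurable C ->
    measurable_fun setT (fun x => (\1_C x)%:E : \bar R).
  by move=> mC; exact/measurable_EFinP/measurable_indic.
have mpre (g : 'cV[R]_n -> 'cV[R]_n) C : measurable_fun setT g -> measurable C ->
    measurable (g @^-1` C).
  by move=> mg mC; rewrite -[X in measurable X]setTI; exact: mg.
have mf : measurable_fun setT f.
  apply/measurable_EFinP; apply: measurable_funM.
    by apply: measurable_indic_comp => //; exact: measurable_cVD.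
  exact: measurable_indic_comp.
have f0 p : 0 <= f p by rewrite lee_fin mulr_ge0.
have int1 (m : {measure set 'cV[R]_n -> \bar R}) C : measurable C ->
    \int[m]_x (\1_C x)%:E = m C.
  by move=> mC; rewrite integral_indic// setIT.
transitivity (\int[nu]_x \int[leb n]_y f (x, y)).
  rewrite (@fubini_tonelli _ _ _ _ R nu (leb n) f mf f0).
  transitivity (\int[leb n]_y (nu A * (\1_B y)%:E)).
    by rewrite ge0_integralZl//; [rewrite int1|exact: m1].
  apply: eq_integral => y _.
  rewrite /f /=; under eq_integral do rewrite EFinM.
  rewrite ge0_integralZr//; [|exact: (m1 _ (mpre _ _ (measurable_cVD _ _) mA))].
  congr (_ * _); rewrite -(nuD y A mA) -int1; last first.
    by apply: mpre => //; exact: measurable_cVD.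
  by apply: eq_integral => x _; rewrite !indicE; congr (((nat_of_bool _)%:R)%:E);
    apply/idP/idP; rewrite !inE.
transitivity (\int[leb n]_y (nu [set x | B (- x)%R] * (\1_A y)%:E)); last first.
  by rewrite ge0_integralZl//; [rewrite int1|exact: m1].
(* For fixed [x], replacing [y] by [y - x] frees [1_A] from [x]; the remaining integral over [x]
   measures a translate of [-B]. *)
transitivity (\int[nu]_x \int[leb n]_y ((\1_A y * \1_B (y - x)%R)%:E)).
  apply: eq_integral => x _.
  rewrite -[RHS](ge0_integral_cV_shift x).
  - apply: eq_integral => y _; rewrite /f/= addrK.
    by rewrite [(x + y)%R]addrC.
  - apply/measurable_EFinP; apply: measurable_funM => //.
    apply: measurable_indic_comp => //.
    exact: measurable_cVB.
  - by move=> y; rewrite lee_fin mulr_ge0.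
rewrite (@fubini_tonelli _ _ _ _ R nu (leb n)
  (fun p => (\1_A p.2 * \1_B (p.2 - p.1)%R)%:E))/=; first last.
- by move=> p; rewrite lee_fin mulr_ge0.
- apply/measurable_EFinP; apply: measurable_funM => //.
    exact: measurable_indic_comp.
  by apply: measurable_indic_comp => //; exact: measurable_cVB.
apply: eq_integral => y _.
under eq_integral do rewrite EFinM.
rewrite ge0_integralZl//; last first.
  apply/measurable_EFinP; apply: measurable_indic_comp => //.
  exact: measurable_cVB.
rewrite muleC; congr (_ * _).
rewrite -(nuD (- y)%R); last by apply: mpre => //; exact: measurable_cVN.
rewrite -int1; last first.
  apply: (mpre (fun x => - (x - y))%R) => //.
  by apply: measurable_cVN; exact: measurable_cVB.
by apply: eq_integral => x _; rewrite !indicE; congr (((nat_of_bool _)%:R)%:E);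
    apply/idP/idP; rewrite !inE/= opprB.
Qed.

End lebesgue_cV_theory.

(** * The Euclidean norm *)

Section euclidean_norm.
Context {R : realType} {n : nat}.
Implicit Types x y v : 'cV[R]_n.

Lemma enorm_ge0 x : 0 <= enorm x. Proof. exact: sqrtr_ge0. Qed.

Lemma sqr_enorm x : enorm x ^+ 2 = \sum_i x i 0 ^+ 2.
Proof. by rewrite sqr_sqrtr// sumr_ge0// => i _; rewrite sqr_ge0. Qed.

Lemma sqr_enorm_mx x : enorm x ^+ 2 = (x^T *m x) 0 0.
Proof.
by rewrite sqr_enorm mxE; apply: eq_bigr => i _; rewrite mxE expr2.
Qed.

Lemma enormZ (k : R) x : enorm (k *: x) = `|k| * enorm x.
Proof.
rewrite /enorm; under eq_bigr do rewrite mxE exprMn.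
by rewrite -mulr_sumr sqrtrM ?sqr_ge0// sqrtr_sqr.
Qed.

Lemma enormN x : enorm (- x) = enorm x.
Proof. by rewrite -scaleN1r enormZ normrN1 mul1r. Qed.

Lemma enorm0 : enorm (0 : 'cV[R]_n) = 0.
Proof. by rewrite -(scale0r 0) enormZ normr0 mul0r. Qed.

Lemma le_coord_enorm x i : `|x i 0| <= enorm x.
Proof.
rewrite -sqrtr_sqr ler_wsqrtr// (bigD1 i)//= lerDl.
by rewrite sumr_ge0// => j _; rewrite sqr_ge0.
Qed.

Lemma enorm_orthogonal (O : 'M[R]_n) x : O^T *m O = 1%:M ->
  enorm (O *m x) = enorm x.
Proof.
move=> OO; apply/eqP; rewrite -(@eqrXn2 _ 2) ?enorm_ge0// !sqr_enorm_mx.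
by rewrite trmx_mul -mulmxA (mulmxA O^T) OO mul1mx.
Qed.

End euclidean_norm.

(** * Linear maps and the volume of balls *)

Section linear_change.
Context {R : realType}.
Local Notation leb := (@lebesgue_cV R).
Local Open Scope ereal_scope.

Lemma muleIr (r : R) (x y : \bar R) : (r != 0)%R ->
  x * r%:E = y * r%:E -> x = y.
Proof.
move=> r0 /(congr1 (fun z => z * r^-1%:E)).
by rewrite -!muleA -EFinM mulfV// !mule1.
Qed.

(** The image of Lebesgue measure under [G] is again translation invariant, hence proportional to
    it. Leaving the constant implicit, as a ratio of volumes of a test set [B], avoids any
    determinant: [B] is later chosen so that its image is known. *)
Lemma lebesgue_cV_linear n (G : 'M[R]_n) (A B : set 'cV[R]_n) :
  G \in unitmx -> measurable A -> measurable B ->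
  leb n [set x | A (G *m x)] * leb n B =
  leb n [set x | B (- (G *m x))%R] * leb n A.
Proof.
move=> Gu mA mB.
have mG : measurable_fun setT (mulmx G : 'cV[R]_n -> 'cV[R]_n).
  exact: measurable_mulmx_cV.
pose nu := measure_function_pushforward__canonical__measure_function_Measure
  (leb n) mG.
have sf : sigma_finite setT nu.
  have /sigma_finiteP[F [TF ndF Foo]] := sigma_finiteT (leb n).
  exists (fun i => [set x | F i (invmx G *m x)]).
    apply/seteqP; split => // x _.
    have [i _ Fi] : (\bigcup_i F i) (invmx G *m x) by rewrite -TF.
    by exists i.
  move=> i; have [mFi Fi] := Foo i; split.
    rewrite -[X in measurable X]setTI.
    exact: (measurable_mulmx_cV (invmx G) (@measurable_id _ _ setT)).
  rewrite /nu/= /pushforward/= (_ : _ @^-1` _ = F i)//.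
  by apply/seteqP; split => x /=; rewrite mulKmx.
pose nus : {sigma_finite_measure set 'cV[R]_n -> \bar R} :=
  HB.pack (Measure.sort nu) (Measure_isSigmaFinite.Build _ _ _ nu sf).
have := @translation_invariant_proportional R n nus A B _ mA mB; apply.
move=> v C mC; rewrite /nus/= /pushforward.
have mC' : measurable [set x | C (G *m x)].
  rewrite -[X in measurable X]setTI.
  exact: (measurable_mulmx_cV G (@measurable_id _ _ setT)).
rewrite -[RHS](lebesgue_cV_shift (invmx G *m v) mC'); congr (leb n _).
by apply/seteqP; split => x /=; rewrite mulmxDr mulKVmx.
Qed.

Lemma eball_cbox n (r : R) : 
  (eball r : set 'cV[R]_n) `<=` cbox (fun=> - r)%R (fun=> r).
Proof.
move=> x xr i; rewrite -ler_norml.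
exact: le_trans (le_coord_enorm x i) (ltW xr).
Qed.

Lemma lebesgue_eball_fin n (r : R) : leb n (eball r) < +oo.
Proof.
have [r0|r0] := ltP r 0%R.
  rewrite (_ : eball r = set0) ?measure0//.
  apply/seteqP; split => // x; rewrite /eball/= => xr.
  by have := lt_trans xr r0; rewrite ltNge enorm_ge0.
have bf : leb n (cbox (fun=> - r)%R (fun=> r)) < +oo.
  by rewrite lebesgue_cV_box ?ltry// => i; rewrite (@le_trans _ _ 0%R)// oppr_le0.
apply: le_lt_trans bf; apply: le_measure (@eball_cbox n r).
- by rewrite inE; exact: measurable_eball.
- by rewrite inE; exact: measurable_cbox.
Qed.

Lemma lebesgue_eball1_gt0 n : 0 < leb n (eball 1).
Proof.
(* A cube of half-side [e] lies in the unit ball since [n e^2 < 1]; [n.+1] keeps [e] meaningful for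
   [n = 0]. *)
pose e : R := (n.+1%:R^-1)%R.
have e0 : (0 < e)%R by rewrite invr_gt0 ltr0n.
apply: (@lt_le_trans _ _ (leb n (cbox (fun=> - e)%R (fun=> e)))).
  rewrite lebesgue_cV_box => [|i].
    by rewrite lte_fin prodr_gt0// => i _; rewrite opprK addr_gt0.
  by rewrite (@le_trans _ _ 0%R)// ?oppr_le0 ltW.
apply: le_measure; rewrite ?inE; [exact: measurable_cbox|exact: measurable_eball|].
move=> x xe; rewrite /eball/= /enorm -sqrtr1 ltr_sqrt//.
apply: (@le_lt_trans _ _ (\sum_(i < n) e ^+ 2)%R).
  apply: ler_sum => i _; rewrite -real_normK ?num_real//.
  by rewrite ler_sqr ?nnegrE ?(ltW e0)// ler_norml; exact: xe.
rewrite sumr_const card_ord -mulr_natr expr2 -invfM mulrC.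
rewrite ltr_pdivrMr ?mulr_gt0 ?ltr0n// mul1r -natrM ltr_nat.
by rewrite (leq_trans (ltnSn n))// leq_pmulr.
Qed.

(** The unit ball is a test set fixed by [O] and by [-1]; its volume is finite and positive, so it
    cancels. *)
Lemma lebesgue_cV_orthogonal n (O : 'M[R]_n) (A : set 'cV[R]_n) :
  O^T *m O = 1%:M -> measurable A -> leb n [set x | A (O *m x)] = leb n A.
Proof.
move=> OO mA; have := lebesgue_cV_linear (proj2 (mulmx1_unit OO)) mA
  (@measurable_eball R n 1).
rewrite (_ : [set x | eball _ _] = eball 1); last first.
  by apply/seteqP; split => x; rewrite /eball/= enormN enorm_orthogonal.
rewrite [RHS]muleC.
have := lebesgue_eball1_gt0 n; have := lebesgue_eball_fin n 1.
case: (leb n (eball 1)) => // r _; rewrite lte_fin => r0.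
by apply: muleIr; rewrite gt_eqF.
Qed.

(** Comparison with the cube [[-1, 1]^n], whose dilates have a known volume. *)
Lemma lebesgue_eball n (r : R) : (0 < r)%R ->
  leb n (eball r) = (r ^+ n)%:E * leb n (eball 1).
Proof.
move=> r0;
have := @lebesgue_cV_linear n (r^-1)%:M _ _ _ (@measurable_eball R n 1)
  (measurable_cbox (fun=> - 1)%R (fun=> 1%R)).
rewrite unitmxE det_scalar unitfE expf_neq0 ?invr_neq0 ?gt_eqF// => /(_ isT).
rewrite (_ : [set x | eball _ _] = eball r); last first.
  apply/seteqP; split => x; rewrite /eball/= mul_scalar_mx enormZ;
  by rewrite gtr0_norm ?invr_gt0// mulrC ltr_pdivrMr// mul1r.
rewrite (_ : [set x | cbox _ _ _] = cbox (fun=> - r)%R (fun=> r)); last first.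
  apply/seteqP; split => x /= xr i; have := xr i; rewrite mul_scalar_mx !mxE;
  rewrite mulrC -mulNr ler_pdivrMr// ler_pdivlMr// mul1r mulN1r lerN2 lerNl.
    by rewrite andbC.
  by rewrite andbC.
have cb (s : R) : (0 < s)%R ->
    leb n (cbox (fun=> - s)%R (fun=> s)) = ((s * 2) ^+ n)%:E.
  move=> s0; rewrite lebesgue_cV_box => [|i]; last by move: s0; clear; lra.
  rewrite prodr_const card_ord; congr ((_ ^+ _)%:E); clear; lra.
rewrite !cb// mul1r exprMn EFinM muleAC.
by apply: muleIr; rewrite expf_neq0.
Qed.

End linear_change.

(** * The Prekopa-Leindler inequality *)

Section brunn_minkowski_line.
Context {R : realType}.
Local Notation mu := (@lebesgue_measure R).
Local Open Scope ereal_scope.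

Lemma measurable_affine (c b : R) (A : set R) : measurable A ->
  measurable [set x : R | A (c * x + b)%R].
Proof.
move=> mA; rewrite -[X in measurable X]setTI.
have mf : measurable_fun setT (fun x : R => c * x + b)%R.
  by apply: measurable_funD => //; exact: measurable_funM.
exact: mf.
Qed.

Lemma lebesgue_measure_dilate (t b : R) (A : set R) : (0 < t)%R ->
  measurable A ->
  mu [set x | A (t^-1 * x + - (t^-1 * b))%R] = t%:E * mu A.
Proof.
move=> t0 mA; have ti0 : (0 < t^-1)%R by rewrite invr_gt0.
rewrite (lebesgue_measure_affine (- (t^-1 * b)) ti0 mA) muleA -EFinM.
by rewrite mulfV ?mul1e// gt_eqF.
Qed.

(* The overlap of the two translates of A and B inside C is as short as one
   wants, when the base points are near sup A and inf B. *)
Lemma brunn_minkowski_line (t : R) (A B C : set R) : (0 < t < 1)%R ->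
  measurable A -> measurable B -> measurable C ->
  A !=set0 -> B !=set0 -> has_ubound A -> has_lbound B ->
  (forall a b, A a -> B b -> C (t * a + (1 - t) * b)%R) ->
  t%:E * mu A + (1 - t)%:E * mu B <= mu C.
Proof.
move=> /andP[t0 t1] mA mB mC A0 B0 Au Bl ABC.
have s0 : (0 < 1 - t)%R by rewrite subr_gt0.
apply/lee_addgt0Pr => e e0.
have supA : has_sup A by [].
have infB : has_inf B by [].
have [a Aa ae] := sup_adherent e0 supA.
have [b Bb be] := inf_adherent e0 infB.
(* [SA] is [t A + (1 - t) b] and [SB] is [t a + (1 - t) B]. Both lie in [C], because [a] is in [A]
   and [b] in [B]. *)
pose SA := [set x | A (t^-1 * x + - (t^-1 * ((1 - t) * b)))%R].
pose SB := [set x | B ((1 - t)^-1 * x + - ((1 - t)^-1 * (t * a)))%R].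
have mSA : measurable SA by exact: measurable_affine.
have mSB : measurable SB by exact: measurable_affine.
rewrite -(lebesgue_measure_dilate ((1 - t) * b) t0 mA).
rewrite -(lebesgue_measure_dilate (t * a) s0 mB).
rewrite -/SA -/SB.
have -> : mu SB = mu (SB `\` SA) + mu (SB `&` SA).
  by rewrite (measureDI mu mSB mSA).
rewrite addeA -measureU//; last 2 first.
- exact: measurableD.
- by rewrite setDE setICA setICr setI0.
apply: leeD.
  apply: le_measure; rewrite ?inE//.
    by apply: measurableU => //; exact: measurableD.
  move=> x [Sx|[Sx _]].
    have := ABC _ _ Sx Bb; congr C.
    by field; rewrite gt_eqF.
  have := ABC _ _ Aa Sx; congr C.
  by field; rewrite gt_eqF.
(* This interval has length [(1 - t) e + t e = e]. *)
pose I : set R := `[(t * a + (1 - t) * (b - e))%R,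
  (t * (a + e) + (1 - t) * b)%R]%classic.
have SI : SB `&` SA `<=` I.
  move=> x [Sb Sa]; rewrite /I/= in_itv/=; apply/andP; split.
    have -> : x = (t * a + (1 - t) *
        ((1 - t)^-1 * x - (1 - t)^-1 * (t * a)))%R by field; rewrite gt_eqF.
    rewrite lerD2l ler_pM2l// lerBlDr ltW//.
    by apply: lt_le_trans be _; rewrite lerD2r; exact: ge_inf.
  have -> : x = (t * (t^-1 * x - t^-1 * ((1 - t) * b)) + (1 - t) * b)%R.
    by field; rewrite gt_eqF.
  rewrite lerD2r ler_pM2l// -lerBlDr ltW//.
  by apply: le_lt_trans ae; rewrite lerD2r; exact: ub_le_sup.
have muI : mu I <= e%:E.
  rewrite /I lebesgue_measure_itv/= lte_fin; case: ifP => _.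
    by rewrite -EFinB lee_fin; move: t0 t1 e0; clear; lra.
  by rewrite lee_fin ltW.
apply: le_trans muI; apply: le_measure => //; rewrite inE.
  exact: measurableI.
exact: measurable_itv.
Qed.

End brunn_minkowski_line.

Import HBNNSimple.

Section prekopa_leindler.
Context {R : realType}.
Local Notation mu := (@lebesgue_measure R).
Local Notation leb := (@lebesgue_cV R).
Local Open Scope ereal_scope.

(** Young's inequality with the conjugate exponents [1 / t] and [1 / (1 - t)]. *)
Lemma powR_AMGM (t x y : R) : (0 < t < 1)%R -> (0 <= x)%R -> (0 <= y)%R ->
  (x `^ t * y `^ (1 - t) <= t * x + (1 - t) * y)%R.
Proof.
move=> /andP[t0 t1] x0 y0; have s0 : (0 < 1 - t)%R by rewrite subr_gt0.
have := @conjugate_powR R (x `^ t)%R (y `^ (1 - t))%R (t^-1)%R ((1 - t)^-1)%R.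
rewrite !powR_ge0 !invr_gt0 t0 s0 !invrK -!powRrM !mulfV ?gt_eqF// !powRr1//.
rewrite [(x * _)%R]mulrC [(y * _)%R]mulrC => H.
by apply: H => //; rewrite addrC subrK.
Qed.

Lemma layer_cake_scale d (T : measurableType d)
    (m : {sigma_finite_measure set T -> \bar R}) (a : R) (f : T -> \bar R) :
  (0 < a)%R -> measurable_fun setT f -> (forall x, 0 <= f x) ->
  a^-1%:E * \int[m]_x f x =
  \int[mu]_(u in `]0%R, +oo[) m [set x | (a * u)%:E < f x].
Proof.
move=> a0 mf f0; have ai0 : (0 <= a^-1)%R by rewrite invr_ge0 ltW.
rewrite -ge0_integralZl//.
rewrite layer_cake; first last.
- by move=> x; rewrite mule_ge0.
- exact: measurable_funeM.
apply: eq_integral => u _; congr (m _); apply/seteqP.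
by split => x /=; rewrite lte_pdivlMl// -EFinM.
Qed.

(* Hypothesis h(t x + (1 - t) y) >= f(x)^t g(y)^(1 - t), phrased with
   finite lower bounds so that no power of +oo is needed. *)
Definition pl_triple (V : lmodType R) (t : R) (f g h : V -> \bar R) :=
  forall (x y : V) (p q : R), (0 < p)%R -> (0 < q)%R ->
    p%:E < f x -> q%:E < g y ->
    (p `^ t * q `^ (1 - t))%:E <= h (t *: x + (1 - t) *: y)%R.

(** Brunn-Minkowski on the line fails when exactly one of the two sets is empty. Measuring the
    levels of [f] and [g] relative to their suprema [a] and [b] makes both superlevel sets nonempty
    for [u < 1] and both empty for [u >= 1]. Integrating over [u] gives an arithmetic mean of
    normalized integrals, which dominates the geometric mean. *)
Lemma prekopa_leindler_bounded (t p q M : R) (f g : R -> R) (h : R -> \bar R) :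
  (0 < t < 1)%R ->
  measurable_fun setT f -> measurable_fun setT g -> measurable_fun setT h ->
  (forall x, 0 <= f x <= M)%R -> (forall x, 0 <= g x <= M)%R ->
  (forall x, 0 <= h x) ->
  (forall x, (0 < f x)%R -> (`|x| <= M)%R) ->
  (forall x, (0 < g x)%R -> (`|x| <= M)%R) ->
  @pl_triple R^o t (EFin \o f) (EFin \o g) h ->
  (0 < p)%R -> (0 < q)%R ->
  p%:E < \int[mu]_x (f x)%:E -> q%:E < \int[mu]_x (g x)%:E ->
  (p `^ t * q `^ (1 - t))%:E <= \int[mu]_x h x.
Proof.
move=> /[dup] t01 /andP[t0 t1] mf mg mh fM gM h0 fs gs fgh p0 q0 pf qg.
have s0 : (0 < 1 - t)%R by rewrite subr_gt0.
have supP (k : R -> R) (r : R) : (forall x, 0 <= k x <= M)%R -> (0 < r)%R ->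
    r%:E < \int[mu]_x (k x)%:E -> has_sup (range k) /\ (0 < sup (range k))%R.
  move=> kM r0 rk.
  have ub : has_ubound (range k).
    by exists M => _ [x _ <-]; have /andP[] := kM x.
  split; first by split => //; exists (k 0%R); exists 0%R.
  rewrite ltNge; apply/negP => k0; move: rk; apply/negP; rewrite -leNgt.
  rewrite integral0_eq ?lee_fin ?ltW// => x _; congr EFin; apply/eqP.
  have /andP[kx0 _] := kM x; rewrite eq_le kx0 andbT.
  by apply: le_trans k0; apply: ub_le_sup => //; exists x.
have [[_ fub] a0] := supP f p fM p0 pf; have [[_ gub] b0] := supP g q gM q0 qg.
set a := sup _ in a0; set b := sup _ in b0.
pose c : R := (a `^ t * b `^ (1 - t))%R.
have c0 : (0 < c)%R by rewrite mulr_gt0// powR_gt0.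
have lev u : (0 < u)%R ->
    t%:E * mu [set x | (a * u)%:E < (f x)%:E] +
    (1 - t)%:E * mu [set x | (b * u)%:E < (g x)%:E] <=
    mu [set x | (c * u)%:E < h x].
  move=> u0.
  have mlt (k : R -> \bar R) (r : R) : measurable_fun setT k ->
      measurable [set x | r%:E < k x].
    move=> mk; rewrite -[X in measurable X]setTI.
    exact: (measurable_lte measurableT (f := cst r%:E)).
  have [u1|u1] := leP 1%R u.
    rewrite [X in mu X](_ : _ = set0); last first.
      apply/seteqP; split => // x /=; rewrite lte_fin; apply/negP; rewrite -leNgt.
      apply: (@le_trans _ _ a); last by rewrite ler_peMr// ltW.
      by apply: ub_le_sup => //; exists x.
    rewrite [X in _ + _ * mu X](_ : _ = set0); last first.
      apply/seteqP; split => // x /=; rewrite lte_fin; apply/negP; rewrite -leNgt.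
      apply: (@le_trans _ _ b); last by rewrite ler_peMr// ltW.
      by apply: ub_le_sup => //; exists x.
    by rewrite measure0 !mule0 adde0 measure_ge0.
  have fM' : measurable_fun setT (EFin \o f) by exact/measurable_EFinP.
  have gM' : measurable_fun setT (EFin \o g) by exact/measurable_EFinP.
  have inh (k : R -> R) (z : R) : has_ubound (range k) -> (0 < sup (range k))%R ->
      [set x | (sup (range k) * u)%:E < (k x)%:E] !=set0.
    move=> ku k0; have hs : has_sup (range k).
      by split => //; exists (k 0%R); exists 0%R.
    have e0 : (0 < sup (range k) * (1 - u))%R by rewrite mulr_gt0// subr_gt0.
    have [_ [x _ <-] kx] := sup_adherent e0 hs.
    exists x => /=; rewrite lte_fin; apply: le_lt_trans kx.
    by rewrite mulrBr mulr1 opprB addrC subrK.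
  apply: brunn_minkowski_line => //; try exact: mlt.
  - exact: (inh f 0%R).
  - exact: (inh g 0%R).
  - exists M => x /=; rewrite lte_fin => xf.
    apply: le_trans (ler_norm x) (fs x _); apply: lt_trans xf.
    by rewrite mulr_gt0.
  - exists (- M)%R => x /=; rewrite lte_fin => xg.
    have := gs x; rewrite ler_norml => H.
    have /H/andP[//] : (0 < g x)%R by apply: lt_trans xg; rewrite mulr_gt0.
  move=> x y /=; rewrite !lte_fin => xf yg.
  (* Values strictly between the level and the function: the hypothesis on [h] yields only a weak
     inequality, while membership in the superlevel set of [h] is strict. *)
  pose p' := ((a * u + f x) / 2)%R; pose q' := ((b * u + g y) / 2)%R.
  have au0 : (0 < a * u)%R by rewrite mulr_gt0.
  have bu0 : (0 < b * u)%R by rewrite mulr_gt0.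
  have [p1 p2] : (a * u < p' /\ p' < f x)%R by rewrite /p'; split; lra.
  have [q1 q2] : (b * u < q' /\ q' < g y)%R by rewrite /q'; split; lra.
  apply: lt_le_trans (fgh x y p' q' _ _ _ _); rewrite ?lte_fin//;
    [|exact: lt_trans p1|exact: lt_trans q1].
  have -> : (c * u = (a * u) `^ t * (b * u) `^ (1 - t))%R.
    rewrite !powRM ?ltW// mulrACA -powRD ?(gt_eqF u0) ?implybT//.
    by rewrite [(t + _)%R]addrC subrK powRr1 ?ltW.
  have p'0 : (0 < p')%R by exact: lt_trans p1.
  have q'0 : (0 < q')%R by exact: lt_trans q1.
  apply: ltr_pM; rewrite ?powR_ge0//.
    by rewrite gt0_ltr_powR ?nnegrE ?(ltW au0) ?(ltW p'0).
  by rewrite gt0_ltr_powR ?nnegrE ?(ltW bu0) ?(ltW q'0).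
have mf' : measurable_fun setT (EFin \o f) by exact/measurable_EFinP.
have mg' : measurable_fun setT (EFin \o g) by exact/measurable_EFinP.
have mF d (T : measurableType d) (m : {sigma_finite_measure set T -> \bar R})
    (k : T -> \bar R) (r : R) : measurable_fun setT k ->
    measurable_fun setT (fun u : R => m [set x | (r * u)%:E < k x]).
  move=> mk.
  have mS : measurable [set z : R * T | (r * z.1)%:E < k z.2].
    rewrite -[X in measurable X]setTI.
    apply: (measurable_lte measurableT (f := fun z : R * T => (r * z.1)%:E)
       (g := k \o snd)).
      by apply/measurable_EFinP; apply: measurable_funM.
    by apply: measurableT_comp => //; exact: measurable_snd.
  have := measurable_fun_xsection m mS.
  apply: eq_measurable_fun => u _ /=; congr (m _).
  by apply/seteqP; split => x; rewrite /xsection/= inE.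
have key : t%:E * (a^-1%:E * \int[mu]_x (f x)%:E) +
    (1 - t)%:E * (b^-1%:E * \int[mu]_x (g x)%:E) <= c^-1%:E * \int[mu]_x h x.
  rewrite (layer_cake_scale mu a0 mf')//; last first.
    by move=> x; rewrite lee_fin; have /andP[] := fM x.
  rewrite (layer_cake_scale mu b0 mg')//; last first.
    by move=> x; rewrite lee_fin; have /andP[] := gM x.
  rewrite (layer_cake_scale mu c0 mh)//.
  rewrite -!ge0_integralZl ?lee_fin ?(ltW t0) ?(ltW s0)//; try exact: measurable_funTS (mF _ _ _ _ _ _).
  rewrite -ge0_integralD//; try by
    move=> u _; rewrite mule_ge0 ?lee_fin ?(ltW t0) ?(ltW s0) ?measure_ge0.
  - apply: ge0_le_integral => //.
    + by move=> u _; rewrite adde_ge0// mule_ge0 ?lee_fin ?(ltW t0) ?(ltW s0) ?measure_ge0.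
    + apply: emeasurable_funD; apply: measurable_funeM;
      exact: measurable_funTS (mF _ _ _ _ _ _).
    + exact: measurable_funTS (mF _ _ _ _ _ _).
    + by move=> u /=; rewrite in_itv/= andbT => u0; exact: lev.
  - by apply: measurable_funeM; exact: measurable_funTS (mF _ _ _ _ _ _).
  - by apply: measurable_funeM; exact: measurable_funTS (mF _ _ _ _ _ _).
(* Factoring out [c] leaves the geometric mean of [p / a] and [q / b], to which the
   arithmetic-geometric inequality applies. *)
have -> : (p `^ t * q `^ (1 - t) =
    c * ((p / a) `^ t * (q / b) `^ (1 - t)))%R.
  rewrite /c mulrACA -!powRM ?divr_ge0 ?ltW//.
  by rewrite ![(_ * (_ / _))%R]mulrC !divfK ?gt_eqF.
rewrite EFinM -lee_pdivlMl//; apply: le_trans key.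
apply: (@le_trans _ _ (t * (p / a) + (1 - t) * (q / b))%:E).
  by rewrite lee_fin powR_AMGM ?divr_ge0 ?ltW.
rewrite EFinD !EFinM [X in _ * X + _]muleC [X in _ + _ * X]muleC.
apply: leeD; apply: lee_wpmul2l; rewrite ?lee_fin ?(ltW t0) ?(ltW s0)//;
  apply: lee_wpmul2r; rewrite ?lee_fin ?invr_ge0 ?(ltW a0) ?(ltW b0)//;
  exact: ltW.
Qed.


(** A simple function from the supremum defining the integral, cut off to [[-i, i]]; monotone
    convergence keeps the integral above [p]. The single bound [M] serves for the values and for the
    support, the latter making the superlevel sets bounded. *)
Lemma bounded_lower_approximation (f : R -> \bar R) (p : R) :
  measurable_fun setT f -> (forall x, 0 <= f x) -> p%:E < \int[mu]_x f x ->
  exists (M : R) (k : R -> R), [/\ measurable_fun setT k,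
    (forall x, 0 <= k x <= M)%R, (forall x, (k x)%:E <= f x),
    (forall x, (0 < k x)%R -> (`|x| <= M)%R) & p%:E < \int[mu]_x (k x)%:E].
Proof.
move=> mf f0; rewrite ge0_integralTE// => /ereal_sup_gt[_ [k kf <-]].
rewrite -integralT_nnsfun => pk.
have mk : measurable_fun setT k by [].
have k0 x : (0 <= k x)%R by [].
have [N kN] : exists N : R, forall x, (k x <= N)%R.
  have [N [_ kN]] := simple_bounded k.
  exists (N + 1)%R => x.
  by apply: le_trans (ler_norm _) _; apply: (kN (N + 1)%R) => //; rewrite ltrDl.
pose F (i : nat) : set R := `[(- i%:R)%R, (i%:R)%R]%classic.
have mF i : measurable (F i) by exact: measurable_itv.
have Fcvg : \int[mu]_(x in F i) (k x)%:E @[i --> \oo] -->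
    \int[mu]_(x in \bigcup_i F i) (k x)%:E.
  apply: ge0_nondecreasing_set_cvg_integral => //.
  - move=> a b ab; apply/subsetPset => x; rewrite /F/= !in_itv/=.
    by rewrite -!ler_norml => /le_trans; apply; rewrite ler_nat.
  - by move=> a; apply: measurable_funTS; exact/measurable_EFinP.
  - by move=> a x _; rewrite lee_fin.
have TF : \bigcup_i F i = setT.
  apply/seteqP; split => // x _; exists (Num.truncn `|x|).+1 => //.
  by rewrite /F/= in_itv/= -ler_norml ltW// truncnS_gt.
have [i pi] : exists i, p%:E < \int[mu]_(x in F i) (k x)%:E.
  apply: contrapT => /forallNP H; move: pk; apply/negP; rewrite -leNgt.
  rewrite -TF -(cvg_lim _ Fcvg)//; apply: lime_le; first exact: cvgP Fcvg.
  by apply: nearW => i; rewrite leNgt; exact/negP/H.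
exists (Num.max N i%:R), (fun x => k x * \1_(F i) x)%R; split.
- by apply: measurable_funM => //; exact: measurable_indic.
- move=> x; rewrite mulr_ge0//= le_max (le_trans _ (kN x))//.
  by rewrite ler_piMr// indicE; case: (_ \in _).
- move=> x; apply: le_trans (kf x); rewrite lee_fin.
  by rewrite ler_piMr// indicE; case: (_ \in _).
- move=> x; rewrite indicE; case: (boolP (x \in F i)) => [|_]; last first.
    by rewrite mulr0 ltxx.
  by rewrite inE /F/= in_itv/= -ler_norml => xi _; rewrite le_max xi orbT.
apply: lt_le_trans pi _; rewrite integral_mkcond le_eqVlt; apply/orP; left.
apply/eqP; apply: eq_integral => x _; rewrite patchE indicE.
by case: (x \in F i); rewrite ?mulr1 ?mulr0.
Qed.

Lemma prekopa_leindler_line (t p q : R) (f g h : R -> \bar R) :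
  (0 < t < 1)%R ->
  measurable_fun setT f -> measurable_fun setT g -> measurable_fun setT h ->
  (forall x, 0 <= f x) -> (forall x, 0 <= g x) -> (forall x, 0 <= h x) ->
  @pl_triple R^o t f g h -> (0 < p)%R -> (0 < q)%R ->
  p%:E < \int[mu]_x f x -> q%:E < \int[mu]_x g x ->
  (p `^ t * q `^ (1 - t))%:E <= \int[mu]_x h x.
Proof.
move=> t01 mf mg mh f0 g0 h0 fgh p0 q0 pf qg.
have [M [k [mk kM kf ks pk]]] := bounded_lower_approximation mf f0 pf.
have [N [l [ml lN lg ls ql]]] := bounded_lower_approximation mg g0 qg.
apply: (@prekopa_leindler_bounded t p q (Num.max M N) k l h) => //.
- by move=> x; have /andP[-> kx] := kM x; rewrite le_max kx.
- by move=> x; have /andP[-> lx] := lN x; rewrite le_max lx orbT.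
- by move=> x /ks xM; rewrite le_max xM.
- by move=> x /ls xN; rewrite le_max xN orbT.
move=> x y p' q' p'0 q'0 pkx qly; apply: fgh => //.
  exact: lt_le_trans pkx (kf _).
exact: lt_le_trans qly (lg _).
Qed.

(** The conclusion has the same shape as [pl_triple]. Hence the induction hypothesis, applied to
    slices, says exactly that the marginals in the first coordinate form a triple on the line. For
    [n = 0] the integral is evaluation at the only point. *)
Lemma prekopa_leindler n (t p q : R) (f g h : 'cV[R]_n -> \bar R) :
  (0 < t < 1)%R ->
  measurable_fun setT f -> measurable_fun setT g -> measurable_fun setT h ->
  (forall x, 0 <= f x) -> (forall x, 0 <= g x) -> (forall x, 0 <= h x) ->
  pl_triple t f g h -> (0 < p)%R -> (0 < q)%R ->
  p%:E < \int[leb n]_x f x -> q%:E < \int[leb n]_x g x ->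
  (p `^ t * q `^ (1 - t))%:E <= \int[leb n]_x h x.
Proof.
move=> t01; elim: n p q f g h => [|n IH] p q f g h mf mg mh f0 g0 h0 fgh p0 q0.
  rewrite /= !integral_dirac//; rewrite !diracT !mul1e => pf qg.
  have := fgh _ _ _ _ p0 q0 pf qg; congr (_ <= h _).
  by apply/colP => -[].
have mF (k : 'cV[R]_n.+1 -> \bar R) : measurable_fun setT k ->
    (forall x, 0 <= k x) ->
    measurable_fun setT (fun s => \int[leb n]_y k (cV_cons (s, y))).
  move=> mk k0.
  apply: (measurable_fun_fubini_tonelli_F (m2 := leb n) (k \o @cV_cons R n)).
    exact: (measurableT_comp mk (@measurable_cV_cons R n)).
  by move=> z /=.
rewrite (ge0_integral_cV_cons_swap mf f0) (ge0_integral_cV_cons_swap mg g0).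
rewrite (ge0_integral_cV_cons_swap mh h0).
apply: prekopa_leindler_line => //; try exact: mF.
- by move=> s; exact: integral_ge0.
- by move=> s; exact: integral_ge0.
- by move=> s; exact: integral_ge0.
move=> a b p' q' p'0 q'0 pf qg.
apply: (IH p' q' (fun y => f (cV_cons (a, y))) (fun y => g (cV_cons (b, y)))) => //;
  try exact: measurable_cV_section2.
move=> x y p2 q2 p20 q20 p2f q2g.
by have := fgh _ _ _ _ p20 q20 p2f q2g; rewrite -!cV_consZ -cV_consD.
Qed.

End prekopa_leindler.

(** * Re-centring intervals and sets *)

Lemma measurable_indicM d (T : measurableType d) (R : realType) (S : set T)
    (k : T -> R) : measurable S -> measurable_fun setT k ->
  measurable_fun setT (fun s => (\1_S s * k s)%:E).
Proof.
by move=> mS mk; apply/measurable_EFinP; exact: measurable_funM.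
Qed.

Section recentering_line.
Context {R : realType}.
Local Notation mu := (@lebesgue_measure R).
Local Open Scope ereal_scope.

Variable q : R -> R.
Hypothesis mq : measurable_fun setT q.
Hypothesis q0 : forall s, (0 <= q s)%R.
Hypothesis q_radial : forall s r, (`|s| <= `|r|)%R -> (q r <= q s)%R.

Let L (h u : R) := \int[mu]_s (\1_[set s | `|s - u| < h]%R s * q s)%:E.

Let mball (u h : R) : measurable [set s : R | (`|s - u| < h)%R].
Proof.
rewrite (_ : [set _ | _] = ball u h); first exact: measurable_ball.
by apply/seteqP; split => s; rewrite /ball/= distrC.
Qed.

Let LN h u : L h (- u) = L h u.
Proof.
rewrite /L -[RHS]ge0_integral_opp.
- apply: eq_integral => s _; congr ((_ * _)%:E).
    rewrite !indicE; congr ((nat_of_bool _)%:R).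
    by apply/idP/idP; rewrite !inE/= -normrN opprD opprK.
  by apply/eqP; rewrite eq_le !q_radial// normrN.
- exact: measurable_indicM.
- by move=> s; rewrite lee_fin mulr_ge0.
Qed.

(* Reflection in (u + v) / 2 exchanges the two windows and brings the part
   of the farther one that sticks out closer to the origin. *)
Let L_mono0 h u v : (0 <= v)%R -> (v <= u)%R -> L h u <= L h v.
Proof.
move=> v0 vu; rewrite /L.
pose U := [set s : R | (`|s - u| < h)%R]; pose V := [set s : R | (`|s - v| < h)%R].
have mU : measurable U by exact: mball.
have mV : measurable V by exact: mball.
have i0 (S : set R) s : 0 <= (\1_S s * q s)%:E by rewrite lee_fin mulr_ge0.
have split_int (S T : set R) : measurable S -> measurable T ->
    \int[mu]_s (\1_S s * q s)%:E =
    \int[mu]_s (\1_(S `&` T) s * q s)%:E + \int[mu]_s (\1_(S `\` T) s * q s)%:E.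
  move=> mS mT; rewrite -ge0_integralD//; last 2 first.
  - by apply: measurable_indicM => //; exact: measurableI.
  - by apply: measurable_indicM => //; exact: measurableD.
  apply: eq_integral => s _; rewrite -EFinD -mulrDl; congr ((_ * _)%:E).
  rewrite !indicE in_setI in_setD.
  by case: (s \in S); case: (s \in T); rewrite /= ?addr0 ?add0r.
rewrite (split_int U V)// (split_int V U)// setIC leeD2l//.
rewrite -ge0_integral_opp//; last by apply: measurable_indicM => //; exact: measurableD.
rewrite -(ge0_integral_shift (- (u + v))); last 2 first.
- apply: (measurableT_comp (measurable_indicM (measurableD mU mV) mq)).
  exact: oppr_measurable.
- by move=> s.
apply: ge0_le_integral => //.
- apply: (measurableT_comp (measurable_indicM (measurableD mU mV) mq)).
  by apply: measurable_funN; exact: measurable_funD.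
- by apply: measurable_indicM => //; exact: measurableD.
move=> s _; rewrite lee_fin opprD opprK.
have -> : \1_(U `\` V) (- s + (u + v))%R = \1_(V `\` U) s :> R.
  rewrite !indicE; congr ((nat_of_bool _)%:R).
  apply/idP/idP; rewrite !inE /U /V/=.
    rewrite (_ : - s + (u + v) - u = - (s - v))%R; last by lra.
    by rewrite (_ : - s + (u + v) - v = - (s - u))%R ?normrN//; last by lra.
  rewrite (_ : - s + (u + v) - u = - (s - v))%R; last by lra.
  by rewrite (_ : - s + (u + v) - v = - (s - u))%R ?normrN//; last by lra.
rewrite indicE; case: (boolP (s \in V `\` U)); last by rewrite !mul0r.
rewrite inE /U /V /= => -[sv /negP]; rewrite -leNgt => su.
rewrite ler_wpM2l// q_radial//.
(* A point of the window of [v] outside that of [u] is closer to [v], so it lies below the midpoint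
   [(u + v) / 2]. As [u + v >= 0], its mirror image [u + v - s] is then at least as far from 0. *)
have : (`|s - v| < `|s - u|)%R by exact: lt_le_trans su.
rewrite -ltr_sqr ?nnegrE// !real_normK ?num_real// => sqr.
have s2 : (s < u + v - s)%R.
  have uv : (v < u)%R.
    by rewrite lt_neqAle vu andbT; apply: contraTneq sqr => ->; rewrite ltxx.
  rewrite -subr_lt0.
  have : ((u - v) * (s - (u + v - s)) < 0)%R.
    rewrite (_ : _ * _ = (s - v) ^+ 2 - (s - u) ^+ 2)%R; last by ring.
    by rewrite subr_lt0.
  by rewrite pmulr_rlt0// subr_gt0.
rewrite (_ : - s + (u + v) = u + v - s)%R; last by lra.
rewrite [X in (_ <= X)%R]ger0_norm ?ler_norml; last by lra.
by apply/andP; split; lra.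
Qed.

Lemma recentered_window_le h u v : (`|v| <= `|u|)%R -> L h u <= L h v.
Proof.
move=> vu.
have Labs w : L h w = L h `|w|.
  have [w0|w0] := leP 0%R w; first by rewrite ger0_norm.
  by rewrite ltr0_norm// LN.
by rewrite (Labs u) (Labs v); apply: L_mono0.
Qed.

(** Up to its endpoints, [I] shifted by [-z] is the window of half-width [(r - l) / 2] about
    [(l + r) / 2 - z]. *)
Lemma recentered_interval_le (I : set R) (l r x y : R) : (l < r)%R ->
  measurable I -> `]l, r[%classic `<=` I -> I `<=` `[l, r]%classic ->
  (`|y - (l + r) / 2| <= `|x - (l + r) / 2|)%R ->
  \int[mu]_s (\1_I s * q (s - x))%:E <= \int[mu]_s (\1_I s * q (s - y))%:E.
Proof.
move=> lr mI Il Ir yx.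
suff key z : \int[mu]_s (\1_I s * q (s - z))%:E =
    L ((r - l) / 2) (- (z - (l + r) / 2)).
  by rewrite !key; apply: recentered_window_le; rewrite !normrN.
have mz : measurable_fun setT (fun s : R => q (s - z)%R).
  by apply: (measurableT_comp mq); exact: measurable_funB.
transitivity (\int[mu]_s (\1_(`]l, r[%classic) s * q (s - z))%:E).
  apply: ae_eq_integral => //.
  - exact: measurable_indicM.
  - exact: measurable_indicM.
  exists ([set l] `|` [set r]); split.
  - exact: measurableU.
  - by apply: countable_lebesgue_measure0; apply: finite_set_countable;
      rewrite finite_setU; split; exact: finite_set1.
  move=> s /= H; apply: contrapT => /not_orP[/eqP sl /eqP sr]; apply: H => _.
  congr ((_ * _)%:E); rewrite !indicE; congr ((nat_of_bool _)%:R).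
  apply/idP/idP; rewrite !inE; last exact: Il.
  move=> /Ir; rewrite /= !in_itv/= => /andP[ls sr'].
  by rewrite !lt_neqAle ls sr' eq_sym sl sr.
rewrite /L -[RHS](ge0_integral_shift (- z)).
- apply: eq_integral => s _; congr ((_ * _)%:E).
  rewrite !indicE; congr ((nat_of_bool _)%:R).
  apply/idP/idP; rewrite !inE/= !in_itv/= ltr_norml.
    by move=> /andP[? ?]; apply/andP; split; lra.
  by move=> /andP[? ?]; apply/andP; split; lra.
- exact: measurable_indicM.
- by move=> s; rewrite lee_fin mulr_ge0.
Qed.

End recentering_line.

Section interval_endpoints.
Context {R : realType}.
Local Notation mu := (@lebesgue_measure R).
Local Open Scope ereal_scope.

(** Positive finite length excludes degenerate and unbounded intervals. Which endpoints belong to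
    [I] is left open, since they form a null set. *)
Lemma interval_endpoints (I : set R) : is_interval I -> 0 < mu I -> mu I < +oo ->
  exists lr : R * R, [/\ (lr.1 < lr.2)%R, `]lr.1, lr.2[%classic `<=` I &
    I `<=` `[lr.1, lr.2]%classic].
Proof.
move=> /is_intervalP -> ; set i := Rhull I.
rewrite lebesgue_measure_itv; case: i => -[b1 l|[]] [b2 r|[]] //=;
  rewrite ?ltNyr ?ltry ?ltxx//=.
rewrite lte_fin; case: ifPn => [lr _ _|_]; last by rewrite ltxx.
exists (l, r); split => //= x; rewrite /= !in_itv/=.
  by move=> /andP[lx xr]; rewrite !lteifS.
by move=> /andP[/lteifW -> /lteifW ->].
Qed.

(* Expresses the midpoint of an interval through its length only, so that the
   midpoint of a fibre is seen to be a measurable function of the fibre. *)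
Lemma midpoint_gtP (I : set R) (l r a : R) : (l < r)%R -> measurable I ->
  `]l, r[%classic `<=` I -> I `<=` `[l, r]%classic ->
  (a < (l + r) / 2)%R <-> mu I < 2%:E * mu (I `&` `]a, +oo[%classic).
Proof.
move=> lr mI Il Ir.
have sand (J J1 J2 : set R) (v : \bar R) : measurable J -> measurable J1 ->
    measurable J2 -> J1 `<=` J -> J `<=` J2 -> mu J1 = v -> mu J2 = v -> mu J = v.
  move=> mJ mJ1 mJ2 s1 s2 e1 e2; apply/eqP; rewrite eq_le -{1}e2 -e1.
  by rewrite !le_measure ?inE.
have -> : mu I = (r - l)%:E.
  apply: (sand I `]l, r[%classic `[l, r]%classic) => //.
    by rewrite lebesgue_measure_itv/= lte_fin lr EFinB.
  by rewrite lebesgue_measure_itv/= lte_fin lr EFinB.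
have ma : measurable (`]a, +oo[%classic : set R) by [].
have [ar|ra] := ltP a r; last first.
  have -> : mu (I `&` `]a, +oo[%classic) = 0.
    apply/eqP; rewrite eq_le measure_ge0 andbT -(lebesgue_measure_set1 r).
    apply: le_measure; rewrite ?inE//; first exact: measurableI.
    move=> s [/Ir]; rewrite /= !in_itv/= => /andP[_ sr] /andP[sa _].
    by apply/eqP; rewrite eq_le sr (le_trans ra)// ltW.
  rewrite mule0 lte_fin; split; lra.
have -> : mu (I `&` `]a, +oo[%classic) = (r - Num.max l a)%:E.
  apply: (sand _ `](Num.max l a), r[%classic `[(Num.max l a), r]%classic) => //.
  - exact: measurableI.
  - move=> s; rewrite /= !in_itv/= gt_max andbT => /andP[/andP[ls as_] sr].
    by split => //; apply: Il; rewrite /= in_itv/= ls.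
  - move=> s [/Ir]; rewrite /= !in_itv/= ge_max => /andP[-> ->] /andP[as_ _].
    by rewrite ltW.
  - by rewrite lebesgue_measure_itv/= lte_fin gt_max lr ar EFinB.
  - by rewrite lebesgue_measure_itv/= lte_fin gt_max lr ar EFinB.
rewrite -EFinM lte_fin; split; case: (leP l a) => la; lra.
Qed.

End interval_endpoints.

(** Markov's inequality. *)
Lemma level_measure_lty d (T : measurableType d) (R : realType)
    (m : {measure set T -> \bar R}) (f : T -> \bar R) (t : R) :
  measurable_fun setT f -> (forall x, (0 <= f x)%E) ->
  (\int[m]_x f x < +oo)%E -> 0 < t -> (m [set x | (t%:E < f x)%E] < +oo)%E.
Proof.
move=> mf f0 foo t0; set A := [set x | _].
have mA : measurable A.
  rewrite -[X in measurable X]setTI.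
  exact: (measurable_lte measurableT (f := cst t%:E)).
have : (t%:E * m A <= \int[m]_x f x)%E.
  rewrite -integral_cst//; apply: (@le_trans _ _ (\int[m]_(x in A) f x)%E).
    apply: ge0_le_integral => //.
    - by move=> x _; rewrite lee_fin ltW.
    - exact: measurable_funTS.
    - by move=> x /ltW.
  exact: ge0_subset_integral.
move=> /le_lt_trans/(_ foo).
by rewrite -lte_pdivlMl// gt0_muley// lte_fin invr_gt0.
Qed.

Lemma integral_one d (T : measurableType d) (R : realType)
    (m : {measure set T -> \bar R}) (A : set T) : measurable A ->
  (\int[m]_(z in A) (cst 1%R z : R)%:E = m A)%E.
Proof. by move=> mA; rewrite -[RHS]mul1e -integral_cst. Qed.

Lemma integral_indicM d (T : measurableType d) (R : realType)
    (m : {measure set T -> \bar R}) (A : set T) (k : T -> R) :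
  (\int[m]_(z in A) (k z)%:E = \int[m]_z (\1_A z * k z)%:E)%E.
Proof.
rewrite integral_mkcond; apply: eq_integral => z _; rewrite patchE indicE.
by case: (z \in A); rewrite ?mul1r ?mul0r.
Qed.

(** * Moving the fibres of a set *)

Section recentering_set.
Context {R : realType} {n : nat}.
Local Notation mu := (@lebesgue_measure R).
Local Notation leb := (@lebesgue_cV R).
Local Open Scope ereal_scope.

Variable A : set 'cV[R]_n.+1.
Hypothesis mA : measurable A.
Hypothesis Afin : leb n.+1 A < +oo.
Hypothesis Aitv : forall y, is_interval [set s | A (cV_cons (s, y))].

Let fibre (y : 'cV[R]_n) : set R := [set s | A (cV_cons (s, y))].

Let mfibre y : measurable (fibre y).
Proof.
rewrite -[X in measurable X]setTI.
have : measurable_fun setT (fun s : R => cV_cons (s, y)).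
  by apply: (measurableT_comp (@measurable_cV_cons R n)).
by move=> /(_ measurableT A mA).
Qed.

Let measurable_fibre_measure (S : set R) : measurable S ->
  measurable_fun setT (fun y => mu (fibre y `&` S)).
Proof.
move=> mS.
have mAS : measurable [set p : 'cV[R]_n * R | A (cV_cons (p.2, p.1)) /\ S p.2].
  apply: measurableI.
    rewrite -[X in measurable X]setTI.
    have : measurable_fun setT (fun p : 'cV[R]_n * R => cV_cons (p.2, p.1)).
      by apply: (measurableT_comp (@measurable_cV_cons R n));
        exact: measurable_fun_pair.
    by move=> /(_ measurableT A mA).
  by rewrite -[X in measurable X]setTI; apply: measurable_snd.
have := measurable_fun_xsection (@lebesgue_measure R) mAS.
apply: eq_measurable_fun => y _ /=; congr (mu _).
by apply/seteqP; split => s; rewrite /xsection/= inE.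
Qed.

Let measurable_fibre_length : measurable_fun setT (fun y => mu (fibre y)).
Proof.
have := measurable_fibre_measure measurableT.
by under eq_fun do rewrite setIT.
Qed.

Let indic_cons_integral (k : 'cV[R]_n.+1 -> R) : measurable_fun setT k ->
  (forall z, (0 <= k z)%R) ->
  \int[leb n.+1]_(z in A) (k z)%:E =
  \int[leb n]_y \int[mu]_s (\1_(fibre y) s * k (cV_cons (s, y)))%:E.
Proof.
move=> mk k0; rewrite integral_indicM ge0_integral_cV_cons.
- by [].
- exact: measurable_indicM.
- by move=> z; rewrite lee_fin mulr_ge0.
Qed.

Let fibre_finite_ae : {ae leb n, forall y, mu (fibre y) < +oo}.
Proof.
have i : (leb n).-integrable setT (fun y => mu (fibre y)).
  apply/integrableP; split => //.
  under eq_integral do rewrite gee0_abs//.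
  have := @indic_cons_integral (cst 1%R) (measurable_cst _) (fun=> ler01).
  rewrite integral_one// => AE; rewrite [X in X < _](_ : _ = leb n.+1 A)//.
  rewrite AE; apply: eq_integral => y _.
  rewrite -(integral_indicM (@lebesgue_measure R) (fibre y) (cst 1%R)).
  by apply/esym; apply: integral_one; exact: mfibre.
have := integrable_ae measurableT i; apply: filterS => y /(_ I).
by rewrite ge0_fin_numE.
Qed.

(** The fibres that have a midpoint. A fibre of length zero contributes nothing to the integrals,
    and fibres of infinite length occur only over a null set. *)
Let good y := (0 < mu (fibre y)) && (mu (fibre y) < +oo).

Let measurable_good : measurable [set y | good y].
Proof.
rewrite (_ : [set _ | _] =
  [set y | 0 < mu (fibre y)] `&` [set y | mu (fibre y) < +oo]).
  apply: measurableI; rewrite -[X in measurable X]setTI.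
    exact: (measurable_lte measurableT (f := cst 0)).
  exact: (measurable_lte measurableT (g := cst +oo)).
by apply/seteqP; split => y /= /andP.
Qed.

Let is_ends y (lr : R * R) := [/\ (lr.1 < lr.2)%R,
  `]lr.1, lr.2[%classic `<=` fibre y & fibre y `<=` `[lr.1, lr.2]%classic].

Let ends y := xget (0%R, 0%R) (is_ends y).

Let centre y : R := if good y then (((ends y).1 + (ends y).2) / 2)%R else 0%R.

Let endsP y : good y -> is_ends y (ends y).
Proof.
move=> /andP[y0 yoo].
have [lr lrP] := interval_endpoints (@Aitv y) y0 yoo.
exact: (@xgetPex _ (0%R, 0%R) (is_ends y) (ex_intro _ lr lrP)).
Qed.

(** The endpoints come from a choice function, which says nothing about measurability;
    [midpoint_gtP] replaces them by lengths of pieces of the fibre, measurable by Tonelli. Off the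
    good fibres the centre is the default 0, whence the case distinction on the sign of [a]. *)
Let measurable_centre : measurable_fun setT centre.
Proof.
apply: (measurability _ (measurable_realfun.RGenOInfty.measurableE R)).
move=> _ [_ [a ->] <-]; rewrite setTI.
rewrite (_ : _ @^-1` _ = ([set y | good y] `&`
    [set y | mu (fibre y) < 2%:E * mu (fibre y `&` `]a, +oo[%classic)]) `|`
    ((~` [set y | good y]) `&` (if (a < 0)%R then setT else set0))).
  apply: measurableU; apply: measurableI => //.
  - rewrite -[X in measurable X]setTI; apply: measurable_lte => //.
    by apply: measurable_funeM; exact: measurable_fibre_measure.
  - exact: measurableC.
  - by case: ifP.
apply/seteqP; split => y; rewrite /centre /= in_itv/= andbT.
  case: ifPn => gy ay.
    left; split => //; have [lr Il Ir] := endsP gy.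
    exact: (proj1 (midpoint_gtP _ lr (mfibre y) Il Ir)).
  by right; split => //; rewrite ay.
move=> [[gy ay]|[/negP gy]].
  rewrite gy; have [lr Il Ir] := endsP gy.
  exact: (proj2 (midpoint_gtP _ lr (mfibre y) Il Ir)).
by rewrite (negbTE gy); case: ifP.
Qed.

(** The order of quantifiers matters: [B] is fixed before the weight [w] and the translation
    [(t, v)], so it can be used for all values of [X] at once. Equality of volumes is the case of a
    constant weight. *)
Lemma recentering_set (a : R) : (0 <= a <= 1)%R ->
  exists B : set 'cV[R]_n.+1, [/\ measurable B, leb n.+1 B = leb n.+1 A &
    forall (w : 'cV[R]_n.+1 -> R) (t : R) (v : 'cV[R]_n),
      measurable_fun setT w -> (forall z, (0 <= w z)%R) ->
      (forall s r y, (`|s| <= `|r|)%R -> (w (cV_cons (r, y)) <= w (cV_cons (s, y)))%R) ->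
      \int[leb n.+1]_(z in A) (w (z - cV_cons (t, v))%R)%:E <=
      \int[leb n.+1]_(z in B) (w (z - cV_cons (a * t, v)%R)%R)%:E].
Proof.
move=> /andP[a0 a1].
(* The set B is A with the fibre of midpoint c moved to midpoint a c. *)
pose sh (z : 'cV[R]_n.+1) :=
  (z + cV_cons ((1 - a) * centre (cV_uncons z).2, 0))%R.
have msh : measurable_fun setT sh.
  apply: measurable_cVD => //.
  apply: (measurableT_comp (@measurable_cV_cons R n)).
  apply: measurable_fun_pair => //.
  apply: measurable_funM => //; apply: (measurableT_comp measurable_centre).
  by apply: (measurableT_comp measurable_snd); exact: measurable_cV_uncons.
pose B := sh @^-1` A.
have mB : measurable B by rewrite -[X in measurable X]setTI; exact: msh.
have shE s y : sh (cV_cons (s, y)) = cV_cons (s + (1 - a) * centre y, y)%R.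
  by rewrite /sh cV_consK/= -cV_consD addr0.
have BE (k : 'cV[R]_n.+1 -> R) : measurable_fun setT k ->
    (forall z, (0 <= k z)%R) ->
    \int[leb n.+1]_(z in B) (k z)%:E =
    \int[leb n]_y \int[mu]_s
      (\1_(fibre y) s * k (cV_cons (s - (1 - a) * centre y, y)%R))%:E.
  move=> mk k0; rewrite integral_indicM ge0_integral_cV_cons.
  - apply: eq_integral => y _.
    rewrite -[LHS](ge0_integral_shift (- ((1 - a) * centre y))).
    + apply: eq_integral => s _; congr ((_ * _)%:E); rewrite !indicE.
      congr ((nat_of_bool _)%:R).
      by apply/idP/idP; rewrite !inE /B/= shE subrK.
    + have := measurable_cV_section y (measurable_indicM mB mk).
      by [].
    + by move=> s; rewrite lee_fin mulr_ge0.
  - exact: measurable_indicM.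
  - by move=> z; rewrite lee_fin mulr_ge0.
exists B; split => //.
  rewrite -(integral_one _ mB) -(integral_one _ mA).
  have c0 (z : 'cV[R]_n.+1) : (0 <= cst (1 : R) z)%R by exact: ler01.
  by rewrite (BE (cst 1%R) _ c0)// (indic_cons_integral _ c0).
move=> w t v mw w0 w_radial.
have mws (x : 'cV[R]_n.+1) : measurable_fun setT (fun z : 'cV[R]_n.+1 => w (z - x)%R).
  by apply: (measurableT_comp mw); exact: measurable_cVB.
have ws0 (x z : 'cV[R]_n.+1) : (0 <= w (z - x))%R by exact: w0.
rewrite [leRHS](BE _ (mws (cV_cons (a * t, v)%R)) (ws0 _)).
rewrite [leLHS](indic_cons_integral (mws (cV_cons (t, v))) (ws0 _)).
have mcons (g : R * 'cV[R]_n -> R) : measurable_fun setT g ->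
    (forall z, (0 <= g z)%R) ->
    measurable_fun setT (fun y => \int[mu]_s (\1_(fibre y) s * g (s, y))%:E).
  move=> mg g0.
  apply: (measurable_fun_fubini_tonelli_G (m1 := @lebesgue_measure R)
    (fun p : R * 'cV[R]_n => (\1_A (cV_cons p) * g p)%:E)).
    apply/measurable_EFinP; apply: measurable_funM => //.
    by apply: measurable_indic_comp => //; exact: measurable_cV_cons.
  by move=> p; rewrite lee_fin mulr_ge0.
apply: ae_ge0_le_integral => //.
- by move=> y _; apply: integral_ge0 => s _; rewrite lee_fin mulr_ge0.
- apply: (mcons (fun p => w (cV_cons p - cV_cons (t, v))%R)) => //.
  exact: (measurableT_comp (mws _) (@measurable_cV_cons R n)).
- by move=> y _; apply: integral_ge0 => s _; rewrite lee_fin mulr_ge0.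
- apply: (mcons (fun p => w (cV_cons (p.1 - (1 - a) * centre p.2, p.2) -
    cV_cons (a * t, v))%R)) => //.
  apply: (measurableT_comp (mws _)).
  apply: (measurableT_comp (@measurable_cV_cons R n)).
  apply: measurable_fun_pair => //; apply: measurable_funB => //.
  apply: measurable_funM => //; apply: (measurableT_comp measurable_centre).
  exact: measurable_snd.
apply: filterS fibre_finite_ae => y yoo _.
have subE (s u : R) : (cV_cons (s, y) - cV_cons (u, v))%R =
    cV_cons ((s - u)%R, (y - v)%R).
  rewrite -[(- cV_cons _)%R]scaleN1r -cV_consZ -cV_consD mulN1r scaleN1r.
  by [].
pose q (s : R) := w (cV_cons (s, (y - v)%R)).
have mq : measurable_fun setT q.
  apply: (measurableT_comp mw).
  by apply: (measurableT_comp (@measurable_cV_cons R n)).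
rewrite [leLHS](_ : _ = \int[mu]_s (\1_(fibre y) s * q (s - t)%R)%:E); last first.
  by apply: eq_integral => s _; rewrite subE.
rewrite [leRHS](_ : _ = \int[mu]_s (\1_(fibre y) s *
    q (s - ((1 - a) * centre y + a * t))%R)%:E); last first.
  by apply: eq_integral => s _; rewrite subE /q opprD addrA.
have [y0|y0] := boolP (0 < mu (fibre y)); last first.
  rewrite [leLHS](_ : _ = 0); last first.
    transitivity (\int[mu]_(s in fibre y) (q (s - t)%R)%:E).
      exact/esym/(integral_indicM (@lebesgue_measure R) (fibre y)).
    apply: null_set_integral; first exact: mfibre.
      apply/measurable_EFinP; apply: measurable_funTS.
      by apply: (measurableT_comp mq); exact: measurable_funB.
    by apply/eqP; rewrite eq_le measure_ge0 andbT leNgt.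
  by apply: integral_ge0 => s _; rewrite lee_fin mulr_ge0// w0.
have gy : good y by rewrite /good y0.
have [lr Il Ir] := endsP gy.
apply: (@recentered_interval_le R q mq _ _ _ (ends y).1 (ends y).2) => //.
- by move=> s; exact: w0.
- by move=> s r sr; exact: w_radial.
rewrite /centre gy.
(* Undoing the move of the fibre turns the new weight centre [a t] into [(1 - a) c + a t], whose
   offset from [c] is [a] times that of [t]. *)
set c := (_ / 2)%R; rewrite (_ : _ - c = a * (t - c))%R; last by ring.
by rewrite normrM ger0_norm// ler_piMl.
Qed.

End recentering_set.

(** * The excess inequality for dilations of the first coordinate *)

Section smoothing.
Context {R : realType} {d : nat}.
Local Notation V := 'cV[R]_d.
Local Notation leb := (@lebesgue_cV R).
Local Open Scope ereal_scope.

Definition log_concave_fun (f : V -> R) := forall (x y : V) (t : R),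
  (0 < t < 1)%R -> (f x `^ t * f y `^ (1 - t) <= f (t *: x + (1 - t) *: y)%R)%R.

Definition quasi_concave (f : V -> \bar R) := forall (x y : V) (t : R),
  (0 < t < 1)%R -> mine (f x) (f y) <= f (t *: x + (1 - t) *: y)%R.

Definition excess (f : V -> \bar R) (t : R) :=
  \int[leb d]_z maxe (f z - t%:E) 0.

Variable m : probability V R.

(* Density at z of C X + W when X has law m and W has density w. *)
Definition smoothing (w : V -> R) (C : 'M[R]_d) (z : V) : \bar R :=
  \int[m]_x (w (z - C *m x)%R)%:E.

Variable w : V -> R.
Hypothesis mw : measurable_fun setT w.
Hypothesis w0 : forall z, (0 <= w z)%R.

Lemma measurable_smoothing_kernel (C : 'M[R]_d) :
  measurable_fun setT (fun p : V * V => w (p.1 - C *m p.2)%R).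
Proof.
apply: (measurableT_comp mw).
by apply: measurable_cVB => //; apply: measurable_mulmx_cV.
Qed.

Lemma measurable_smoothing C : measurable_fun setT (smoothing w C).
Proof.
apply: (measurable_fun_fubini_tonelli_F (m2 := m)
  (fun p : V * V => (w (p.1 - C *m p.2)%R)%:E)) => [|p].
  by apply/measurable_EFinP; exact: measurable_smoothing_kernel.
by rewrite lee_fin.
Qed.

Lemma smoothing_ge0 C z : 0 <= smoothing w C z.
Proof. by apply: integral_ge0 => x _; rewrite lee_fin. Qed.

Lemma smoothing_le C z (M : R) : (forall x, (w x <= M)%R) ->
  smoothing w C z <= M%:E.
Proof.
move=> wM; apply: (@le_trans _ _ (\int[m]_x (cst M%:E x))).
  apply: ge0_le_integral => //.
  - by move=> x _; rewrite lee_fin.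
  - apply/measurable_EFinP; apply: (measurableT_comp mw).
    by apply: measurable_cVB => //; exact: measurable_mulmx_cV.
  - by move=> x _; rewrite lee_fin.
by rewrite integral_cst//= probability_setT mule1.
Qed.

Lemma integral_smoothing C (A : set V) : measurable A ->
  \int[leb d]_(z in A) smoothing w C z =
  \int[m]_x \int[leb d]_(z in A) (w (z - C *m x)%R)%:E.
Proof.
move=> mA; rewrite integral_mkcond.
pose k (p : V * V) : \bar R := (\1_A p.1 * w (p.1 - C *m p.2)%R)%:E.
have mk : measurable_fun setT k.
  apply/measurable_EFinP; apply: measurable_funM.
    exact: measurable_indic_comp.
  exact: measurable_smoothing_kernel.
transitivity (\int[leb d]_z \int[m]_x k (z, x)).
  apply: eq_integral => z _; rewrite patchE /k/= indicE.
  case: (z \in A).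
    by apply: eq_integral => x _; rewrite mul1r.
  by rewrite integral0_eq// => x _; rewrite mul0r.
rewrite (@fubini_tonelli _ _ _ _ R (leb d) m k mk).
  by apply: eq_integral => x _; exact/esym/integral_indicM.
by move=> p; rewrite lee_fin mulr_ge0.
Qed.

Lemma measurable_kernel_integral (C : 'M[R]_d) (A : set V) : measurable A ->
  measurable_fun setT (fun x : V =>
    \int[leb d]_(z in A) (w (z - C *m x)%R)%:E).
Proof.
move=> mA; have := measurable_fun_fubini_tonelli_G (m1 := leb d)
  (fun p : V * V => (\1_A p.1 * w (p.1 - C *m p.2)%R)%:E).
rewrite /fubini_G/= => H; under eq_fun do rewrite integral_indicM.
apply: H => [|p]; last by rewrite lee_fin mulr_ge0.
apply/measurable_EFinP; apply: measurable_funM.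
  exact: measurable_indic_comp.
exact: measurable_smoothing_kernel.
Qed.

Lemma smoothing_mass C :
  \int[leb d]_z smoothing w C z = \int[leb d]_z (w z)%:E.
Proof.
have mw' : measurable_fun setT (EFin \o w) by exact/measurable_EFinP.
rewrite integral_smoothing//.
transitivity (\int[m]_x (cst (\int[leb d]_z (w z)%:E) x)); last first.
  by rewrite (integral_cst m measurableT) [X in _ * X]probability_setT mule1.
apply: eq_integral => x _.
exact: (ge0_integral_cV_shift (- (C *m x))%R mw').
Qed.

(* Evaluating with A = {f > t} turns excesses into integrals over sets of
   equal measure. *)
Lemma excess_le_sets (f g : V -> \bar R) (t : R) (A B : set V) :
  (0 <= t)%R ->
  measurable_fun setT f -> measurable_fun setT g ->
  (forall z, 0 <= f z) -> (forall z, 0 <= g z) ->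
  A = [set z | t%:E < f z] -> measurable B ->
  leb d A < +oo -> leb d B = leb d A ->
  \int[leb d]_(z in A) f z <= \int[leb d]_(z in B) g z ->
  excess f t <= excess g t.
Proof.
move=> t0 mf mg f0 g0 AE mB Afin BA fg.
have mA : measurable A.
  rewrite AE -[X in measurable X]setTI.
  exact: (measurable_lte measurableT (f := cst t%:E)).
have mmax (k : V -> \bar R) : measurable_fun setT k ->
    measurable_fun setT (fun z => maxe (k z - t%:E) 0).
  move=> mk; apply: measurable_maxe => //.
  by apply: emeasurable_funB.
have cstint (S : set V) : measurable S -> \int[leb d]_(z in S) t%:E = t%:E * leb d S.
  by move=> mS; rewrite integral_cst.
have fE : excess f t + t%:E * leb d A = \int[leb d]_(z in A) f z.
  rewrite -cstint// /excess.
  rewrite [X in X + _ = _](_ : _ = \int[leb d]_(z in A) maxe (f z - t%:E) 0); last first.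
    rewrite [RHS]integral_mkcond; apply: eq_integral => z _; rewrite patchE.
    case: ifPn => //; rewrite notin_setE AE/= => /negP; rewrite -leNgt => ft.
    by rewrite -[RHS]/(0 : \bar R); apply/max_idPr; rewrite EFinN sube_le0.
  rewrite -ge0_integralD//.
  - apply: eq_integral => z; rewrite inE AE/= => tz.
    rewrite (_ : maxe _ _ = f z - t%:E); first by rewrite subeK.
    by apply/max_idPl; rewrite EFinN sube_ge0// ltW.
  - by move=> z _; rewrite le_max lexx orbT.
  - exact: measurable_funTS (mmax _ mf).
have gE : \int[leb d]_(z in B) g z <= excess g t + t%:E * leb d B.
  rewrite -cstint//.
  apply: (@le_trans _ _ (\int[leb d]_(z in B) (maxe (g z - t%:E) 0 + t%:E))).
    apply: ge0_le_integral => //.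
    - exact: measurable_funTS.
    - apply: emeasurable_funD => //; exact: measurable_funTS (mmax _ mg).
    - by move=> z _; rewrite -leeBlDr// le_max lexx.
  rewrite ge0_integralD//; last 2 first.
  - by move=> z _; rewrite le_max lexx orbT.
  - exact: measurable_funTS (mmax _ mg).
  rewrite leeD2r//; apply: ge0_subset_integral => //; first exact: mmax.
  by move=> z _; rewrite le_max lexx orbT.
have Afn : t%:E * leb d A \is a fin_num.
  by rewrite fin_numM// ge0_fin_numE.
rewrite -(leeD2rE _ _ Afn) fE -BA; exact: le_trans fg gE.
Qed.


Lemma powR_le_min (x y t : R) : (0 <= x)%R -> (0 <= y)%R -> (0 < t < 1)%R ->
  (Num.min x y <= x `^ t * y `^ (1 - t))%R.
Proof.
move=> x0 y0 /andP[t0 t1].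
wlog xy : x y t x0 y0 t0 t1 / (x <= y)%R.
  move=> H; have [xy|yx] := leP x y.
    by rewrite -[leLHS](min_idPl xy); apply: H.
  have := H y x (1 - t)%R y0 x0; rewrite subr_gt0 ltrBlDr ltrDl t0 t1.
  move=> /(_ isT isT (ltW yx)).
  by rewrite (min_idPl (ltW yx)) mulrC opprB addrC subrK.
rewrite (min_idPl xy); move: x0; rewrite le_eqVlt => /predU1P[<-|x0].
  by rewrite mulr_ge0// powR_ge0.
rewrite -[leLHS](powRr1 (ltW x0)).
rewrite -[X in (_ `^ X)%R](subrK t) addrC powRD ?(gt_eqF x0) ?implybT//.
by rewrite ler_wpM2l ?powR_ge0// ge0_ler_powR ?nnegrE ?subr_ge0 ?(ltW t1) ?(ltW x0).
Qed.

(** If the minimum exceeded the right-hand side [H], a finite [r] would lie strictly between. Both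
    integrals on the left exceed [r], so Prekopa-Leindler gives [r = r^t r^(1 - t) <= H]. The finite
    [r] also covers infinite integrals. *)
Lemma quasi_concave_integral_pl (F : V -> V -> R) (x y : V) (t : R) : (0 < t < 1)%R ->
  (forall z, measurable_fun setT (F z)) -> (forall z u, (0 <= F z u)%R) ->
  (forall u v, (F x u `^ t * F y v `^ (1 - t) <=
     F (t *: x + (1 - t) *: y) (t *: u + (1 - t) *: v))%R) ->
  mine (\int[leb d]_u (F x u)%:E) (\int[leb d]_u (F y u)%:E) <=
  \int[leb d]_u (F (t *: x + (1 - t) *: y)%R u)%:E.
Proof.
move=> /[dup] t01 /andP[t0 t1] mF F0 FF.
set H := (X in _ <= X); rewrite leNgt; apply/negP => HF.
have H0 : 0 <= H by apply: integral_ge0 => u _; rewrite lee_fin.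
have [r [r0 Hr rF]] : exists r : R, [/\ (0 < r)%R, H < r%:E &
    r%:E < mine (\int[leb d]_u (F x u)%:E) (\int[leb d]_u (F y u)%:E)].
  case: H H0 HF => [h| |]// h0; last by rewrite ltNge leey.
  move: (mine _ _) => [k| |] //; rewrite ?lee_fin ?lte_fin in h0 * => hk.
    exists ((h + k) / 2)%R; rewrite !lte_fin; split; lra.
  by exists (h + 1)%R; rewrite lte_fin ltry; split => //; lra.
move: rF; rewrite lt_min => /andP[rx ry].
have mF' z : measurable_fun setT (EFin \o F z) by exact/measurable_EFinP.
have := @prekopa_leindler R d t r r (EFin \o F x) (EFin \o F y)
  (EFin \o F (t *: x + (1 - t) *: y)%R) t01 (mF' _) (mF' _) (mF' _).
rewrite -powRD ?(gt_eqF r0) ?implybT// [(t + _)%R]addrC subrK (powRr1 (ltW r0)).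
move=> PL; have : r%:E <= H.
  apply: PL => //; try by move=> z; rewrite /= lee_fin.
  move=> u v p q p0 q0 /=; rewrite !lte_fin lee_fin => pF qF.
  apply: le_trans (FF u v); apply: ler_pM; rewrite ?powR_ge0//.
    by rewrite ge0_ler_powR ?nnegrE ?(ltW p0) ?(ltW t0) ?F0 ?(ltW pF).
  by rewrite ge0_ler_powR ?nnegrE ?(ltW q0) ?subr_ge0 ?(ltW t1) ?F0 ?(ltW qF).
by rewrite leNgt Hr.
Qed.

(** Prekopa-Leindler in the variable of [X]: the integrand [p u * w (z - C u)] is jointly
    log-concave because [z - C u] is linear in the pair. The matrix [C] may be singular, since the
    density used is that of [X] and not of [C X]. *)
Lemma smoothing_quasi_concave (p : V -> R) (C : 'M[R]_d) :
  measurable_fun setT p -> (forall x, (0 <= p x)%R) ->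
  (forall phi : V -> R, measurable_fun setT phi -> (forall x, (0 <= phi x)%R) ->
    \int[m]_x (phi x)%:E = \int[leb d]_x (p x * phi x)%:E) ->
  log_concave_fun p -> log_concave_fun w -> quasi_concave (smoothing w C).
Proof.
move=> mp p0 pm lp lw x y t t01.
have mk z : measurable_fun setT (fun u : V => w (z - C *m u)%R).
  by apply: (measurableT_comp mw); apply: measurable_cVB => //;
    exact: measurable_mulmx_cV.
rewrite /smoothing !pm//.
apply: (@quasi_concave_integral_pl (fun z u => p u * w (z - C *m u))%R
  x y t t01) => //.
- by move=> z; apply: measurable_funM.
- by move=> z u; rewrite mulr_ge0.
move=> u v; rewrite !powRM// mulrACA; apply: ler_pM.
- by rewrite mulr_ge0// powR_ge0.
- by rewrite mulr_ge0// powR_ge0.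
- exact: lp.
have := lw (x - C *m u)%R (y - C *m v)%R t t01; congr (_ <= w _)%R.
by rewrite !scalerBr mulmxDr -!scalemxAr opprD addrACA.
Qed.

End smoothing.

Section coordinate_step.
Context {R : realType} {n : nat}.
Local Notation V := 'cV[R]_n.+1.
Local Notation leb := (@lebesgue_cV R).
Local Open Scope ereal_scope.

Definition first_dilation (a : R) : 'M[R]_n.+1 :=
  diag_mx (\row_j (if j == ord0 then a else 1%R)).

Lemma first_dilationE (a t : R) (v : 'cV[R]_n) :
  first_dilation a *m cV_cons (t, v) = cV_cons (a * t, v)%R.
Proof.
apply/colP => i; rewrite mul_diag_mx !mxE.
by case: unliftP => [j ->|->]/=; rewrite ?mul1r// eqxx.
Qed.

Variable m : probability V R.

Lemma excess_first_dilation (w : V -> R) (C : 'M[R]_n.+1) (a t : R) :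
  measurable_fun setT w -> (forall z, (0 <= w z)%R) ->
  \int[leb n.+1]_z (w z)%:E < +oo ->
  (forall s r y, (`|s| <= `|r|)%R -> (w (cV_cons (r, y)) <= w (cV_cons (s, y)))%R) ->
  quasi_concave (smoothing m w C) -> (0 <= a <= 1)%R -> (0 < t)%R ->
  excess (smoothing m w C) t <= excess (smoothing m w (first_dilation a *m C)) t.
Proof.
move=> mw w0 woo w_radial qF a01 t0.
set F := smoothing m w C; pose A := [set z | t%:E < F z].
have mF : measurable_fun setT F by exact: measurable_smoothing.
have F0 z : 0 <= F z by exact: smoothing_ge0.
have mA : measurable A.
  rewrite -[X in measurable X]setTI.
  exact: (measurable_lte measurableT (f := cst t%:E)).
have Afin : leb n.+1 A < +oo.
  by apply: level_measure_lty => //; rewrite smoothing_mass.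
have Aitv y : is_interval [set s | A (cV_cons (s, y))].
  move=> s r /= As Ar u /andP[su ur].
  move: su; rewrite le_eqVlt => /predU1P[<-//|su].
  move: ur; rewrite le_eqVlt => /predU1P[->//|ur].
  pose tau : R := ((r - u) / (r - s))%R.
  have rs : (0 < r - s)%R by rewrite subr_gt0; exact: lt_trans ur.
  have tau01 : (0 < tau < 1)%R.
    apply/andP; split; first by rewrite divr_gt0// subr_gt0.
    by rewrite /tau ltr_pdivrMr// mul1r ltrD2l ltrN2.
  have := qF (cV_cons (s, y)) (cV_cons (r, y)) tau tau01.
  rewrite -!cV_consZ -cV_consD -scalerDl [(tau + _)%R]addrC subrK scale1r.
  rewrite (_ : tau * s + (1 - tau) * r = u)%R; last first.
    by rewrite /tau; field; rewrite gt_eqF.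
  by apply: lt_le_trans; rewrite lt_min As Ar.
have [B [mB BA AB]] := recentering_set mA Afin Aitv a01.
have mG : measurable_fun setT (smoothing m w (first_dilation a *m C)).
  exact: measurable_smoothing.
have G0 z : 0 <= smoothing m w (first_dilation a *m C) z by exact: smoothing_ge0.
apply: (excess_le_sets (ltW t0) mF mG F0 G0 (erefl A) mB Afin BA).
rewrite /F.
rewrite (integral_smoothing m mw w0 C mA) (integral_smoothing m mw w0 _ mB).
apply: ge0_le_integral; first by [].
- by move=> x _; apply: integral_ge0 => z _; rewrite lee_fin.
- exact: measurable_kernel_integral.
- exact: measurable_kernel_integral.
(* For each value [x] of [X], the dilation sends [C x = (t1, v1)] to [(a t1, v1)], the pair of
   translations compared for [A] and [B]. *)
move=> x _; rewrite -mulmxA -(cV_unconsK (C *m x)); case: (cV_uncons _) => t1 v1.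
by rewrite first_dilationE; apply: AB.
Qed.

End coordinate_step.

(** * Decomposition of contractions *)

Section contraction_decomposition.
Context {R : realType} {n : nat}.
Implicit Types (A M : 'M[R]_n) (u v x y : 'cV[R]_n).

Let form M x y := (x^T *m M *m y) 0 0.

Let formDl M x y z : form M (x + y) z = form M x z + form M y z.
Proof. by rewrite /form linearD/= !mulmxDl mxE. Qed.

Let formDr M x y z : form M x (y + z) = form M x y + form M x z.
Proof. by rewrite /form mulmxDr mxE. Qed.

Let formZl M k x y : form M (k *: x) y = k * form M x y.
Proof. by rewrite /form linearZ/= -!scalemxAl mxE. Qed.

Let formZr M k x y : form M x (k *: y) = k * form M x y.
Proof. by rewrite /form -scalemxAr mxE. Qed.

Let formC M x y : M^T = M -> form M x y = form M y x.
Proof.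
move=> MT; rewrite /form -[in LHS](trmxK (x^T *m M *m y)) mxE.
by rewrite !trmx_mul MT trmxK mulmxA.
Qed.

Let formB (M N : 'M[R]_n) x y : form (M - N) x y = form M x y - form N x y.
Proof. by rewrite /form mulmxBr mulmxBl !mxE. Qed.

Let formZ k M x y : form (k *: M) x y = k * form M x y.
Proof. by rewrite /form -scalemxAr -scalemxAl mxE. Qed.

Let form_rank1 (a b x y : 'cV[R]_n) : form (a *m b^T) x y = (a^T *m x) 0 0 * (b^T *m y) 0 0.
Proof.
rewrite /form mulmxA -mulmxA mxE big_ord1; congr (_ * _).
by rewrite -[x^T *m a]trmxK mxE trmx_mul trmxK.
Qed.

Let psd M := forall x, 0 <= form M x x.

(** The quadratic [t |-> form M (x + t y) (x + t y)] is nonnegative; its minimizer gives the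
    inequality. *)
Lemma psd_cauchy_schwarz M x y : M^T = M -> psd M ->
  form M x y ^+ 2 <= form M x x * form M y y.
Proof.
move=> MT Mp.
have H t : 0 <= form M x x + t * form M x y *+ 2 + t ^+ 2 * form M y y.
  have := Mp (x + t *: y).
  rewrite !formDl !formDr !formZl !formZr (formC y x MT).
  by congr (_ <= _); ring.
have := Mp y; rewrite le_eqVlt => /predU1P[y0|y0].
  rewrite -y0 mulr0; have [->|b0] := eqVneq (form M x y) 0; first by rewrite expr0n.
  (* When the leading coefficient vanishes the quadratic is affine, and this [t] would give it the
     value -1. *)
  have := H (- (form M x x + 1) / (form M x y *+ 2)).
  rewrite -y0 mulr0 addr0 -mulrnAr divfK ?mulrn_eq0//.
  by rewrite opprD addrA subrr add0r oppr_ge0 ler10.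
have := H (- form M x y / form M y y).
rewrite (_ : _ + _ + _ = form M x x - form M x y ^+ 2 / form M y y).
  by rewrite subr_ge0 ler_pdivrMr.
by field; rewrite gt_eqF.
Qed.

(** If the quadratic form vanishes identically, Cauchy-Schwarz on basis vectors makes every entry
    zero. *)
Let psd_neq0 M : M^T = M -> psd M -> M != 0 -> exists x, 0 < form M x x.
Proof.
move=> MT Mp M0; apply: contrapT => /forallNP H.
have q0 x : form M x x = 0.
  apply/eqP; rewrite eq_le Mp andbT leNgt; exact/negP/H.
move/eqP: M0; apply; apply/matrixP => i j; rewrite [RHS]mxE.
have := psd_cauchy_schwarz (delta_mx i 0) (delta_mx j 0) MT Mp.
rewrite !q0 mulr0 => sq.
have : form M (delta_mx i 0) (delta_mx j 0) = 0.
  by apply/eqP; rewrite -sqrf_eq0 eq_le sq sqr_ge0.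
by rewrite /form trmx_delta -rowE -colE !mxE.
Qed.

Let rank_lt (M N K : 'M[R]_n) x : N = K *m M -> N *m x = 0 -> M *m x != 0 ->
  (\rank N < \rank M)%N.
Proof.
move=> NK Nx Mx; have : (N < M)%MS.
  rewrite ltmxE NK submxMl/=; apply/negP => /submxP[L ML].
  by move/eqP: Mx; apply; rewrite ML -NK -mulmxA Nx mulmx0.
by rewrite ltmxErank => /andP[].
Qed.

(** Positive semidefinite exactly for contractions and zero exactly for orthogonal matrices; its
    rank is the induction parameter. *)
Let defect A := 1%:M - A^T *m A.

Let defectT A : (defect A)^T = defect A.
Proof. by rewrite /defect linearB/= trmx_mul trmxK tr_scalar_mx. Qed.

Let form_defect A x : form (defect A) x x = enorm x ^+ 2 - enorm (A *m x) ^+ 2.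
Proof.
rewrite formB !sqr_enorm_mx /form mulmx1; congr (_ - _).
by rewrite trmx_mul !mulmxA.
Qed.

Let contraction_psd A :
  (forall x, enorm (A *m x) <= enorm x) <-> psd (defect A).
Proof.
split=> H x; first by rewrite form_defect subr_ge0 ler_sqr ?nnegrE ?enorm_ge0.
by have := H x; rewrite form_defect subr_ge0 ler_sqr ?nnegrE ?enorm_ge0.
Qed.

Let unit_vector v : v != 0 -> exists k : R, ((k *: v)^T *m (k *: v)) = 1%:M.
Proof.
move=> v0; have ev : enorm v != 0.
  apply: contra_neq v0 => v0; apply/colP => i; rewrite mxE; apply/eqP.
  by rewrite -normr_le0 -v0 le_coord_enorm.
exists (enorm v)^-1; rewrite [LHS]mx11_scalar; congr (_ %:M).
by rewrite -sqr_enorm_mx enormZ normfV (ger0_norm (enorm_ge0 _)) mulVf// expr1n.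
Qed.

Variable P : 'M[R]_n -> Prop.
Hypothesis P_orthogonal : forall O : 'M[R]_n, O^T *m O = 1%:M -> P O.
Hypothesis P_rank1 : forall (u : 'cV[R]_n) (s : R), u^T *m u = 1%:M ->
  0 <= s <= 1 -> P (1%:M - s *: (u *m u^T)).
Hypothesis P_mul : forall A B, P A -> P B -> P (A *m B).

(* Each step splits off a factor 1 - s u u^T that takes as large a multiple of
   u u^T out of 1 - A^T A as positivity allows, which lowers the rank. *)
Lemma contraction_ind A : (forall x, enorm (A *m x) <= enorm x) -> P A.
Proof.
move: {2}(\rank _).+1 (ltnSn (\rank (defect A))) => k.
elim: k A => // k IH A; rewrite ltnS => rk /contraction_psd Ap.
have [M0|M0] := eqVneq (defect A) 0.
  by apply: P_orthogonal; apply/esym/eqP; rewrite -subr_eq0; exact/eqP.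
have step B u s : u^T *m u = 1%:M -> 0 <= s <= 1 ->
    A = B *m (1%:M - s *: (u *m u^T)) -> psd (defect B) ->
    (\rank (defect B) < \rank (defect A))%N -> P A.
  move=> uu s01 AB Bp rB; rewrite AB; apply: P_mul; last exact: P_rank1.
  by apply: IH; [exact: leq_trans rB rk|exact/contraction_psd].
have [Au|Au] := boolP (A \in unitmx); last first.
  have detA : \det A == 0 by move: Au; rewrite unitmxE unitfE negbK.
  have [u [uu Au0]] : exists u, u^T *m u = 1%:M /\ A *m u = 0.
    have : \det A^T == 0 by rewrite det_tr.
    case/det0P => r r0 rA.
    have [|j ju] := @unit_vector r^T; first by rewrite trmx_eq0.
    exists (j *: r^T); split => //.
    by rewrite -scalemxAr -[A]trmxK -trmx_mul rA trmx0 scaler0.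
  have [y [yy Ay0]] : exists y, y^T *m y = 1%:M /\ y^T *m A = 0.
    case/det0P: detA => r r0 rA.
    have [|j ju] := @unit_vector r^T; first by rewrite trmx_eq0.
    exists (j *: r^T); split => //.
    by rewrite linearZ/= trmxK -scalemxAl rA scaler0.
  have Ay0' : A^T *m y = 0 by rewrite -[y]trmxK -trmx_mul Ay0 trmx0.
  have Mu : defect A *m u = u.
    by rewrite /defect mulmxBl mul1mx -mulmxA Au0 mulmx0 subr0.
  have uM : u^T *m defect A = u^T by rewrite -(defectT A) -trmx_mul Mu.
  (* [A] kills the unit vector [u], and [y] is a unit vector orthogonal to the range of [A]. Sending
     [u] to [y] makes [B] isometric on [u], and [A] is recovered as [B] after the full projection
     [1 - u u^T]. Here [u] is an eigenvector of the defect with eigenvalue 1, so subtracting [u u^T]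
     keeps it semidefinite. *)
  pose B := A + y *m u^T.
  have DB : defect B = defect A - u *m u^T.
    have BT : B^T = A^T + u *m y^T.
      by rewrite /B [LHS]linearD/= trmx_mul trmxK.
    rewrite /defect BT /B mulmxDl !mulmxDr.
    rewrite [A^T *m (y *m _)]mulmxA Ay0' mul0mx addr0.
    rewrite -[u *m y^T *m A]mulmxA Ay0 mulmx0 add0r.
    by rewrite mulmxA -(mulmxA u) yy mulmx1 opprD addrA.
  apply: (step B u 1) => //.
  - by rewrite ler01 lexx.
  - rewrite scale1r mulmxBr mulmx1 /B mulmxDl mulmxA Au0 mul0mx add0r.
    by rewrite mulmxA -(mulmxA y) uu mulmx1 addrK.
  - move=> x; rewrite DB formB form_rank1 subr_ge0 -expr2.
    have := psd_cauchy_schwarz u x (defectT A) Ap.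
    by rewrite {1 2}/form uM uu [1%:M _ _]mxE eqxx mul1r.
  apply: (@rank_lt _ _ (1%:M - u *m u^T) u).
  - by rewrite DB mulmxBl mul1mx -mulmxA uM.
  - by rewrite DB mulmxBl Mu -mulmxA uu mulmx1 subrr.
  rewrite Mu; apply/eqP => u0; move: uu; rewrite u0 mulmx0.
  by move=> /matrixP/(_ 0 0); rewrite !mxE eqxx => /eqP; rewrite eq_sym oner_eq0.
have [x qx] := psd_neq0 (defectT A) Ap M0.
set c := form _ x x in qx.
(* Rank-one deflation: subtracting [z z^T / c] from the defect annihilates [x], and Cauchy-Schwarz
   shows that the remainder is still semidefinite. The scalar [b] below rewrites this term with the
   unit vector [u] along [z]. *)
pose z := defect A *m x.
have zE : z^T = x^T *m defect A by rewrite trmx_mul defectT.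
have zx : z^T *m x = c%:M by rewrite zE [LHS]mx11_scalar.
have z0 : z != 0.
  apply: contra_ltN qx => /eqP z0.
  by rewrite /c /form -mulmxA -/z z0 mulmx0 mxE.
have [j] := unit_vector z0; set u := j *: z => uu.
have j0 : j != 0.
  apply: contra_eq_neq uu => /eqP; rewrite /u => /eqP ->; rewrite scale0r mulmx0.
  by apply/eqP => /matrixP/(_ 0 0); rewrite !mxE eqxx => /eqP; rewrite eq_sym oner_eq0.
pose b := (j ^+ 2 * c)^-1.
have b0 : 0 < b by rewrite invr_gt0 mulr_gt0// exprn_even_gt0//= j0.
have zzE : c^-1 *: (z *m z^T) = b *: (u *m u^T).
  rewrite /u linearZ/= -scalemxAl -scalemxAr !scalerA /b; congr (_ *: _).
  by field; rewrite j0 gt_eqF.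
pose N := defect A - b *: (u *m u^T).
have Np : psd N.
  move=> y; rewrite /N -zzE formB subr_ge0.
  rewrite formZ form_rank1 mulrC ler_pdivrMr// -expr2 zE mulrC.
  exact: psd_cauchy_schwarz (defectT A) Ap.
(* Invertibility of [A] enters here: evaluating the remainder at [u] gives [b <= 1 - |A u|^2], and
   [A u] is not zero. *)
have b1 : b < 1.
  have Anz : 0 < enorm (A *m u).
    rewrite lt_neqAle enorm_ge0 andbT; apply/eqP => /esym e0.
    have Au0 : A *m u = 0.
      apply/colP => i; rewrite [RHS]mxE; apply/eqP.
      by rewrite -normr_le0 -e0 le_coord_enorm.
    move: uu; rewrite -[u](mulKmx Au) Au0 mulmx0 mulmx0.
    by move=> /matrixP/(_ 0 0); rewrite !mxE eqxx => /eqP; rewrite eq_sym oner_eq0.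
  have := Np u; rewrite /N formB form_defect sqr_enorm_mx uu [1%:M _ _]mxE eqxx.
  rewrite formZ form_rank1 uu [1%:M _ _]mxE eqxx !mulr1.
  by rewrite -addrA -opprD subr_ge0 => /(lt_le_trans _); apply; rewrite ltrDr exprn_gt0.
pose r := Num.sqrt (1 - b).
have r0 : 0 < r by rewrite sqrtr_gt0 subr_gt0.
have r2 : r ^+ 2 = 1 - b by rewrite sqr_sqrtr// subr_ge0 ltW.
have r1 : r <= 1.
  by rewrite -[leRHS]sqrtr1 ler_wsqrtr// lerBlDr lerDl ltW.
pose U := u *m u^T.
have UU : U *m U = U by rewrite /U mulmxA -(mulmxA u) uu mulmx1.
have UT : U^T = U by rewrite /U trmx_mul trmxK.
(* [F] is the square root of [1 - b u u^T], with eigenvalue [r] along [u], and [E] is its inverse.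
   As [N = F F - A^T A], the matrix [A E] has defect [E N E], whose rank is at most that of [N]. *)
pose E := 1%:M + (r^-1 - 1) *: U.
pose F := 1%:M - (1 - r) *: U.
have ET : E^T = E by rewrite /E linearD/= linearZ/= UT tr_scalar_mx.
have mulU e f : (1%:M + e *: U) *m (1%:M + f *: U) = 1%:M + (e + f + e * f) *: U.
  rewrite mulmxDr mulmx1 mulmxDl mul1mx -!scalemxAr -!scalemxAl UU.
  rewrite scalerA -!addrA -!scalerDl; congr (_ + _ *: _).
  by ring.
have FU : F = 1%:M + (r - 1) *: U by rewrite /F -scaleNr opprB.
have EF : E *m F = 1%:M.
  rewrite FU mulU (_ : _ + _ + _ = 0) ?scale0r ?addr0//.
  by field; rewrite gt_eqF.
have FE : F *m E = 1%:M by exact: mulmx1C.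
have FF : F *m F = 1%:M - b *: U.
  rewrite FU mulU -scaleNr; congr (_ + _ *: _).
  rewrite (_ : _ + _ = r ^+ 2 - 1); last by ring.
  by rewrite r2; ring.
have DE : defect (A *m E) = E *m N *m E.
  have -> : N = F *m F - A^T *m A.
    by rewrite FF /N /defect addrAC.
  rewrite mulmxBr mulmxBl mulmxA EF mul1mx FE /defect; congr (_ - _).
  by rewrite trmx_mul ET !mulmxA.
apply: (step (A *m E) u (1 - r)) => //.
- by rewrite subr_ge0 r1 lerBlDr lerDl ltW.
- by rewrite -mulmxA EF mulmx1.
- move=> y; rewrite DE; have := Np (E *m y); congr (_ <= _).
  by rewrite /form trmx_mul ET !mulmxA.
apply: (@leq_ltn_trans (\rank N)).
  by rewrite DE (leq_trans (mxrankM_maxl _ _))// mxrankM_maxr.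
apply: (@rank_lt _ _ (1%:M - c^-1 *: (z *m x^T)) x).
- rewrite /N -zzE mulmxBl mul1mx -scalemxAl -mulmxA; congr (_ - _ *: _).
  by rewrite zE.
- rewrite /N -zzE mulmxBl -scalemxAl -mulmxA zx mul_mx_scalar.
  by rewrite scalerA mulVf ?gt_eqF// scale1r subrr.
exact: z0.
Qed.

End contraction_decomposition.

(** The Householder reflection exchanging [u] and [e]. Its usual coefficient [2 / |v|^2] is
    [1 / (1 - k)], because [|u - e|^2 = 2 (1 - k)] for unit vectors; [u = e] must be treated
    apart. *)
Lemma unit_vector_rotation (R : realType) n (u : 'cV[R]_n.+1) :
  u^T *m u = 1%:M ->
  exists Q : 'M[R]_n.+1, Q^T *m Q = 1%:M /\ Q *m u = delta_mx ord0 0.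
Proof.
move=> uu; pose e : 'cV[R]_n.+1 := delta_mx ord0 0.
have ee : e^T *m e = 1%:M.
  by rewrite trmx_delta mul_delta_mx; apply/matrixP => i j; rewrite !mxE !ord1.
have [->|ue] := eqVneq u e; first by exists 1%:M; rewrite tr_scalar_mx !mul1mx.
pose v := u - e; pose k := (u^T *m e) 0 0.
have ueE : u^T *m e = k%:M by exact: mx11_scalar.
have euE : e^T *m u = k%:M.
  by rewrite -[e^T *m u]trmxK trmx_mul trmxK ueE tr_scalar_mx.
have vT : v^T = u^T - e^T by rewrite /v [LHS]linearB.
have vu : v^T *m u = (1 - k)%:M by rewrite vT mulmxBl uu euE -raddfB.
have vv : v^T *m v = (2 * (1 - k))%:M.
  rewrite {2}/v mulmxBr vu vT mulmxBl ueE ee -!raddfB/=; congr (_%:M); ring.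
have k1 : 1 - k != 0.
  apply: contra_neq ue => k0; have : enorm v ^+ 2 = 0.
    by rewrite sqr_enorm_mx vv k0 mulr0 mxE mul0rn.
  move=> /eqP; rewrite sqrf_eq0 => /eqP v0.
  apply/eqP; rewrite -subr_eq0 -/v; apply/eqP/colP => i; rewrite [RHS]mxE; apply/eqP.
  by rewrite -normr_le0 -v0 le_coord_enorm.
exists (1%:M - (1 - k)^-1 *: (v *m v^T)); split.
  have -> : (1%:M - (1 - k)^-1 *: (v *m v^T))^T = 1%:M - (1 - k)^-1 *: (v *m v^T).
    by rewrite [LHS]linearB/= tr_scalar_mx linearZ/= trmx_mul trmxK.
  set H := (1 - k)^-1 *: (v *m v^T); have HH : H *m H = H + H.
    rewrite /H -scalemxAl -scalemxAr mulmxA -(mulmxA v) vv mul_mx_scalar.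
    by rewrite -scalemxAl !scalerA -scalerDl; congr (_ *: _); field.
  by rewrite [LHS]mulmxBl mul1mx mulmxBr mulmx1 HH opprB addrK subrK.
rewrite mulmxBl mul1mx -scalemxAl -mulmxA vu mul_mx_scalar scalerA mulVf//.
by rewrite scale1r /v opprB addrC subrK.
Qed.

(** * The excess inequality for contractions *)

Section almost_everywhere.
Context {R : realType} {d : nat}.
Local Notation V := 'cV[R]_d.
Local Notation leb := (@lebesgue_cV R).
Local Open Scope ereal_scope.

Lemma ge0_integral_orthogonal (O : 'M[R]_d) (f : V -> \bar R) :
  O^T *m O = 1%:M -> measurable_fun setT f -> (forall x, 0 <= f x) ->
  \int[leb d]_x f (O *m x)%R = \int[leb d]_x f x.
Proof.
move=> OO mf f0.
have mO : measurable_fun setT (mulmx O : V -> V) by exact: measurable_mulmx_cV.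
transitivity (\int[pushforward (leb d) (mulmx O : V -> V)]_x f x).
  by rewrite ge0_integral_pushforward.
by apply: eq_measure_integral => A mA _; exact: lebesgue_cV_orthogonal.
Qed.

Lemma measurable_excess_integrand (f : V -> \bar R) (t : R) :
  measurable_fun setT f ->
  measurable_fun setT (fun z => maxe (f z - t%:E) 0).
Proof. by move=> mf; apply: measurable_maxe => //; exact: emeasurable_funB. Qed.

Lemma excess_orthogonal (O : 'M[R]_d) (f : V -> \bar R) (t : R) :
  O^T *m O = 1%:M -> measurable_fun setT f ->
  excess (fun z => f (O *m z)%R) t = excess f t.
Proof.
move=> OO mf.
apply: (ge0_integral_orthogonal OO (measurable_excess_integrand t mf)) => x.
by rewrite le_max lexx orbT.
Qed.

Lemma excess_ae (f g : V -> \bar R) (t : R) :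
  measurable_fun setT f -> measurable_fun setT g ->
  {ae leb d, forall z, f z = g z} -> excess f t = excess g t.
Proof.
move=> mf mg fg; apply: ae_eq_integral => //; try exact: measurable_excess_integrand.
by apply: filterS fg => z -> _.
Qed.

Variable m : probability V R.

(** The smoothed indicator of the null set [w != w'] has total mass zero. So for almost every [z]
    the weights agree at [z - C x] for almost every [x], whatever [m] and [C] are. *)
Lemma smoothing_ae (w w' : V -> R) (C : 'M[R]_d) :
  measurable_fun setT w -> measurable_fun setT w' ->
  {ae leb d, forall z, w z = w' z} ->
  {ae leb d, forall z, smoothing m w C z = smoothing m w' C z}.
Proof.
move=> mw mw' ww'.
pose N := [set z | w z != w' z].
have mN : measurable N.
  rewrite -[X in measurable X]setTI (_ : N = [set x | (w x)%:E != (w' x)%:E]).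
    by apply: (measurable_neqe measurableT); exact/measurable_EFinP.
  by apply/seteqP; split => z /=; rewrite eqe.
have N0 : leb d N = 0.
  case: ww' => M [mM M0 wM]; apply/eqP; rewrite eq_le measure_ge0 andbT -M0.
  by apply: le_measure; rewrite ?inE// => z /eqP /= wz; apply: wM.
have m1 : measurable_fun setT (\1_N : V -> R) by exact: measurable_indic.
have ind0 (z : V) : (0 <= (\1_N z : R))%R by [].
have sN : \int[leb d]_z `|smoothing m (\1_N) C z| = 0.
  under eq_integral do rewrite gee0_abs ?smoothing_ge0//.
  by rewrite smoothing_mass// integral_indic// setIT.
have /(ae_eq_integral_abs _ measurableT (measurable_smoothing m m1 ind0 C)) H := sN.
apply: filterS H => z /(_ I) /= zN.
have mk (k : V -> R) : measurable_fun setT k ->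
    measurable_fun setT (fun x : V => (k (z - C *m x)%R)%:E : \bar R).
  move=> mk; apply/measurable_EFinP; apply: (measurableT_comp mk).
  by apply: measurable_cVB => //; exact: measurable_mulmx_cV.
have : \int[m]_x `|(\1_N (z - C *m x)%R)%:E : \bar R| = 0.
  by under eq_integral do rewrite gee0_abs ?lee_fin//.
move=> /(ae_eq_integral_abs _ measurableT (mk _ m1)) H.
apply: ae_eq_integral => //; try exact: mk.
apply: filterS H => x /(_ I) /= [] xN _; congr EFin; apply/eqP.
by apply: contra_eqT xN => wn; rewrite indicE mem_set// oner_eq0.
Qed.

End almost_everywhere.

Lemma rank1_conjugate (R : realType) n (u : 'cV[R]_n.+1) (Q : 'M[R]_n.+1)
    (s : R) : Q^T *m Q = 1%:M -> Q *m u = delta_mx ord0 0 ->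
  1%:M - s *: (u *m u^T) = Q^T *m (first_dilation (1 - s) *m Q).
Proof.
move=> QQ Qu; have uQ : u = Q^T *m delta_mx ord0 0.
  by rewrite -Qu mulmxA QQ mul1mx.
have -> : first_dilation (1 - s) =
    1%:M - s *: (delta_mx ord0 ord0 : 'M[R]_n.+1).
  apply/matrixP => i j; rewrite !mxE.
  have [<-|ij] := eqVneq i j; rewrite ?andbb ?mulr1n ?mulr0n.
    by case: eqP => _; rewrite ?mulr1// mulr0 subr0.
  case: eqP => [i0|_]; rewrite ?andFb ?mulr0 ?subr0//=.
  by case: eqP => [j0|_]; rewrite ?mulr0 ?subr0//; move: ij; rewrite i0 j0 eqxx.
rewrite mulmxBl mul1mx mulmxBr QQ -scalemxAl -scalemxAr uQ trmx_mul trmxK.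
congr (_ - _ *: _); rewrite trmx_delta !mulmxA -(mulmxA _ (delta_mx _ _)).
by rewrite mul_delta_mx.
Qed.

(** A symmetrization that respects log-concavity: a minimum of log-concave functions is log-concave,
    whereas an average need not be. *)
Lemma log_concave_fun_min_linear (R : realType) d (w : 'cV[R]_d -> R)
    (S : 'M[R]_d) : (forall z, 0 <= w z) -> log_concave_fun w ->
  log_concave_fun (fun z => Num.min (w z) (w (S *m z))).
Proof.
move=> w0 w_lc x y t t01; have /andP[t0 t1] := t01; rewrite le_min.
have mono (a b a' b' : R) : 0 <= a <= a' -> 0 <= b <= b' ->
    a `^ t * b `^ (1 - t) <= a' `^ t * b' `^ (1 - t).
  move=> /andP[a0 aa] /andP[b0 bb]; apply: ler_pM; rewrite ?powR_ge0//.
    by rewrite ge0_ler_powR ?nnegrE ?(ltW t0) ?a0 ?(le_trans a0 aa).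
  by rewrite ge0_ler_powR ?nnegrE ?subr_ge0 ?(ltW t1) ?b0 ?(le_trans b0 bb).
apply/andP; split.
  apply: le_trans (w_lc _ _ _ t01); apply: mono.
    by rewrite le_min !w0 ge_min lexx.
  by rewrite le_min !w0 ge_min lexx.
rewrite mulmxDr -!scalemxAr; apply: le_trans (w_lc _ _ _ t01); apply: mono.
  by rewrite le_min !w0 ge_min lexx orbT.
by rewrite le_min !w0 ge_min lexx orbT.
Qed.

Section linear_contraction.
Context {R : realType}.
Local Notation leb := (@lebesgue_cV R).
Local Open Scope ereal_scope.

(** The exceptional null set may depend on [O]. This is what survives when a radial density is
    replaced by a log-concave version of it. *)
Definition ae_rotation_invariant d (w : 'cV[R]_d -> R) :=
  forall O : 'M[R]_d, O^T *m O = 1%:M ->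
    {ae leb d, forall z, w (O *m z) = w z}.

Section fixed_weight.
Context {d : nat}.
Local Notation V := 'cV[R]_d.
Variable m : probability V R.
Variable w : V -> R.
Hypothesis mw : measurable_fun setT w.
Hypothesis w0 : forall z, (0 <= w z)%R.
Hypothesis w_rot : ae_rotation_invariant w.

(** Write [z - O C x = O (O^T z - C x)]: the inner [O] disappears by invariance of [w], the outer
    [O^T] by invariance of Lebesgue measure. *)
Lemma excess_smoothing_orthogonal (O C : 'M[R]_d) (t : R) : O^T *m O = 1%:M ->
  excess (smoothing m w (O *m C)) t = excess (smoothing m w C) t.
Proof.
move=> OO; have OO' : O *m O^T = 1%:M by exact: mulmx1C.
pose w' z := w (O *m z).
have mw' : measurable_fun setT w'.
  by apply: (measurableT_comp mw); exact: measurable_mulmx_cV.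
have w'0 z : (0 <= w' z)%R by exact: w0.
have -> : smoothing m w (O *m C) = fun z => smoothing m w' C (O^T *m z).
  apply/funext => z; apply: eq_integral => x _; rewrite /w' mulmxBr !mulmxA.
  by rewrite OO' mul1mx.
have OOT : (O^T)^T *m O^T = 1%:M by rewrite trmxK.
rewrite (excess_orthogonal t OOT (measurable_smoothing m mw' w'0 C)).
apply: excess_ae; try exact: measurable_smoothing.
by apply: smoothing_ae => //; exact: w_rot.
Qed.

End fixed_weight.

Section reflection_symmetrization.
Context {n : nat}.
Local Notation V := 'cV[R]_n.+1.
Variable m : probability V R.
Variable w : V -> R.
Hypothesis mw : measurable_fun setT w.
Hypothesis w0 : forall z, (0 <= w z)%R.
Hypothesis woo : \int[leb n.+1]_z (w z)%:E < +oo.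
Hypothesis w_lc : log_concave_fun w.
Hypothesis w_rot : ae_rotation_invariant w.

Let S : 'M[R]_n.+1 := first_dilation (-1).

Let SS : S^T *m S = 1%:M.
Proof.
rewrite /S /first_dilation tr_diag_mx mulmx_diag -diag_const_mx; congr diag_mx.
by apply/rowP => i; rewrite !mxE; case: ifP; rewrite ?mulN1r ?opprK ?mulr1.
Qed.

(* The weight is rotation invariant only almost everywhere; its minimum with its
   reflection is everywhere even in the first coordinate and still log-concave. *)
Let v (z : V) := Num.min (w z) (w (S *m z)).

Let mv : measurable_fun setT v.
Proof.
apply: measurable_minr => //.
by apply: (measurableT_comp mw); exact: measurable_mulmx_cV.
Qed.

Let v0 z : (0 <= v z)%R. Proof. by rewrite le_min !w0. Qed.

Let v_ae : {ae leb n.+1, forall z, w z = v z}.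
Proof.
have := w_rot SS; apply: filterS => z wz.
by rewrite /v wz minxx.
Qed.

Let v_lc : log_concave_fun v.
Proof. exact: log_concave_fun_min_linear. Qed.

Let v_even t y : v (cV_cons (- t, y)%R) = v (cV_cons (t, y)).
Proof. by rewrite /v !first_dilationE !mulN1r opprK minC. Qed.

(** On a line in the first direction, [s] is a convex combination of [|r|] and [-|r|], where the
    even function [v] takes the same value. *)
Let v_radial s r y :
  (`|s| <= `|r|)%R -> (v (cV_cons (r, y)) <= v (cV_cons (s, y)))%R.
Proof.
have vabs t : v (cV_cons (t, y)) = v (cV_cons (`|t|%R, y)).
  have [t0|t0] := leP 0%R t; first by rewrite ger0_norm.
  by rewrite ltr0_norm// v_even.
rewrite le_eqVlt => /predU1P[sr|sr]; first by rewrite vabs [leRHS]vabs sr.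
have r0 : (0 < `|r|)%R by apply: le_lt_trans sr.
rewrite (vabs r); set a := `|r|%R in sr r0 *.
pose tau : R := ((s + a) / (2 * a))%R.
have /andP[sa1 sa2] : (- a < s < a)%R by rewrite -ltr_norml.
have tau01 : (0 < tau < 1)%R.
  apply/andP; split; first by rewrite divr_gt0 ?mulr_gt0//; lra.
  by rewrite /tau ltr_pdivrMr ?mulr_gt0//; lra.
have := v_lc (cV_cons (a, y)) (cV_cons (- a, y)%R) tau01.
rewrite v_even -!cV_consZ -cV_consD -scalerDl [(tau + _)%R]addrC subrK scale1r.
rewrite (_ : tau * a + (1 - tau) * - a = s)%R; last first.
  by rewrite /tau; field; rewrite gt_eqF.
apply: le_trans; apply: le_trans (powR_le_min _ _ tau01) => //.
by rewrite minxx.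
Qed.

Variable p : V -> R.
Hypothesis mp : measurable_fun setT p.
Hypothesis p0 : forall z, (0 <= p z)%R.
Hypothesis p_lc : log_concave_fun p.
Hypothesis p_density : forall phi : V -> R, measurable_fun setT phi ->
  (forall x, (0 <= phi x)%R) ->
  \int[m]_x (phi x)%:E = \int[leb n.+1]_x (p x * phi x)%:E.

Lemma excess_smoothing_first_dilation (C : 'M[R]_n.+1) (a t : R) :
  (0 <= a <= 1)%R -> (0 < t)%R ->
  excess (smoothing m w C) t <= excess (smoothing m w (first_dilation a *m C)) t.
Proof.
move=> a01 t0.
have vE B : excess (smoothing m w B) t = excess (smoothing m v B) t.
  apply: excess_ae; [exact: measurable_smoothing|exact: measurable_smoothing|].
  exact: smoothing_ae.
rewrite !vE; apply: excess_first_dilation => //.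
  rewrite (_ : \int[_]_z (v z)%:E = \int[leb n.+1]_z (w z)%:E)//.
  apply: ae_eq_integral => //; try exact/measurable_EFinP.
  by apply: filterS v_ae => z ->.
exact: (@smoothing_quasi_concave R n.+1 m v mv v0 p C mp p0 p_density p_lc v_lc).
Qed.

Lemma excess_smoothing_rank1 (C : 'M[R]_n.+1) (u : V) (s t : R) :
  u^T *m u = 1%:M -> (0 <= s <= 1)%R -> (0 < t)%R ->
  excess (smoothing m w C) t <=
  excess (smoothing m w ((1%:M - s *: (u *m u^T)) *m C)) t.
Proof.
move=> uu /andP[s0 s1] t0; have [Q [QQ Qu]] := unit_vector_rotation uu.
have QQ' : (Q^T)^T *m Q^T = 1%:M by rewrite trmxK; exact: mulmx1C.
rewrite (rank1_conjugate s QQ Qu) -!mulmxA.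
have E1 := excess_smoothing_orthogonal m mw w0 w_rot C t QQ.
have E2 := excess_smoothing_orthogonal m mw w0 w_rot
  (first_dilation (1 - s) *m (Q *m C)) t QQ'.
have a01 : (0 <= 1 - s <= 1)%R by rewrite subr_ge0 s1 gerBl.
have E3 := excess_smoothing_first_dilation (Q *m C) a01 t0.
have K (a b c e : \bar R) : b = a -> e = c -> b <= c -> a <= e by move=> -> ->.
exact: K E1 E2 E3.
Qed.

End reflection_symmetrization.

Lemma excess_smoothing_contraction d (m : probability 'cV[R]_d R)
    (w p : 'cV[R]_d -> R) (A C : 'M[R]_d) (t : R) :
  measurable_fun setT w -> (forall z, (0 <= w z)%R) ->
  \int[leb d]_z (w z)%:E < +oo -> log_concave_fun w -> ae_rotation_invariant w ->
  measurable_fun setT p -> (forall z, (0 <= p z)%R) -> log_concave_fun p ->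
  (forall phi : 'cV[R]_d -> R, measurable_fun setT phi ->
    (forall x, (0 <= phi x)%R) ->
    \int[m]_x (phi x)%:E = \int[leb d]_x (p x * phi x)%:E) ->
  (forall x, (enorm (A *m x) <= enorm x)%R) -> (0 < t)%R ->
  excess (smoothing m w C) t <= excess (smoothing m w (A *m C)) t.
Proof.
move=> mw w0 woo w_lc w_rot mp p0 p_lc p_density Acontr t0.
(* Quantifying over [C] inside the property makes it multiplicative: the second factor is applied to
   [C], the first to the product. The case [d = 0] is separate because there is no first
   coordinate. *)
move: C; apply: (contraction_ind (P := fun A => forall C,
  excess (smoothing m w C) t <= excess (smoothing m w (A *m C)) t) _ _ _ Acontr).
- by move=> O OO C; rewrite excess_smoothing_orthogonal.
- case: d m w p A mw w0 woo w_lc w_rot mp p0 p_lc p_density Acontr => [|n] m w p A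
    mw w0 woo w_lc w_rot mp p0 p_lc p_density _ u s uu s01 C.
    by rewrite (_ : _ *m C = C)//; apply/matrixP => -[].
  exact: excess_smoothing_rank1 p_density _ _ _ _ _ _ _.
- by move=> A' B HA HB C; rewrite -mulmxA; apply: le_trans (HB C) (HA _).
Qed.

End linear_contraction.

(** * Densities *)

Section weighted_layer_cake.
Context d (T : measurableType d) (R : realType).
Variable m : {sigma_finite_measure set T -> \bar R}.
Local Notation mu := (@lebesgue_measure R).
Local Open Scope ereal_scope.

(** Tonelli under the graph of [phi] with the product weight [p x * k s]. With [k = 1] it passes
    from a law to its density; with [p = 1] and [k = F'] it integrates [F] composed with [phi]. *)
Lemma weighted_layer_cake (phi : T -> \bar R) (p : T -> R) (k : R -> R) :
  measurable_fun setT phi -> measurable_fun setT p -> measurable_fun setT k ->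
  (forall x, (0 <= p x)%R) -> (forall s, (0 <= k s)%R) ->
  \int[m]_x ((p x)%:E *
    \int[mu]_(s in `]0%R, +oo[%classic `&` [set s : R | s%:E < phi x]) (k s)%:E) =
  \int[mu]_(s in `]0%R, +oo[) ((k s)%:E *
    \int[m]_(x in [set x | s%:E < phi x]) (p x)%:E).
Proof.
move=> mphi mp mk p0 k0.
pose D := `]0%R, +oo[%classic : set R.
have mD : measurable D by exact: measurable_itv.
pose S := [set q : T * R | q.2%:E < phi q.1] `&` (setT `*` D).
have mS : measurable S.
  by apply: measurableI; [exact: measurable_subgraph|exact: measurableX].
pose g (q : T * R) : \bar R := (\1_S q * (p q.1 * k q.2))%:E.
have mg : measurable_fun setT g.
  apply: measurable_indicM => //; apply: measurable_funM.
    by apply: measurableT_comp.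
  by apply: measurableT_comp.
have g0 q : 0 <= g q by rewrite lee_fin !mulr_ge0.
have mk' : measurable_fun setT (EFin \o k) by exact/measurable_EFinP.
have mp' : measurable_fun setT (EFin \o p) by exact/measurable_EFinP.
transitivity (\int[m]_x \int[mu]_s g (x, s)).
  apply: eq_integral => x _.
  have mSx : measurable (D `&` [set s : R | s%:E < phi x]).
    apply: measurableI => //; rewrite -[X in measurable X]setTI.
    by apply: (measurable_lte measurableT) => //; exact/measurable_EFinP.
  rewrite (integral_indicM mu) -ge0_integralZl ?lee_fin//; last 2 first.
  - exact: measurable_indicM.
  - by move=> s _; rewrite lee_fin mulr_ge0.
  apply: eq_integral => s _; rewrite /g/= -EFinM; congr EFin.
  rewrite mulrCA; congr (_ * _)%R; rewrite !indicE; congr (nat_of_bool _)%:R.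
  by apply/idP/idP; rewrite !inE /S/= => -[]; [|move=> ? []].
transitivity (\int[mu]_s \int[m]_x g (x, s)).
  exact: (@fubini_tonelli _ _ _ (measurableTypeR R) _ m (@lebesgue_measure R) g mg).
rewrite [RHS]integral_mkcond; apply: eq_integral => s _.
have mSs : measurable [set x | s%:E < phi x].
  rewrite -[X in measurable X]setTI.
  by apply: (measurable_lte measurableT (f := cst s%:E)).
rewrite patchE; have [s0|s0] := ltP 0%R (s : R).
  rewrite mem_set/= ?in_itv/= ?s0// [X in _ = _ * X]integral_indicM -ge0_integralZl ?lee_fin//; last 2 first.
  - exact: measurable_indicM.
  - by move=> x _; rewrite lee_fin mulr_ge0.
  apply: eq_integral => x _; rewrite /g/= -EFinM; congr EFin.
  rewrite [RHS]mulrC -mulrA; congr (_ * _)%R; rewrite !indicE; congr (nat_of_bool _)%:R.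
  apply/idP/idP; rewrite !inE /S/=; first by move=> [].
  by move=> ?; do !split => //=; rewrite /D/= in_itv/= s0.
rewrite memNset/= ?in_itv/= ?andbT ?ltNge ?s0//.
apply: integral0_eq => x _; rewrite /g indicE memNset//= ?mul0r// => -[_ [_]].
by rewrite /D/= in_itv/= andbT ltNge s0.
Qed.

End weighted_layer_cake.

Section densities.
Context {R : realType} {d : nat}.
Local Notation V := 'cV[R]_d.
Local Notation leb := (@lebesgue_cV R).
Local Notation mu := (@lebesgue_measure R).
Local Open Scope ereal_scope.

Lemma integral_density (m : probability V R) (p : V -> R) :
  measurable_fun setT p -> (forall x, (0 <= p x)%R) ->
  (forall A, measurable A -> m A = \int[leb d]_(x in A) (p x)%:E) ->
  forall phi : V -> R, measurable_fun setT phi -> (forall x, (0 <= phi x)%R) ->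
    \int[m]_x (phi x)%:E = \int[leb d]_x (p x * phi x)%:E.
Proof.
move=> mp p0 pm phi mphi phi0.
have mphi' : measurable_fun setT (EFin \o phi) by exact/measurable_EFinP.
rewrite layer_cake//.
have := weighted_layer_cake (leb d) mphi' mp (@measurable_cst _ _ _ _ setT (1%R : R))
  p0 (fun=> ler01).
rewrite [X in X = _ -> _](_ : _ = \int[leb d]_x (p x * phi x)%:E); last first.
  apply: eq_integral => x _; rewrite EFinM; congr (_ * _).
  rewrite integral_one; first by apply: lebesgue_measure_below; rewrite lee_fin.
  apply: measurableI => //; rewrite -[X in measurable X]setTI.
  by apply: (measurable_lte measurableT) => //; exact/measurable_EFinP.
move=> ->; apply: eq_integral => s _; rewrite mul1e; apply: pm.
rewrite -[X in measurable X]setTI.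
exact: (measurable_lte measurableT (f := cst s%:E)).
Qed.

Lemma density_unique (f g : V -> R) :
  measurable_fun setT f -> measurable_fun setT g ->
  (forall x, (0 <= f x)%R) -> (forall x, (0 <= g x)%R) ->
  \int[leb d]_x (f x)%:E < +oo ->
  (forall A, measurable A ->
    \int[leb d]_(x in A) (f x)%:E = \int[leb d]_(x in A) (g x)%:E) ->
  {ae leb d, forall x, f x = g x}.
Proof.
move=> mf mg f0 g0 foo fg.
have : ae_eq (leb d) setT (EFin \o f) (EFin \o g).
  apply: integral_ae_eq => //.
  - apply/integrableP; split; first exact/measurable_EFinP.
    by under eq_integral do rewrite gee0_abs ?lee_fin//.
  - exact/measurable_EFinP.
  - by move=> E _ mE; exact: fg.
by apply: filterS => x /(_ I) [].
Qed.

Lemma ae_orthogonal (O : 'M[R]_d) (Q : V -> Prop) : O^T *m O = 1%:M ->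
  {ae leb d, forall x, Q x} -> {ae leb d, forall x, Q (O *m x)}.
Proof.
move=> OO [N [mN N0 QN]]; exists [set x | N (O *m x)]; split.
- rewrite -[X in measurable X]setTI.
  exact: (measurable_mulmx_cV O (@measurable_id _ _ setT)).
- by rewrite lebesgue_cV_orthogonal.
- by move=> x /= Qx; exact: QN.
Qed.

Lemma expeR_log_concave (f : V -> R) (phi : V -> \bar R) :
  (forall x, phi x != -oo) -> convex_efun phi ->
  (forall x, (f x)%:E = expeR (- phi x)) -> log_concave_fun f.
Proof.
move=> phiN cphi fE x y t t01; have /andP[t0 t1] := t01.
have f0 z : (0 <= f z)%R by rewrite -lee_fin fE expeR_ge0.
have fx0 z : phi z = +oo -> f z = 0%R.
  by move=> pz; apply: EFin_inj; rewrite fE pz.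
have fr z r : phi z = r%:E -> f z = expR (- r).
  by move=> pz; apply: EFin_inj; rewrite fE pz.
have := cphi x y t; rewrite (ltW t0) (ltW t1) => /(_ isT).
have := phiN x; case px : (phi x) => [a| |]// _; last first.
  by rewrite (fx0 x px) powR0 ?gt_eqF// mul0r.
have := phiN y; case py : (phi y) => [b| |]// _; last first.
  by rewrite (fx0 y py) powR0 ?subr_eq0 ?gt_eqF// mulr0.
rewrite (fr x a px) (fr y b py) -!expRM -expRD.
case pz : (phi _) => [c| |] //=; last by have := phiN (t *: x + (1 - t) *: y)%R; rewrite pz.
rewrite -!EFinM -EFinD lee_fin => cab; rewrite (fr _ c pz) ler_expR.
by move: cab; lra.
Qed.

End densities.

(** * The density of an affine image of [X] plus [W] *)

Section sum_density.
Context {R : realType} {d : nat}.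
Local Notation V := 'cV[R]_d.
Local Notation leb := (@lebesgue_cV R).
Local Open Scope ereal_scope.

(** Minimum with the reflection through 0. An even log-concave function is largest at 0, the
    midpoint of [z] and [-z]; the resulting bound keeps smoothed densities finite and later controls
    the entropy at [alpha = 1]. *)
Lemma log_concave_even_version (w : V -> R) :
  measurable_fun setT w -> (forall z, (0 <= w z)%R) -> log_concave_fun w ->
  ae_rotation_invariant w ->
  exists v : V -> R, [/\ measurable_fun setT v, (forall z, (0 <= v z)%R),
    log_concave_fun v, {ae leb d, forall z, w z = v z} &
    (forall z, (v z <= v 0)%R)].
Proof.
move=> mw w0 w_lc w_rot; pose N : 'M[R]_d := (-1)%:M.
have NN : N^T *m N = 1%:M.
  by rewrite /N tr_scalar_mx -scalar_mxM mulN1r opprK.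
have Nz z : N *m z = (- z)%R by rewrite mul_scalar_mx scaleN1r.
pose v z := Num.min (w z) (w (N *m z)).
have v_lc : log_concave_fun v by exact: log_concave_fun_min_linear.
have v0 z : (0 <= v z)%R by rewrite le_min !w0.
exists v; split => //.
- apply: measurable_minr => //.
  by apply: (measurableT_comp mw); exact: measurable_mulmx_cV.
- by apply: filterS (w_rot _ NN) => z; rewrite /v => ->; rewrite minxx.
move=> z.
pose h : R := (2^-1)%R.
have h01 : (0 < h < 1)%R by apply/andP; split; rewrite /h; lra.
have := v_lc z (- z)%R _ h01.
have -> : v (- z)%R = v z by rewrite /v !Nz opprK minC.
rewrite scalerN -scalerBl (_ : h - (1 - h) = 0)%R ?scale0r; last by rewrite /h; lra.
apply: le_trans; apply: le_trans (powR_le_min _ _ h01) => //.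
by rewrite minxx.
Qed.

Context {disp : measure_display} {Omega : measurableType disp}.
Variable P : probability Omega R.
Variables X W : {RV P >-> V}.
Hypothesis XW_indep : independent_vectors P X W.

Lemma joint_law (S : set (V * V)) : measurable S ->
  P [set omega | S (X omega, W omega)] =
  \int[distribution P X]_x distribution P W (xsection S x).
Proof.
move=> mS.
have mXW : measurable_fun setT (fun omega => (X omega, W omega)).
  by apply: measurable_fun_pair.
pose J := measure_function_pushforward__canonical__measure_function_Measure P mXW.
have := @product_measure_unique _ _ _ _ R (distribution P X) (distribution P W) J.
move=> H; have JE : forall A B : set V, measurable A -> measurable B ->
    J (A `*` B) = distribution P X A * distribution P W B.
  by move=> A B mA mB; exact: XW_indep.
exact/esym/(H JE S mS).
Qed.

(** The bound [M] makes the smoothed function finite at every point, so that [fine] loses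
    nothing. *)
Lemma affine_sum_density (A : 'M[R]_d) (b : V) (w : V -> R) (M : R) :
  measurable_fun setT w -> (forall z, (0 <= w z)%R) -> (forall z, (w z <= M)%R) ->
  (forall E, measurable E -> pushforward P W E = \int[leb d]_(x in E) (w x)%:E) ->
  is_density P (fun omega => (A *m X omega + b) + W omega)%R
    (fun z => fine (smoothing (distribution P X) w A (z - b)%R)).
Proof.
move=> mw w0 wM Ww.
set F := smoothing _ _ _.
have mF : measurable_fun setT F by exact: measurable_smoothing.
have F0 z : 0 <= F z by exact: smoothing_ge0.
have Ffin z : F z \is a fin_num.
  rewrite ge0_fin_numE//; apply: le_lt_trans (ltry M).
  exact: smoothing_le.
have mFb : measurable_fun setT (fun z : V => F (z - b)%R).
  by apply: (measurableT_comp mF); exact: measurable_cVB.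
split.
- by apply/measurable_EFinP; rewrite (_ : _ \o _ = fun z => F (z - b)%R)//;
    apply/funext => z /=; rewrite fineK.
- by move=> z; rewrite fine_ge0.
move=> E mE.
have mS : measurable [set q : V * V | E (A *m q.1 + b + q.2)%R].
  rewrite -[X in measurable X]setTI.
  have : measurable_fun setT (fun q : V * V => A *m q.1 + b + q.2)%R.
    apply: measurable_cVD => //; apply: measurable_cVD => //.
    exact: measurable_mulmx_cV.
  by move=> /(_ measurableT E mE).
rewrite /pushforward [LHS](joint_law mS).
under [RHS]eq_integral do rewrite fineK//.
have mE' : measurable [set z | E (z + b)%R].
  rewrite -[X in measurable X]setTI.
  by apply: (measurable_cVD (f := id) (g := cst b)).
transitivity (\int[leb d]_(z in [set z | E (z + b)%R]) F z).
  rewrite /F integral_smoothing//; apply: eq_integral => x _.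
  have mSx : measurable [set y | E (A *m x + b + y)%R].
    rewrite -[X in measurable X]setTI.
    by apply: (measurable_cVD (f := cst (A *m x + b)%R) (g := id)).
  rewrite (_ : xsection _ x = [set y | E (A *m x + b + y)%R]); last first.
    by apply/seteqP; split => y; rewrite /xsection/= inE.
  rewrite [LHS](Ww _ mSx) [LHS]integral_indicM [RHS]integral_indicM.
  rewrite -[LHS](ge0_integral_cV_shift (- (A *m x))%R); first last.
  - by move=> z; rewrite lee_fin mulr_ge0.
  - exact: measurable_indicM.
  apply: eq_integral => z _; congr ((_ * _)%:E); rewrite !indicE.
  congr ((nat_of_bool _)%:R); apply/idP/idP; rewrite !inE/=;
    by rewrite [(z - _)%R]addrC addrA [(A *m x + b)%R]addrC addrK addrC.
rewrite [LHS]integral_mkcond [RHS]integral_mkcond -[LHS](ge0_integral_cV_shift (- b)%R); first last.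
- by move=> z; apply: erestrict_ge0.
- by apply/(measurable_restrictT F mE'); exact: measurable_funTS.
apply: eq_integral => z _; rewrite !patchE; congr (if _ then _ else _).
by apply/idP/idP; rewrite !inE/= subrK.
Qed.

End sum_density.

(** * Comparison of tails *)

Lemma measurable_level_measure d (T : measurableType d) (R : realType)
    (m : {sigma_finite_measure set T -> \bar R}) (k : T -> \bar R) :
  measurable_fun setT k ->
  measurable_fun setT (fun u : R => m [set x | (u%:E < k x)%E]).
Proof.
move=> mk.
have mS : measurable [set z : R * T | (z.1%:E < k z.2)%E].
  rewrite -[X in measurable X]setTI.
  apply: (measurable_lte measurableT (f := fun z : R * T => z.1%:E)
     (g := k \o snd)).
    by apply/measurable_EFinP.
  by apply: measurableT_comp => //; exact: measurable_snd.
have := measurable_fun_xsection m mS.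
apply: eq_measurable_fun => u _ /=; congr (m _).
by apply/seteqP; split => x; rewrite /xsection/= inE.
Qed.

Section tail_comparison.
Context {R : realType}.
Local Notation mu := (@lebesgue_measure R).
Local Notation D := (`]0%R, +oo[%classic : set R).
Local Open Scope ereal_scope.

Variables F G : R -> \bar R.
Hypothesis mF : measurable_fun setT F.
Hypothesis mG : measurable_fun setT G.
Hypothesis F0 : forall s, 0 <= F s.
Hypothesis G0 : forall s, 0 <= G s.
Hypothesis F1 : \int[mu]_(s in D) F s = 1.
Hypothesis G1 : \int[mu]_(s in D) G s = 1.
Hypothesis tail_le : forall t : R, (0 <= t)%R ->
  \int[mu]_(s in `]t, +oo[) F s <= \int[mu]_(s in `]t, +oo[) G s.

(** A nonempty upset is a half-line from its infimum, with or without the endpoint, so its integral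
    is a tail. *)
Lemma upset_integral_le (U : set R) : measurable U -> U `<=` D ->
  (forall s r, U s -> (s < r)%R -> U r) ->
  \int[mu]_(s in U) F s <= \int[mu]_(s in U) G s.
Proof.
move=> mU UD Uup; have [->|/set0P[u Uu]] := eqVneq U set0.
  by rewrite !integral_set0.
have Ulb : has_lbound U by exists 0%R => s /UD; rewrite /= in_itv/= andbT => /ltW.
have Uinf : has_inf U by split => //; exists u.
set t := inf U.
have t0 : (0 <= t)%R.
  by apply: lb_le_inf; [exists u|move=> s /UD; rewrite /= in_itv/= andbT => /ltW].
have Ut : `]t, +oo[%classic `<=` U.
  move=> s; rewrite /= in_itv/= andbT => ts.
  have [v Uv vs] := inf_lt (proj1 Uinf) ts.
  exact: Uup Uv vs.
have tU : U `<=` `[t, +oo[%classic.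
  by move=> s Us; rewrite /= in_itv/= andbT; exact: ge_inf.
have E (H : R -> \bar R) : measurable_fun setT H -> (forall s, 0 <= H s) ->
    \int[mu]_(s in U) H s = \int[mu]_(s in `]t, +oo[) H s.
  move=> mH H0; apply/eqP; rewrite eq_le; apply/andP; split; last first.
    by apply: ge0_subset_integral => //; exact: measurable_funTS.
  rewrite integral_itv_obnd_cbnd; last exact: measurable_funTS.
  by apply: ge0_subset_integral => //; exact: measurable_funTS.
by rewrite (E F)// (E G)//; exact: tail_le.
Qed.

(** The complement in the half-line is an upset. Both totals equal 1, so the comparison reverses
    after subtracting finite integrals. *)
Lemma downset_integral_le (L : set R) : measurable L -> L `<=` D ->
  (forall s r, L s -> (0 < r < s)%R -> L r) ->
  \int[mu]_(s in L) G s <= \int[mu]_(s in L) F s.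
Proof.
move=> mL LD Ldown.
have mU : measurable (D `\` L) by exact: measurableD.
have split_int (H : R -> \bar R) : measurable_fun setT H -> (forall s, 0 <= H s) ->
    \int[mu]_(s in D) H s = \int[mu]_(s in L) H s + \int[mu]_(s in D `\` L) H s.
  move=> mH H0; rewrite -ge0_integral_setU//.
  - by rewrite setDUK.
  - exact: measurable_funTS.
  - by apply/disj_setPS => s [Ls [_]].
have UU : \int[mu]_(s in D `\` L) F s <= \int[mu]_(s in D `\` L) G s.
  apply: upset_integral_le => //.
  move=> s r [Ds Ls] sr; have r0 : D r.
    by move: Ds; rewrite /= !in_itv/= !andbT => /lt_trans; apply.
  split => // Lr; apply: Ls; apply: Ldown Lr _.
  by move: Ds; rewrite /= in_itv/= andbT => ->.
have Gfin : \int[mu]_(s in D `\` L) G s \is a fin_num.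
  rewrite ge0_fin_numE; last by apply: integral_ge0.
  apply: (@le_lt_trans _ _ 1); last by rewrite ltry.
  rewrite -G1; apply: ge0_subset_integral => //; exact: measurable_funTS.
rewrite -(leeD2rE _ _ Gfin) -split_int// G1 -F1 split_int//.
exact: leeD2l.
Qed.

(** Since [G] is nonincreasing, [G <= c] holds on an upset. Off it [mine (G s) c] is [c], the
    largest possible value; on it, truncation leaves [G] unchanged and can only lower [F], so the
    tail comparison applies. With [c] the volume of a ball, this is majorization. *)
Lemma min_integral_le (c : \bar R) : 0 <= c ->
  (forall s r, (s <= r)%R -> G r <= G s) ->
  \int[mu]_(s in D) mine (F s) c <= \int[mu]_(s in D) mine (G s) c.
Proof.
move=> c0 Gni.
pose U : set R := D `&` [set s | G s <= c].
have mU : measurable U.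
  apply: measurableI => //; rewrite -[X in measurable X]setTI.
  exact: (measurable_lee measurableT (g := cst c)).
have mm (H : R -> \bar R) : measurable_fun setT H ->
    measurable_fun setT (fun s => mine (H s) c).
  by move=> mH; apply: measurable_mine.
have m0 (H : R -> \bar R) s : 0 <= H s -> 0 <= mine (H s) c.
  by move=> H0; rewrite le_min H0.
have split_int (H : R -> \bar R) : measurable_fun setT H -> (forall s, 0 <= H s) ->
    \int[mu]_(s in D) H s = \int[mu]_(s in D `\` U) H s + \int[mu]_(s in U) H s.
  move=> mH H0; rewrite -ge0_integral_setU//.
  - by rewrite setUC setDUK//; exact: subIsetl.
  - exact: measurableD.
  - exact: measurable_funTS.
  - by apply/disj_setPS => s [[_ +] Us].
rewrite [leLHS]split_int//; [|exact: mm|by move=> s; exact: m0].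
rewrite [leRHS]split_int//; [|exact: mm|by move=> s; exact: m0].
apply: leeD.
  apply: ge0_le_integral => //.
  - exact: measurableD.
  - by move=> s _; exact: m0.
  - exact: measurable_funTS (mm _ mF).
  - exact: measurable_funTS (mm _ mG).
  move=> s [Ds Us]; rewrite [leRHS](_ : _ = c); first by rewrite ge_min lexx orbT.
  apply/min_idPr; rewrite leNgt; apply/negP => Gc; apply: Us; split => //.
  exact: ltW.
apply: (@le_trans _ _ (\int[mu]_(s in U) F s)).
  apply: ge0_le_integral => //.
  - by move=> s _; exact: m0.
  - exact: measurable_funTS (mm _ mF).
  - exact: measurable_funTS.
  - by move=> s _; rewrite ge_min lexx.
apply: (@le_trans _ _ (\int[mu]_(s in U) G s)).
  apply: upset_integral_le => //; first exact: subIsetl.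
  move=> s r [Ds Gs] sr; split.
    by move: Ds; rewrite /= !in_itv/= !andbT => /lt_trans; apply.
  exact: le_trans (Gni _ _ (ltW sr)) Gs.
apply: ge0_le_integral => //.
- exact: measurable_funTS.
- exact: measurable_funTS (mm _ mG).
- by move=> s [_ Gs]; rewrite le_min lexx.
Qed.

(** The layer cake takes real weights, while a level volume can be infinite at levels [s <= 0]. *)
Let trunc (H : R -> \bar R) (s : R) : R := (\1_D s * fine (H s))%R.

Let measurable_trunc H : measurable_fun setT H -> measurable_fun setT (trunc H).
Proof.
move=> mH; apply: measurable_funM; first exact: measurable_indic.
exact: (measurableT_comp (fine_measurable _) mH).
Qed.

Let trunc_ge0 H : (forall s, 0 <= H s) -> forall s, (0 <= trunc H s)%R.
Proof. by move=> H0 s; rewrite mulr_ge0// fine_ge0. Qed.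

Let integral_trunc (H : R -> \bar R) (S : set R) :
  (forall s, 0 <= H s) -> (forall s, (0 < s)%R -> H s < +oo) ->
  \int[mu]_(s in S) (trunc H s)%:E = \int[mu]_(s in D `&` S) H s.
Proof.
move=> H0 Hoo; rewrite [LHS]integral_mkcond [RHS]integral_mkcond.
apply: eq_integral => s _; rewrite !patchE in_setI.
have [s0|s0] := ltP 0%R (s : R).
  rewrite [s \in D]mem_set/= ?in_itv/= ?s0//; case: ifP => // _.
  rewrite /trunc indicE mem_set/= ?in_itv/= ?s0// mul1r fineK//.
  by rewrite ge0_fin_numE// Hoo.
rewrite [s \in D]memNset/= ?in_itv/= ?andbT ?ltNge ?s0//; case: ifP => // _.
by rewrite /trunc indicE memNset/= ?mul0r// in_itv/= andbT ltNge s0.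
Qed.

Let weight_layers (k : R -> R) (H : R -> \bar R) : measurable_fun setT k ->
  (forall s, (0 <= k s)%R) ->
  measurable_fun setT H -> (forall s, 0 <= H s) ->
  (forall s, (0 < s)%R -> H s < +oo) ->
  \int[mu]_(s in D) ((k s)%:E * H s) =
  \int[mu]_(u in D) \int[mu]_(s in D `&` [set s | u%:E < (k s)%:E]) H s.
Proof.
move=> mk k0 mH H0 Hoo.
have mk' : measurable_fun setT (EFin \o k) by exact/measurable_EFinP.
have := weighted_layer_cake (@lebesgue_measure R) mk' (measurable_trunc mH)
  (@measurable_cst _ _ _ _ setT (1%R : R)) (trunc_ge0 H0) (fun=> ler01).
rewrite [X in X = _ -> _](_ : _ = \int[mu]_(s in D) ((k s)%:E * H s)); last first.
  rewrite [RHS]integral_mkcond; apply: eq_integral => s _; rewrite patchE.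
  rewrite integral_one; last first.
    apply: measurableI => //; rewrite -[X in measurable X]setTI.
    by apply: (measurable_lte measurableT) => //; exact/measurable_EFinP.
  rewrite [X in _ * X](_ : _ = (k s)%:E); last first.
    by apply: lebesgue_measure_below; rewrite lee_fin.
  have [s0|s0] := ltP 0%R (s : R).
    rewrite mem_set/= ?in_itv/= ?s0// /trunc indicE mem_set/= ?in_itv/= ?s0// mul1r.
    by rewrite fineK 1?muleC// ge0_fin_numE// Hoo.
  rewrite memNset/= ?in_itv/= ?andbT ?ltNge ?s0//.
  by rewrite /trunc indicE memNset/= ?mul0r ?mul0e// in_itv/= andbT ltNge s0.
move=> ->; apply: eq_integral => u _; rewrite mul1e; exact: integral_trunc.
Qed.

Let measurable_layer (k : R -> R) (H : R -> \bar R) : measurable_fun setT k ->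
  measurable_fun setT H -> (forall s, 0 <= H s) ->
  (forall s, (0 < s)%R -> H s < +oo) ->
  measurable_fun setT
    (fun u : R => \int[mu]_(s in D `&` [set s | u%:E < (k s)%:E]) H s).
Proof.
move=> mk mH H0 Hoo.
have HF := @measurable_fun_fubini_tonelli_F _ _ R (measurableTypeR R) R
  (@lebesgue_measure R)
  (fun q : R * R => (\1_[set s | (q.1%:E < (k s)%:E)%E] q.2 * trunc H q.2)%:E).
apply: (eq_measurable_fun (fun u : R =>
    \int[mu]_s (\1_[set s | (u%:E < (k s)%:E)%E] s * trunc H s)%:E)).
  move=> u _; rewrite -(integral_trunc _ H0 Hoo).
  exact/esym/(integral_indicM (@lebesgue_measure R)).
apply: HF.
  rewrite (_ : (fun _ => _) = (fun q : R * R =>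
     (\1_[set z : R * R | (z.1%:E < (k z.2)%:E)%E] q * trunc H q.2)%:E)).
    apply: measurable_indicM.
      rewrite -[X in measurable X]setTI.
      apply: (measurable_lte measurableT (f := fun z : R * R => z.1%:E)
        (g := fun z : R * R => (k z.2)%:E)).
        by apply/measurable_EFinP.
      by apply/measurable_EFinP; apply: (measurableT_comp mk).
    by apply: (measurableT_comp (measurable_trunc mH)).
  by apply/funext => q; rewrite !indicE.
by move=> q; rewrite lee_fin mulr_ge0// trunc_ge0.
Qed.

Hypothesis Foo : forall s, (0 < s)%R -> F s < +oo.
Hypothesis Goo : forall s, (0 < s)%R -> G s < +oo.

Let measurable_layer_set (k : R -> R) (u : R) : measurable_fun setT k ->
  measurable (D `&` [set s | u%:E < (k s)%:E]).
Proof.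
move=> mk; apply: measurableI => //; rewrite -[X in measurable X]setTI.
by apply: (measurable_lte measurableT) => //; exact/measurable_EFinP.
Qed.

(** The layers [{k > u}] of a nondecreasing weight are upsets, so the inequality holds layer by
    layer. *)
Lemma nondecreasing_weight_le (k : R -> R) : measurable_fun setT k ->
  (forall s, (0 <= k s)%R) ->
  (forall s r, (0 < s)%R -> (s < r)%R -> (k s <= k r)%R) ->
  \int[mu]_(s in D) ((k s)%:E * F s) <= \int[mu]_(s in D) ((k s)%:E * G s).
Proof.
move=> mk k0 kmono; rewrite !weight_layers//; apply: ge0_le_integral => //.
- by move=> u _; apply: integral_ge0.
- exact: measurable_funTS (measurable_layer mk mF F0 Foo).
- exact: measurable_funTS (measurable_layer mk mG G0 Goo).
move=> u _; apply: upset_integral_le.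
- exact: measurable_layer_set.
- exact: subIsetl.
move=> s r [/= Ds us] sr; have s0 : (0 < s)%R by move: Ds; rewrite in_itv/= andbT.
split; first by rewrite /= in_itv/= andbT (lt_trans s0).
by apply: lt_le_trans us _; rewrite lee_fin; exact: kmono.
Qed.

Lemma nonincreasing_weight_le (k : R -> R) : measurable_fun setT k ->
  (forall s, (0 <= k s)%R) ->
  (forall s r, (0 < s)%R -> (s < r)%R -> (k r <= k s)%R) ->
  \int[mu]_(s in D) ((k s)%:E * G s) <= \int[mu]_(s in D) ((k s)%:E * F s).
Proof.
move=> mk k0 kmono; rewrite !weight_layers//; apply: ge0_le_integral => //.
- by move=> u _; apply: integral_ge0.
- exact: measurable_funTS (measurable_layer mk mG G0 Goo).
- exact: measurable_funTS (measurable_layer mk mF F0 Foo).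
move=> u _; apply: downset_integral_le.
- exact: measurable_layer_set.
- exact: subIsetl.
move=> s r [/= Ds us] /andP[r0 rs]; split; first by rewrite /= in_itv/= andbT.
by apply: lt_le_trans us _; rewrite lee_fin; exact: kmono.
Qed.

End tail_comparison.

(** * Level volumes and rearrangements *)

Section level_volumes.
Context {R : realType} {d : nat}.
Local Notation V := 'cV[R]_d.
Local Notation leb := (@lebesgue_cV R).
Local Notation mu := (@lebesgue_measure R).
Local Notation D := (`]0%R, +oo[%classic : set R).
Local Open Scope ereal_scope.

Definition level_volume (f : V -> R) (s : R) : \bar R :=
  leb d [set x | s%:E < (f x)%:E].

Section one_density.
Variable f : V -> R.
Hypothesis mf : measurable_fun setT f.
Hypothesis f0 : forall x, (0 <= f x)%R.
Hypothesis f1 : \int[leb d]_x (f x)%:E = 1.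

Let mf' : measurable_fun setT (EFin \o f).
Proof. exact/measurable_EFinP. Qed.

Lemma measurable_level (s : R) : measurable [set x | s%:E < (f x)%:E].
Proof.
rewrite -[X in measurable X]setTI.
exact: (measurable_lte measurableT (f := cst s%:E) (g := EFin \o f)).
Qed.

Lemma measurable_level_volume : measurable_fun setT (level_volume f).
Proof. exact: (measurable_level_measure (leb d) mf'). Qed.

Lemma level_volume_ge0 s : 0 <= level_volume f s.
Proof. exact: measure_ge0. Qed.

Lemma level_volume_nonincreasing s r : (s <= r)%R ->
  level_volume f r <= level_volume f s.
Proof.
move=> sr; apply: le_measure; rewrite ?inE; [exact: measurable_level..|].
by move=> x /=; apply: le_lt_trans; rewrite lee_fin.
Qed.

Lemma level_volume_lty s : (0 < s)%R -> level_volume f s < +oo.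
Proof.
move=> s0; apply: level_measure_lty mf' _ _ s0; rewrite ?f1 ?ltry//.
Qed.

Lemma integral_level_volume : \int[mu]_(s in D) level_volume f s = 1.
Proof.
by rewrite -f1 (layer_cake (leb d) mf')// => x; rewrite lee_fin.
Qed.

Lemma excess_tail (t : R) : (0 <= t)%R ->
  excess (EFin \o f) t = \int[mu]_(s in `]t, +oo[) level_volume f s.
Proof.
move=> t0; rewrite /excess layer_cake; first last.
- by move=> x; rewrite le_max lexx orbT.
- exact: measurable_excess_integrand.
have mt : measurable (`]t, +oo[%classic : set R) by exact: measurable_itv.
rewrite [LHS]integral_mkcond [RHS]integral_mkcond.
rewrite -[RHS](ge0_integral_shift t); first last.
- by move=> s; apply: erestrict_ge0 => x _; exact: level_volume_ge0.
- apply/(measurable_restrictT _ mt); apply: measurable_funTS.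
  exact: measurable_level_volume.
apply: eq_integral => s _; rewrite !patchE.
have [s0|s0] := ltP 0%R (s : R).
  rewrite mem_set/= ?in_itv/= ?s0// mem_set/= ?in_itv/= ?ltrDr ?s0//.
  congr (leb d _); apply/seteqP; split => x /=.
    rewrite -EFinD lt_max !lte_fin ltrBrDr => /orP[//|].
    by rewrite ltNge (ltW s0).
  by rewrite -EFinD lt_max !lte_fin ltrBrDr => ->.
by rewrite !memNset//= in_itv/= ?ltrDr andbT ltNge s0.
Qed.

(** Continuity from below along [{f > t + 1/(i+1)}], which increase to [{f > t}]. It lets the
    superlevel sets of the rearrangement be described by a strict inequality, hence as open
    balls. *)
Lemma level_volume_right_continuous (t : R) (v : \bar R) :
  v < level_volume f t -> exists2 r : R, (t < r)%R & v < level_volume f r.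
Proof.
move=> vt; apply: contrapT => H; move: vt; apply/negP; rewrite -leNgt.
pose r (i : nat) : R := (t + i.+1%:R^-1)%R.
pose S (i : nat) := [set x : V | (r i)%:E < (f x)%:E].
have US : \bigcup_i S i = [set x | t%:E < (f x)%:E].
  apply/seteqP; split => x /=.
    by move=> [i _]; apply: lt_trans; rewrite lte_fin ltrDl invr_gt0.
  rewrite lte_fin => tf; have ft : (0 < f x - t)%R by rewrite subr_gt0.
  exists (Num.truncn (f x - t)^-1%R) => //; rewrite /S/= lte_fin /r -ltrBrDl.
  by rewrite invf_plt ?posrE// truncnS_gt.
have : leb d (S i) @[i --> \oo] --> leb d (\bigcup_i S i).
  apply: nondecreasing_cvg_mu.
  - by move=> i; exact: measurable_level.
  - by apply: bigcup_measurable => i _; exact: measurable_level.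
  move=> i j ij; apply/subsetPset => x /=; apply: le_lt_trans.
  by rewrite lee_fin lerD2l lef_pV2 ?posrE// ler_nat.
rewrite US => cv; rewrite /level_volume -(cvg_lim _ cv)//.
apply: lime_le; first exact: cvgP cv.
apply: nearW => i; rewrite leNgt; apply/negP => vi; apply: H.
by exists (r i) => //; rewrite ltrDl invr_gt0.
Qed.

Lemma measurable_rearrangement (fs : V -> \bar R) : is_rearrangement f fs ->
  measurable_fun setT fs.
Proof.
move=> [fs0 fsr].
have mpos (t : R) : (0 < t)%R -> measurable [set x | t%:E < fs x].
  by move=> /fsr[r [-> _]]; exact: measurable_eball.
apply: (measurability _ (ErealGenOInfty.measurableE R)).
move=> _ [_ [t ->] <-]; rewrite setTI.
rewrite [X in measurable X](_ : _ = [set x | t%:E < fs x]); last first.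
  by apply/seteqP; split => x /=; rewrite in_itv/= andbT.
have [t0|t0|->] := ltgtP t 0%R; last first.
- rewrite (_ : [set x | _] = \bigcup_(i in [set: nat]) [set x | (i.+1%:R^-1)%:E < fs x]).
    by apply: bigcup_measurable => i _; apply: mpos; rewrite invr_gt0.
  apply/seteqP; split => x /=; last first.
    by move=> [i _]; apply: lt_trans; rewrite lte_fin invr_gt0.
  have := fs0 x; case fx : (fs x) => [r| |]// _.
    rewrite lte_fin => r0; exists (Num.truncn r^-1%R) => //=.
    by rewrite fx lte_fin invf_plt ?posrE// truncnS_gt.
  by move=> _; exists 0%N => //=; rewrite fx ltry.
- exact: mpos.
rewrite (_ : [set x | _] = setT)//; apply/seteqP; split => x //= _.
by apply: lt_le_trans (fs0 x); rewrite lte_fin.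
Qed.

(** Layer cake on the ball: superlevel sets of [fs] are concentric balls, and the volume of the
    intersection of two such balls is the smaller of the two volumes. *)
Lemma integral_rearrangement (fs : V -> \bar R) (r : R) :
  is_rearrangement f fs ->
  \int[leb d]_(x in eball r) fs x =
  \int[mu]_(s in D) mine (level_volume f s) (leb d (eball r)).
Proof.
move=> fsR; have mfs := measurable_rearrangement fsR.
have [fs0 fsr] := fsR.
rewrite integral_mkcond layer_cake; first last.
- by move=> x; apply: erestrict_ge0.
- apply/(measurable_restrictT _ (measurable_eball r)).
  exact: measurable_funTS.
apply: eq_integral => s; rewrite inE/= in_itv/= andbT => s0.
have [rho [fsE vE]] := fsr s s0.
rewrite (_ : [set x | _] = eball (Num.min r rho)); last first.
  apply/seteqP; split => x; rewrite /eball/= patchE.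
    case: ifPn; last by rewrite -[point]/(0 : \bar R) lte_fin ltNge ltW.
    rewrite inE lt_min => -> sx.
    by have : [set x | s%:E < fs x] x by []; rewrite fsE.
  rewrite lt_min => /andP[xr xrho]; rewrite mem_set//.
  by have : eball rho x by []; rewrite -fsE.
have vE' : leb d (eball rho) = level_volume f s.
  by rewrite -fsE vE.
rewrite -vE'; have [rr|rr] := leP r rho.
  apply/esym/min_idPr; apply: le_measure; rewrite ?inE; [exact: measurable_eball..|].
  by move=> x; rewrite /eball/= => /lt_le_trans; apply.
apply/esym/min_idPl; apply: le_measure; rewrite ?inE; [exact: measurable_eball..|].
by move=> x; rewrite /eball/= => /lt_trans; apply.
Qed.

End one_density.
End level_volumes.

(** * Existence of the rearrangement and majorization *)

Section rearrangement_existence.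
Context {R : realType}.
Local Notation leb := (@lebesgue_cV R).
Local Open Scope ereal_scope.

(** In dimension 0 the volume of a ball does not determine its radius by a root; on a single point
    every function is its own rearrangement. *)
Lemma rearrangement_exists0 (f : 'cV[R]_0 -> R) : (forall x, (0 <= f x)%R) ->
  is_rearrangement f (EFin \o f).
Proof.
move=> f0; split=> [x|t t0]; first by rewrite lee_fin.
have E (x : 'cV[R]_0) : x = 0%R by apply/colP => -[].
have [tf|tf] := ltP t (f 0%R).
  exists 1%R; split; last by [].
  apply/seteqP; split => x; rewrite (E x) /eball/= lte_fin tf//.
  by rewrite enorm0 ltr01.
exists 0%R; split; last by [].
apply/seteqP; split => x; rewrite (E x) /eball/= lte_fin ltNge ?tf//.
by rewrite enorm0 lexx.
Qed.

Lemma rearrangement_exists n (f : 'cV[R]_n.+1 -> R) :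
  measurable_fun setT f -> (forall x, (0 <= f x)%R) ->
  \int[leb n.+1]_x (f x)%:E = 1 -> exists fs, is_rearrangement f fs.
Proof.
move=> mf f0 f1.
pose c := fine (leb n.+1 (eball 1%R)).
have cE : leb n.+1 (eball 1%R) = c%:E.
  by rewrite fineK// ge0_fin_numE// lebesgue_eball_fin.
have c0 : (0 < c)%R by rewrite -lte_fin -cE lebesgue_eball1_gt0.
have volE (a : R) : (0 <= a)%R -> leb n.+1 (eball a) = (a ^+ n.+1 * c)%:E.
  rewrite le_eqVlt => /predU1P[<-|a0]; last by rewrite lebesgue_eball// cE EFinM.
  rewrite expr0n mul0r (_ : eball _ = set0) ?measure0//.
  by apply/seteqP; split => // x; rewrite /eball/= ltNge enorm_ge0.
(* The value at [x] is the largest level whose superlevel set is bigger than the ball through [x];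
   the element 0 covers the case of no such level. *)
pose S (x : 'cV[R]_n.+1) := [set u : \bar R | u = 0 \/ exists t : R, [/\ (0 < t)%R,
  leb n.+1 (eball (enorm x)) < level_volume f t & u = t%:E]].
pose fs x := ereal_sup (S x); exists fs; split => [x|t t0].
  by apply: ereal_sup_ubound; left.
have FE : level_volume f t \is a fin_num.
  by rewrite ge0_fin_numE ?level_volume_ge0// level_volume_lty.
pose r := ((fine (level_volume f t) / c) `^ (n.+1%:R^-1))%R.
have v0 : (0 <= fine (level_volume f t))%R by rewrite fine_ge0// level_volume_ge0.
have r0 : (0 <= r)%R by rewrite powR_ge0.
have volr : leb n.+1 (eball r) = level_volume f t.
  rewrite volE// /r -powR_mulrn ?powR_ge0// -powRrM mulVf ?pnatr_eq0// powRr1.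
    by rewrite divfK ?gt_eqF// fineK.
  by rewrite divr_ge0// ltW.
have fsE : [set x | t%:E < fs x] = eball r; last first.
  by exists r; split => //; rewrite fsE volr.
rewrite [RHS](_ : _ = [set x | leb n.+1 (eball (enorm x)) < level_volume f t]); last first.
  apply/seteqP; split => x; rewrite /eball/= -volr !volE ?enorm_ge0// lte_fin
    ltr_pM2r// ltr_pXn2r// nnegrE ?enorm_ge0//.
apply/seteqP; split => x /=.
  move=> /ereal_sup_gt[u [->|[t' [t'0 xt' ->]]]].
    by rewrite lte_fin ltNge ltW.
  rewrite lte_fin => tt'; apply: lt_le_trans xt' _.
  exact: (level_volume_nonincreasing mf (ltW tt')).
move=> /(level_volume_right_continuous mf)[t' tt' xt'].
apply: (@lt_le_trans _ _ t'%:E); first by rewrite lte_fin.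
by apply: ereal_sup_ubound; right; exists t'; split => //; exact: lt_trans tt'.
Qed.

Lemma excess_majorized d (f g : 'cV[R]_d -> R) :
  measurable_fun setT f -> (forall x, (0 <= f x)%R) ->
  \int[leb d]_x (f x)%:E = 1 ->
  measurable_fun setT g -> (forall x, (0 <= g x)%R) ->
  \int[leb d]_x (g x)%:E = 1 ->
  (forall t : R, (0 <= t)%R ->
    \int[lebesgue_measure]_(s in `]t, +oo[) level_volume f s <=
    \int[lebesgue_measure]_(s in `]t, +oo[) level_volume g s) ->
  majorized f g.
Proof.
move=> mf f0 f1 mg g0 g1 fg.
have ex (h : 'cV[R]_d -> R) : measurable_fun setT h -> (forall x, (0 <= h x)%R) ->
    \int[leb d]_x (h x)%:E = 1 -> exists hs, is_rearrangement h hs.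
  case: (d) h => [|n] h mh h0 h1; last exact: rearrangement_exists.
  by exists (EFin \o h); exact: rearrangement_exists0.
have [fs fsr] := ex f mf f0 f1; have [gs gsr] := ex g mg g0 g1.
exists fs, gs; split => // r r0.
rewrite (integral_rearrangement r fsr) (integral_rearrangement r gsr).
have lv0 (h : 'cV[R]_d -> R) s : 0 <= level_volume h s by exact: level_volume_ge0.
have c0 : 0 <= leb d (eball r) by exact: measure_ge0.
apply: (min_integral_le (measurable_level_volume mf) (measurable_level_volume mg)
  (lv0 f) (lv0 g) fg c0).
by move=> s r' sr'; exact: level_volume_nonincreasing.
Qed.

End rearrangement_existence.

(** * Entropies *)

Section primitives.
Context {R : realType}.
Local Notation mu := (@lebesgue_measure R).
Local Open Scope ereal_scope.

Lemma integral_derivative_itvcc (F k : R -> R) (a b : R) : (0 < a < b)%R ->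
  (forall s : R, (0 < s)%R -> is_derive s 1%R F (k s)) ->
  (forall s : R, (0 < s)%R -> {for s, continuous k}) ->
  \int[mu]_(s in `[a, b]) (k s)%:E = (F b - F a)%:E.
Proof.
move=> /andP[a0 ab] Fk kc.
have Fc (s : R) : (0 < s)%R -> F x @[x --> s] --> F s.
  move=> s0; apply: differentiable_continuous; apply/derivable1_diffP.
  by have [] := Fk s s0.
rewrite EFinB; apply: continuous_FTC2 => //.
- apply: continuous_in_subspaceT => s; rewrite inE/= in_itv/= => /andP[as_ _].
  exact/kc/(lt_le_trans a0).
- split.
  + move=> s; rewrite in_itv/= => /andP[as_ _].
    by have [] := Fk s (lt_trans a0 as_).
  + exact/cvg_at_right_filter/Fc.
  + exact/cvg_at_left_filter/Fc/(lt_trans a0).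
- move=> s; rewrite in_itv/= => /andP[as_ _]; have := Fk s (lt_trans a0 as_).
  by move=> [_ FE]; rewrite derive1E.
Qed.

(** The derivative [k] may blow up at 0, so the fundamental theorem is applied on intervals
    exhausting []0, y]] and [F] enters through its right limit [l]. *)
Lemma integral_derivative (F k : R -> R) (y l : R) : (0 < y)%R ->
  measurable_fun setT k ->
  (forall s : R, (0 < s)%R -> is_derive s 1%R F (k s)) ->
  (forall s : R, (0 < s)%R -> {for s, continuous k}) ->
  (forall s : R, (0 < s <= y)%R -> (0 <= k s)%R) ->
  F s @[s --> 0^'+] --> l ->
  \int[mu]_(s in `]0%R, y[) (k s)%:E = (F y - l)%:E.
Proof.
move=> y0 mk Fk kc k0 Fl.
have mk' A : measurable_fun A (EFin \o k).
  by apply: measurable_funTS; exact/measurable_EFinP.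
rewrite integral_itv_bndo_bndc//.
(* The shift by two keeps [u i] strictly below [y] already for [i = 0]. *)
pose u (i : nat) : R := (y / i.+2%:R)%R.
have u0 i : (0 < u i)%R by rewrite divr_gt0.
have uy i : (u i < y)%R by rewrite ltr_pdivrMr// ltr_pMr// ltr1n.
have UE : \bigcup_i `[u i, y]%classic = `]0%R, y]%classic.
  apply/seteqP; split => s /=.
    by move=> [i _]; rewrite /= !in_itv/= => /andP[/(lt_le_trans (u0 i))-> ->].
  rewrite in_itv/= => /andP[s0 sy].
  exists (Num.truncn (y / s)%R) => //=; rewrite in_itv/= sy andbT /u.
  rewrite ler_pdivrMr// mulrC -ler_pdivrMr//; apply: ltW.
  by rewrite (lt_trans (truncnS_gt _))// ltr_nat.
have cv1 : \int[mu]_(s in `[u i, y]) (k s)%:E @[i --> \oo] -->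
    \int[mu]_(s in `]0%R, y]) (k s)%:E.
  rewrite -UE; apply: ge0_nondecreasing_set_cvg_integral => //.
  - move=> n m nm; apply/subsetPset => s /=; rewrite !in_itv/= => /andP[us ->].
    rewrite andbT (le_trans _ us)// /u ler_pM2l// lef_pV2 ?posrE// ler_nat.
    by rewrite !ltnS.
  - by move=> i; exact: mk'.
  - move=> i s /=; rewrite in_itv/= => /andP[us sy].
    by rewrite lee_fin k0// sy (lt_le_trans (u0 i)).
have cv2 : \int[mu]_(s in `[u i, y]) (k s)%:E @[i --> \oo] --> (F y - l)%:E.
  under eq_fun do rewrite (integral_derivative_itvcc (F := F)) ?u0 ?uy//.
  apply: cvg_EFin; first exact: nearW.
  apply: cvgB; first exact: cvg_cst.
  move/cvg_at_rightP : Fl; apply; split => //.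
  have : (y * i.+1%:R^-1)%R @[i --> \oo] --> (y * 0)%R.
    by apply: cvgM; [exact: cvg_cst|exact: cvg_harmonic].
  by rewrite mulr0 -(cvg_shiftS (fun i => y * i.+1%:R^-1)%R).
exact: cvg_unique cv1 cv2.
Qed.

Lemma integral_powR (a y : R) : (0 < a)%R -> (0 <= y)%R ->
  \int[mu]_(s in `]0%R, y[) (a * s `^ (a - 1))%:E = (y `^ a)%:E.
Proof.
move=> a0; rewrite le_eqVlt => /predU1P[<-|y0].
  by rewrite set_itvoo0 integral_set0 powR0 ?gt_eqF.
rewrite -[in RHS](subr0 (y `^ a)%R).
apply: (integral_derivative (F := fun s => s `^ a)%R) => //.
- by apply: measurable_funM => //; exact: measurable_powR.
- move=> s s0; apply: continuousM; first exact: cvg_cst.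
  apply: differentiable_continuous; apply/derivable1_diffP.
  by have [] := is_derive1_powR (a - 1) s0.
- by move=> s _; rewrite mulr_ge0 ?powR_ge0// ltW.
- exact: powR_cvg0.
Qed.

Let xlnx (s : R) : R := (s * ln s)%R.

Let is_derive_xlnx (s : R) : (0 < s)%R -> is_derive s 1%R xlnx (1 + ln s)%R.
Proof.
move=> s0; have ln1 := is_derive1_ln s0.
apply: is_derive_eq.
by rewrite /GRing.scale/= mulr1 mulfV// gt_eqF.
Qed.

Let is_derive_xlnx1 (s : R) : (0 < s)%R ->
  is_derive s 1%R (fun s => xlnx (s + 1)%R) (1 + ln (s + 1))%R.
Proof.
move=> s0; have s1 : (0 < s + 1)%R by rewrite addr_gt0.
have dx := is_derive_xlnx s1.
rewrite -[X in is_derive _ _ _ X]mulr1.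
exact: (is_derive1_comp (g := shift 1%R) dx (is_derive_shift s 1%R 1%R)).
Qed.

Let continuous_xlnx (s : R) : (0 < s)%R -> {for s, continuous xlnx}.
Proof.
move=> s0; apply: differentiable_continuous; apply/derivable1_diffP.
by have [] := is_derive_xlnx s0.
Qed.

Let xlnx_cvg0 : xlnx s @[s --> 0^'+] --> (0 : R)%R.
Proof.
have h : (0 < (2^-1 : R))%R by rewrite invr_gt0.
(* The bound [ln x <= x] at [x = s^(-1/2)] gives [s ln s >= - 2 s^(1/2)]. *)
apply: (@squeeze_cvgr _ _ _ _ (fun s => - 2 * s `^ (2^-1))%R (cst 0)%R).
- near=> s.
  have s0 : (0 < s)%R by near: s; exact: nbhs_right_gt.
  have s1 : (s <= 1)%R by near: s; exact: nbhs_right_le.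
  rewrite /xlnx /= mulr_ge0_le0 ?ln_le0 ?(ltW s0)// andbT.
  have : (ln (s `^ (- 2^-1)) <= s `^ (- 2^-1))%R.
    by rewrite ltW// ln_sublinear// powR_gt0.
  rewrite ln_powR => H.
  have -> : (s `^ 2^-1 = s * s `^ (- 2^-1))%R.
    rewrite -{2}(powRr1 (ltW s0)) -powRD; last by rewrite (gt_eqF s0) implybT.
    by congr (_ `^ _)%R; lra.
  by rewrite mulrCA ler_pM2l//; lra.
- by rewrite -[X in _ --> X](mulr0 (- 2)%R); apply: cvgM; [exact: cvg_cst|exact: powR_cvg0].
- exact: cvg_cst.
Unshelve. all: by end_near. Qed.

Let ln1Dx_ge0 (s : R) : (0 < s)%R -> (0 <= ln (s + 1))%R.
Proof. by move=> s0; rewrite ln_ge0// lerDr ltW. Qed.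

Let measurable_ln1Dx : measurable_fun setT (fun s : R => ln (s + 1))%R.
Proof. by apply: measurableT_comp => //; exact: measurable_funD. Qed.

Let continuous_ln (s : R) : (0 < s)%R -> {for s, continuous (@ln R)}.
Proof. exact: continuous_ln. Qed.

Let continuous_ln1Dx (s : R) : (0 < s)%R ->
  {for s, continuous (fun s : R => ln (s + 1))%R}.
Proof.
move=> s0; apply: (@cvg_comp _ _ _ (fun s : R => s + 1)%R (@ln R) _ (nbhs (s + 1)%R)).
  by apply: cvgD; [exact: cvg_id|exact: cvg_cst].
by apply: continuous_ln; rewrite addr_gt0.
Qed.

Let xlnx1_cvg0 : xlnx (s + 1)%R @[s --> 0^'+] --> (0 : R)%R.
Proof.
have x1 : xlnx 1%R = 0%R by rewrite /xlnx ln1 mulr0.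
have s1 : (s + 1)%R @[s --> (0 : R)%R] --> (1 : R)%R.
  by rewrite -[X in _ --> X]add0r; apply: cvgD; [exact: cvg_id|exact: cvg_cst].
have : xlnx x @[x --> (1 : R)%R] --> (0 : R)%R by rewrite -x1; exact: continuous_xlnx.
by move=> /(cvg_comp _ _ s1); exact: cvg_at_right_filter.
Qed.

Lemma integral_ln1Dx (y : R) : (0 <= y)%R ->
  \int[mu]_(s in `]0%R, y[) (ln (s + 1))%:E = ((y + 1) * ln (y + 1) - y)%:E.
Proof.
rewrite le_eqVlt => /predU1P[<-|y0].
  by rewrite set_itvoo0 integral_set0 add0r ln1 mulr0 subr0.
rewrite -[in RHS](subr0 (_ - y)%R).
apply: (integral_derivative (F := fun s => xlnx (s + 1) - s)%R) => //.
- move=> s s0; have := is_derive_xlnx1 s0 => ?.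
  by apply: is_derive_eq; rewrite addrAC subrr add0r.
- by move=> s /andP[s0 _]; exact: ln1Dx_ge0.
- rewrite -[X in _ --> X]subr0; apply: cvgB; first exact: xlnx1_cvg0.
  exact/cvg_at_right_filter/cvg_id.
Qed.

Lemma integral_ln1Dx_sub_ln (y : R) : (0 <= y)%R ->
  \int[mu]_(s in `]0%R, y[) (ln (s + 1) - ln s)%:E =
  ((y + 1) * ln (y + 1) - y * ln y)%:E.
Proof.
rewrite le_eqVlt => /predU1P[<-|y0].
  by rewrite set_itvoo0 integral_set0 add0r ln1 mulr0 mul0r subr0.
rewrite -[in RHS](subr0 (_ - _)%R).
apply: (integral_derivative (F := fun s => xlnx (s + 1) - xlnx s)%R) => //.
- by apply: measurable_funB => //; exact: measurable_ln.
- move=> s s0; have := is_derive_xlnx1 s0 => ?; have := is_derive_xlnx s0 => ?.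
  by apply: is_derive_eq; rewrite opprD addrACA subrr add0r.
- move=> s s0; apply: continuousB; first exact: continuous_ln1Dx.
  exact: continuous_ln.
- by move=> s /andP[s0 _]; rewrite subr_ge0 ler_ln ?posrE ?addr_gt0// lerDl.
- rewrite -[X in _ --> X]subr0; apply: cvgB; first exact: xlnx1_cvg0.
  exact: xlnx_cvg0.
Qed.

End primitives.

(** The integral of [v] may be infinite; the negative part of [u - v] then has infinite integral
    too, and both sides are [-oo]. This is the case of infinite entropy. *)
Lemma integral_ge0_sub_ge0 d (T : measurableType d) (R : realType)
  (m : {measure set T -> \bar R}) (u v : T -> R) :
  measurable_fun setT u -> measurable_fun setT v ->
  (forall x, 0 <= u x) -> (forall x, 0 <= v x) ->
  (\int[m]_x (u x)%:E < +oo)%E ->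
  (\int[m]_x (u x - v x)%:E = \int[m]_x (u x)%:E - \int[m]_x (v x)%:E)%E.
Proof.
move=> mu mv u0 v0 uoo.
have mu' : measurable_fun setT (EFin \o u) by exact/measurable_EFinP.
have mv' : measurable_fun setT (EFin \o v) by exact/measurable_EFinP.
have I0 (w : T -> R) : (forall x, 0 <= w x) -> (0 <= \int[m]_x (w x)%:E)%E.
  by move=> w0; apply: integral_ge0 => x _; rewrite lee_fin.
have integrable_fin (w : T -> R) : measurable_fun setT (EFin \o w) ->
    (forall x, 0 <= w x) -> (\int[m]_x (w x)%:E < +oo)%E ->
    m.-integrable setT (EFin \o w).
  move=> mw w0 woo; apply/integrableP; split => //.
  by under eq_integral do rewrite /= ger0_norm//.
have [voo|] := ltP (\int[m]_x (v x)%:E)%E +oo%E.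
  by rewrite -integralB_EFin//; exact: integrable_fin.
rewrite leye_eq => /eqP vE; rewrite vE.
pose h x := (u x - v x)%:E.
have mh : measurable_fun setT h by apply/measurable_EFinP; exact: measurable_funB.
have hp : (\int[m]_x h^\+ x < +oo)%E.
  apply: le_lt_trans uoo; apply: ge0_le_integral => //.
  - exact: measurable_funepos.
  - by move=> x _; rewrite funeposE /h ge_max !lee_fin gerBl u0 v0.
have hn : (\int[m]_x h^\- x = +oo)%E.
  have : (\int[m]_x (v x)%:E <= \int[m]_x (u x)%:E + \int[m]_x h^\- x)%E.
    rewrite -ge0_integralD//; last 2 first.
    - by move=> x _; rewrite lee_fin.
    - exact: measurable_funeneg.
    apply: ge0_le_integral => //.
    - by move=> x _; rewrite lee_fin.
    - by apply: emeasurable_funD => //; exact: measurable_funeneg.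
    move=> x _; apply: (@le_trans _ _ ((u x)%:E + - h x)%E).
      by rewrite /h -EFinN -EFinD lee_fin opprB addrC subrK.
    by rewrite leeD2l// funenegE le_max lexx.
  rewrite vE leye_eq => H; apply/eqP; apply: contraTT H.
  by rewrite -!ltey; exact: lte_add_pinfty.
rewrite integralE -/h hn; have hpf : (\int[m]_x h^\+ x)%E \is a fin_num.
  by rewrite ge0_fin_numE//; apply: integral_ge0 => x _; exact: funepos_ge0.
have uf : (\int[m]_x (u x)%:E)%E \is a fin_num by rewrite ge0_fin_numE// I0.
by rewrite /= -(fineK hpf) -(fineK uf).
Qed.

(** * Comparison of the entropies *)

Section entropy_comparison.
Context {R : realType} {d : nat}.
Local Notation V := 'cV[R]_d.
Local Notation leb := (@lebesgue_cV R).
Local Notation mu := (@lebesgue_measure R).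
Local Notation D := (`]0%R, +oo[%classic : set R).
Local Open Scope ereal_scope.

(* The absolute value only makes the weight [k] nonnegative off the half-line. *)
Lemma integral_weighted_level_volume (f : V -> R) (k F : R -> R) :
  measurable_fun setT f -> (forall x, (0 <= f x)%R) ->
  measurable_fun setT k -> (forall s : R, (0 < s)%R -> (0 <= k s)%R) ->
  (forall y : R, (0 <= y)%R -> \int[mu]_(s in `]0%R, y[) (k s)%:E = (F y)%:E) ->
  \int[leb d]_x (F (f x))%:E =
  \int[mu]_(s in D) (`|k s|%:E * level_volume f s).
Proof.
move=> mf f0 mk k0 kF.
have mf' : measurable_fun setT (EFin \o f) by exact/measurable_EFinP.
have mk' : measurable_fun setT (fun s => `|k s|%R) by exact: measurableT_comp.
have m1 : measurable_fun setT (cst 1%R : V -> R) by exact: measurable_cst.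
have := @weighted_layer_cake _ _ _ (leb d) _ (cst 1%R) (fun s => `|k s|)%R
  mf' m1 mk' (fun _ => ler01) (fun s => normr_ge0 _).
under eq_integral => x _.
  rewrite mul1e (_ : D `&` _ = `]0%R, f x[%classic); last first.
    apply/seteqP; split => s /=; rewrite !in_itv/= andbT lte_fin.
      by move=> [-> ->].
    by move=> /andP[].
  rewrite (_ : \int[mu]_(s in _) _ = (F (f x))%:E); first over.
  rewrite -kF//; apply: eq_integral => s; rewrite inE/= in_itv/= => /andP[s0 _].
  by rewrite ger0_norm// k0.
move=> ->; apply: eq_integral => s _; congr (_ * _).
by rewrite (integral_cst (leb d) (measurable_level mf s) 1%E) mul1e.
Qed.

Variables f g : V -> R.
Hypothesis mf : measurable_fun setT f.
Hypothesis f0 : forall x, (0 <= f x)%R.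
Hypothesis f1 : \int[leb d]_x (f x)%:E = 1.
Hypothesis mg : measurable_fun setT g.
Hypothesis g0 : forall x, (0 <= g x)%R.
Hypothesis g1 : \int[leb d]_x (g x)%:E = 1.
Hypothesis tail_le : forall t : R, (0 <= t)%R ->
  \int[mu]_(s in `]t, +oo[) level_volume f s <=
  \int[mu]_(s in `]t, +oo[) level_volume g s.

Lemma nondecreasing_derivative_integral_le (k F : R -> R) :
  measurable_fun setT k -> (forall s : R, (0 < s)%R -> (0 <= k s)%R) ->
  (forall s r : R, (0 < s)%R -> (s < r)%R -> (k s <= k r)%R) ->
  (forall y : R, (0 <= y)%R -> \int[mu]_(s in `]0%R, y[) (k s)%:E = (F y)%:E) ->
  \int[leb d]_x (F (f x))%:E <= \int[leb d]_x (F (g x))%:E.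
Proof.
move=> mk k0 kmono kF.
rewrite (integral_weighted_level_volume mf f0 mk k0 kF).
rewrite (integral_weighted_level_volume mg g0 mk k0 kF).
apply: (nondecreasing_weight_le (measurable_level_volume mf)
  (measurable_level_volume mg) (level_volume_ge0 f) (level_volume_ge0 g)
  tail_le
  (level_volume_lty mf f0 f1) (level_volume_lty mg g0 g1)
  (k := fun s => `|k s|%R)) => [|s|s r s0 sr].
- exact: measurableT_comp.
- exact: normr_ge0.
- by rewrite !ger0_norm ?k0// ?(lt_trans s0)// kmono.
Qed.

Lemma nonincreasing_derivative_integral_le (k F : R -> R) :
  measurable_fun setT k -> (forall s : R, (0 < s)%R -> (0 <= k s)%R) ->
  (forall s r : R, (0 < s)%R -> (s < r)%R -> (k r <= k s)%R) ->
  (forall y : R, (0 <= y)%R -> \int[mu]_(s in `]0%R, y[) (k s)%:E = (F y)%:E) ->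
  \int[leb d]_x (F (g x))%:E <= \int[leb d]_x (F (f x))%:E.
Proof.
move=> mk k0 kmono kF.
rewrite (integral_weighted_level_volume mf f0 mk k0 kF).
rewrite (integral_weighted_level_volume mg g0 mk k0 kF).
apply: (nonincreasing_weight_le (measurable_level_volume mf)
  (measurable_level_volume mg) (level_volume_ge0 f) (level_volume_ge0 g)
  (integral_level_volume mf f0 f1) (integral_level_volume mg g0 g1) tail_le
  (level_volume_lty mf f0 f1) (level_volume_lty mg g0 g1)
  (k := fun s => `|k s|%R)) => [|s|s r s0 sr].
- exact: measurableT_comp.
- exact: normr_ge0.
- by rewrite !ger0_norm ?k0// ?(lt_trans s0)// kmono.
Qed.

(** The derivative [a s^(a - 1)] decreases for [a < 1] and increases for [a > 1]; the sign of
    [1 - a] changes at the same point, so the entropies compare the same way. *)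
Lemma renyi_entropy_le_neq1 (a : R) : (0 < a)%R -> a != 1%R ->
  renyi_entropy a g <= renyi_entropy a f.
Proof.
move=> a0 a1; rewrite /renyi_entropy (negbTE a1).
have mk : measurable_fun setT (fun s : R => a * s `^ (a - 1))%R.
  by apply: measurable_funM => //; exact: measurable_powR.
have k0 (s : R) : (0 < s)%R -> (0 <= a * s `^ (a - 1))%R.
  by move=> _; rewrite mulr_ge0 ?powR_ge0// ltW.
have I0 (h : V -> R) : \int[leb d]_x (h x `^ a)%:E \in `[0, +oo].
  rewrite in_itv/= leey andbT; apply: integral_ge0 => x _.
  by rewrite lee_fin powR_ge0.
have [alt|agt|aE] := ltgtP a 1%R; last by rewrite aE eqxx in a1.
- rewrite lee_wpmul2l ?lee_fin ?invr_ge0 ?subr_ge0 ?(ltW alt)// lee_lne//.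
  apply: (nonincreasing_derivative_integral_le (F := fun y => y `^ a)%R mk k0) => [s r s0 sr|y y0].
    rewrite ler_pM2l// -(opprB 1%R) !powRN lef_pV2 ?posrE ?powR_gt0//.
      by rewrite ge0_ler_powR ?nnegrE ?subr_ge0// ltW// (lt_trans s0).
    exact: lt_trans sr.
  exact: integral_powR.
- rewrite -(opprB a 1%R) invrN EFinN !mulNe leeN2.
  rewrite lee_wpmul2l ?lee_fin ?invr_ge0 ?subr_ge0 ?(ltW agt)// lee_lne//.
  apply: (nondecreasing_derivative_integral_le (F := fun y => y `^ a)%R mk k0) => [s r s0 sr|y y0].
    rewrite ler_pM2l// ge0_ler_powR ?nnegrE ?subr_ge0 ?(ltW agt)// ltW//.
    exact: lt_trans sr.
  exact: integral_powR.
Qed.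

(** Primitives of [ln (y + 1)] and [ln (y + 1) - ln y], vanishing with [y]: they separate the
    behaviour of [y ln y] at large values from that near 0. *)
Let b (y : R) : R := ((y + 1) * ln (y + 1) - y)%R.
Let c (y : R) : R := ((y + 1) * ln (y + 1) - y * ln y)%R.

Let measurable_xlnx : measurable_fun setT (fun y : R => y * ln y)%R.
Proof. by apply: measurable_funM => //; exact: measurable_ln. Qed.

Let measurable_xlnx1 : measurable_fun setT (fun y : R => (y + 1) * ln (y + 1))%R.
Proof.
by apply: (@measurableT_comp _ _ _ _ _ _ (fun y : R => y * ln y)%R _ (fun y : R => y + 1)%R)
  => //; exact: measurable_funD.
Qed.

Let ln1Dx_ge0 (s : R) : (0 < s)%R -> (0 <= ln (s + 1))%R.
Proof. by move=> s0; rewrite ln_ge0// lerDr ltW. Qed.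

Let ln1Dx_sub_ln_ge0 (s : R) : (0 < s)%R -> (0 <= ln (s + 1) - ln s)%R.
Proof.
by move=> s0; rewrite subr_ge0 ler_ln ?posrE ?addr_gt0// lerDl.
Qed.

Let b_ge0 (y : R) : (0 <= y)%R -> (0 <= b y)%R.
Proof.
move=> y0; rewrite -lee_fin -integral_ln1Dx//.
apply: integral_ge0 => s /=; rewrite in_itv/= => /andP[s0 _].
by rewrite lee_fin ln1Dx_ge0.
Qed.

Let c_ge0 (y : R) : (0 <= y)%R -> (0 <= c y)%R.
Proof.
move=> y0; rewrite -lee_fin -integral_ln1Dx_sub_ln//.
apply: integral_ge0 => s /=; rewrite in_itv/= => /andP[s0 _].
by rewrite lee_fin ln1Dx_sub_ln_ge0.
Qed.

(* [y ln y = b y + y - c y], where [b] has a nondecreasing and [c] a nonincreasing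
   nonnegative derivative; [c] alone may have an infinite integral. *)
Let integral_xlnx (h : V -> R) : measurable_fun setT h -> (forall x, (0 <= h x)%R) ->
  \int[leb d]_x (h x)%:E = 1 -> \int[leb d]_x (b (h x))%:E < +oo ->
  \int[leb d]_x (h x * ln (h x))%:E =
  \int[leb d]_x (b (h x))%:E + 1 - \int[leb d]_x (c (h x))%:E.
Proof.
move=> mh h0 h1 bh.
have mb : measurable_fun setT (fun x => b (h x)).
  by apply: measurableT_comp => //; exact: measurable_funB.
have mc : measurable_fun setT (fun x => c (h x)).
  by apply: measurableT_comp => //; exact: measurable_funB.
have bhE : \int[leb d]_x (b (h x) + h x)%:E = \int[leb d]_x (b (h x))%:E + 1.
  under eq_integral do rewrite EFinD.
  rewrite ge0_integralD ?h1//.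
  - by move=> x _; rewrite lee_fin b_ge0.
  - exact/measurable_EFinP.
  - by move=> x _; rewrite lee_fin h0.
  - exact/measurable_EFinP.
rewrite -bhE -integral_ge0_sub_ge0//.
- by apply: eq_integral => x _; congr EFin; rewrite /b /c; lra.
- exact: measurable_funD.
- by move=> x; rewrite addr_ge0// b_ge0.
- by move=> x; rewrite c_ge0.
- by rewrite bhE lte_add_pinfty// ltry.
Qed.

(** From [ln (y + 1) <= y] one gets [b y <= y ln (y + 1)], so a bounded [g] has [b] of finite
    integral. The comparison passes finiteness on to [f], and no difference [oo - oo] occurs in
    either entropy. *)
Lemma renyi_entropy_le1 (M : R) : {ae leb d, forall x, (g x <= M)%R} ->
  renyi_entropy 1%R g <= renyi_entropy 1%R f.
Proof.
move=> gM; rewrite /renyi_entropy eqxx leeN2.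
pose L := ln (Num.max M 0 + 1)%R.
have bg : \int[leb d]_x (b (g x))%:E < +oo.
  apply: (@le_lt_trans _ _ (\int[leb d]_x (L%:E * (g x)%:E))).
    apply: ae_ge0_le_integral => //.
    - by move=> x _; rewrite lee_fin b_ge0.
    - apply/measurable_EFinP; apply: measurableT_comp => //; exact: measurable_funB.
    - move=> x _; rewrite mule_ge0 ?lee_fin// ln_ge0// lerDr.
      by rewrite le_max lexx orbT.
    - apply/measurable_EFinP; exact: measurable_funM.
    - apply: filterS gM => x gxM _; rewrite -EFinM lee_fin /b.
      have gx1 : (ln (g x + 1) <= g x)%R.
        by rewrite addrC le_ln1Dx// (lt_le_trans _ (g0 x))// ltrN10.
      have gL : (ln (g x + 1) <= L)%R.
        rewrite /L ler_ln ?posrE ?lerD2r ?le_max ?gxM//.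
          by rewrite ltr_wpDl.
        by rewrite ltr_wpDl// le_max lexx orbT.
      have := ler_wpM2r (g0 x) gL; nra.
  rewrite ge0_integralZl//.
  - by rewrite g1 mule1 ltry.
  - exact/measurable_EFinP.
  - by move=> x _; rewrite lee_fin.
  - by rewrite lee_fin ln_ge0// lerDr le_max lexx orbT.
have bfg : \int[leb d]_x (b (f x))%:E <= \int[leb d]_x (b (g x))%:E.
  apply: (@nondecreasing_derivative_integral_le (fun s => ln (s + 1))%R) => //.
  - by apply: measurableT_comp => //; exact: measurable_funD.
  - move=> s r s0 sr; rewrite ler_ln ?posrE ?lerD2r ?(ltW sr)// addr_gt0//.
    exact: lt_trans sr.
  - exact: integral_ln1Dx.
have cgf : \int[leb d]_x (c (g x))%:E <= \int[leb d]_x (c (f x))%:E.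
  apply: (@nonincreasing_derivative_integral_le (fun s => ln (s + 1) - ln s)%R) => //.
  - apply: measurable_funB; last exact: measurable_ln.
    by apply: measurableT_comp => //; exact: measurable_funD.
  - move=> s r s0 sr; have r0 := lt_trans s0 sr.
    rewrite lerBlDr addrAC lerBrDr -!lnM ?posrE ?addr_gt0//.
    by rewrite ler_ln ?posrE ?mulr_gt0 ?addr_gt0//; nra.
  - exact: integral_ln1Dx_sub_ln.
rewrite integral_xlnx// ?(le_lt_trans bfg)// integral_xlnx//.
by apply: leeB => //; exact: leeD2r.
Qed.

End entropy_comparison.

(** * Sums of independent vectors *)

Section densities_of_random_vectors.
Context {R : realType} {d : nat}.
Local Notation V := 'cV[R]_d.
Local Notation leb := (@lebesgue_cV R).
Context {disp : measure_display} {Omega : measurableType disp}.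
Variable P : probability Omega R.
Local Open Scope ereal_scope.

Lemma is_density_integral (Y : Omega -> V) f : is_density P Y f ->
  \int[leb d]_x (f x)%:E = 1.
Proof.
move=> [_ _ /(_ _ measurableT)]; rewrite /pushforward preimage_setT.
by rewrite probability_setT => <-.
Qed.

Lemma is_density_unique (Y : Omega -> V) f g :
  is_density P Y f -> is_density P Y g -> {ae leb d, forall x, f x = g x}.
Proof.
move=> fY gY; have [mf f0 fE] := fY; have [mg g0 gE] := gY.
apply: density_unique => //.
  by rewrite (is_density_integral fY) ltry.
by move=> A mA; rewrite -fE// gE.
Qed.

Lemma is_density_ae (Y : Omega -> V) (f g : V -> R) : is_density P Y f ->
  measurable_fun setT g -> (forall x, (0 <= g x)%R) ->
  {ae leb d, forall x, f x = g x} -> is_density P Y g.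
Proof.
move=> [mf f0 fE] mg g0 fg; split => // A mA; rewrite fE//.
apply: ae_eq_integral => //.
- by apply: measurable_funTS; exact/measurable_EFinP.
- by apply: measurable_funTS; exact/measurable_EFinP.
- by apply: filterS fg => x -> _.
Qed.

Lemma log_concave_density (Y : Omega -> V) : log_concave P Y ->
  exists2 f, is_density P Y f & log_concave_fun f.
Proof.
by move=> [phi [phiNy cphi [f fY fE]]]; exists f => //; exact: expeR_log_concave fE.
Qed.

(** The two hypotheses on [W] supply two densities that agree almost everywhere; invariance is
    carried from the radial to the log-concave one, which is then made even. *)
Lemma radial_log_concave_density (W : Omega -> V) :
  log_concave P W -> radially_symmetric P W ->
  exists v, [/\ is_density P W v, log_concave_fun v, ae_rotation_invariant v &
    forall z, (v z <= v 0%R)%R].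
Proof.
move=> /log_concave_density[w wW w_lc] [r rW r_rad].
have wr := is_density_unique wW rW; have [mw w0 _] := wW.
have w_rot : ae_rotation_invariant w.
  move=> O OO; have := ae_orthogonal OO wr; apply: filterS2 wr => x wx wOx.
  by rewrite wOx wx; apply: r_rad; exact: enorm_orthogonal.
have [v [mv v0 v_lc wv v_max]] := log_concave_even_version mw w0 w_lc w_rot.
exists v; split => //; first exact: is_density_ae wW mv v0 wv.
move=> O OO; have := ae_orthogonal OO wv; have := w_rot O OO.
by apply: filterS3 wv => x <- <- <-.
Qed.

End densities_of_random_vectors.

Lemma excess_shift (R : realType) d (F : 'cV[R]_d -> \bar R) (b : 'cV[R]_d) t :
  measurable_fun setT F -> excess (fun z => F (z - b)) t = excess F t.
Proof.
move=> mF; rewrite /excess.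
rewrite (ge0_integral_cV_shift (- b) (f := fun z => (maxe (F z - t%:E) 0)%E))//.
- exact: measurable_excess_integrand.
- by move=> x; rewrite le_max lexx orbT.
Qed.

Theorem corollary2p6 (R : realType) (d : nat) (disp : measure_display)
    (Omega : measurableType disp) (P : probability Omega R)
    (X W : {RV P >-> 'cV[R]_d}) (T : 'cV[R]_d -> 'cV[R]_d) :
  log_concave P X ->
  log_concave P W -> radially_symmetric P W ->
  independent_vectors P X W ->
  affine_contraction T ->
  let XW := fun omega => X omega + W omega in
  let TXW := fun omega => T (X omega) + W omega in
  [/\ (exists f, is_density P XW f), (exists g, is_density P TXW g) &
    forall f g : 'cV[R]_d -> R,
      is_density P XW f -> is_density P TXW g ->
      majorized f g /\
      forall alpha : R, 0 < alpha ->
        (renyi_entropy alpha g <= renyi_entropy alpha f)%E].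
Proof.
move=> /log_concave_density[p [mp p0 pX] p_lc] W_lc W_rad XW_indep.
move=> [[A [b TE]] T_contr] XW TXW.
have [v [vW v_lc v_rot v_max]] := radial_log_concave_density W_lc W_rad.
have [mv v0 vE] := vW.
have A_contr x : enorm (A *m x) <= enorm x.
  have := T_contr x 0; rewrite !TE mulmx0 add0r addrK.
  by rewrite subr0.
pose m := distribution P X.
pose f0 z := fine (smoothing m v 1%:M (z - 0)).
pose g0 z := fine (smoothing m v A (z - b)).
have f0XW : is_density P XW f0.
  rewrite (_ : XW = fun omega => (1%:M *m X omega + 0) + W omega).
    exact: (affine_sum_density XW_indep 1%:M 0 mv v0 v_max vE).
  by apply/funext => omega; rewrite mul1mx addr0.
have g0TXW : is_density P TXW g0.
  rewrite (_ : TXW = fun omega => (A *m X omega + b) + W omega).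
    exact: (affine_sum_density XW_indep A b mv v0 v_max vE).
  by apply/funext => omega; rewrite /TXW TE.
have smoothing_fin C z : smoothing m v C z \is a fin_num.
  rewrite ge0_fin_numE ?smoothing_ge0//.
  by apply: le_lt_trans (ltry (v 0)); exact: smoothing_le.
split; [by exists f0|by exists g0|move=> f g fXW gTXW].
have [mf f_ge0 _] := fXW; have [mg g_ge0 _] := gTXW.
have [mf0 _ _] := f0XW; have [mg0 _ _] := g0TXW.
have f1 := is_density_integral fXW; have g1 := is_density_integral gTXW.
have ff0 := is_density_unique fXW f0XW.
have gg0 := is_density_unique gTXW g0TXW.
(* The excess sees neither null sets nor the translation part [c], so any density can be replaced by
   the smoothed one. *)
have excess_density (h h0 : 'cV[R]_d -> R) C c t : measurable_fun setT h ->
    measurable_fun setT h0 -> (forall z, h0 z = fine (smoothing m v C (z - c))) ->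
    {ae lebesgue_cV R d, forall x, h x = h0 x} ->
    excess (EFin \o h) t = excess (smoothing m v C) t.
  move=> mh mh0 h0E hh0.
  rewrite -(excess_shift c t (measurable_smoothing m mv v0 C)).
  transitivity (excess (EFin \o h0) t).
    apply: excess_ae; [exact/measurable_EFinP|exact/measurable_EFinP|].
    by apply: filterS hh0 => x /= ->.
  by congr (excess _ t); apply/funext => z /=; rewrite h0E fineK.
have v_lty : (\int[lebesgue_cV R d]_z (v z)%:E < +oo)%E.
  by rewrite (is_density_integral vW) ltry.
have tail (t : R) : 0 <= t ->
    (\int[lebesgue_measure]_(s in `]t, +oo[) level_volume f s <=
     \int[lebesgue_measure]_(s in `]t, +oo[) level_volume g s)%E.
  (* At [t = 0] both tails are the total mass 1; the excess inequality covers positive levels, where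
     superlevel sets have finite volume. *)
  rewrite le_eqVlt => /predU1P[<-|t0].
    by rewrite (integral_level_volume mf f_ge0 f1) (integral_level_volume mg g_ge0 g1).
  rewrite -(excess_tail mf (ltW t0)) -(excess_tail mg (ltW t0)).
  rewrite (excess_density f f0 1%:M 0 t mf mf0 (fun _ => erefl) ff0).
  rewrite (excess_density g g0 A b t mg mg0 (fun _ => erefl) gg0).
  rewrite -[X in (_ <= excess (smoothing _ _ X) _)%E](mulmx1 A).
  exact: (@excess_smoothing_contraction R d m v p A 1%:M t mv v0 v_lty v_lc v_rot
    mp p0 p_lc (@integral_density R d m p mp p0 pX) A_contr t0).
split; first exact: excess_majorized.
move=> alpha alpha0; have [->|alpha1] := eqVneq alpha 1; last first.
  exact: renyi_entropy_le_neq1.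
apply: (renyi_entropy_le1 mf f_ge0 f1 mg g_ge0 g1 tail (M := v 0)).
apply: filterS gg0 => z ->; rewrite -lee_fin fineK//; exact: smoothing_le.
Qed.
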